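(* Let $d\ge 1$, let $M$ be a compact metric space, $f:M\to M$ a map preserving a Borel probability measure $\nu$, $\tau:M\to\mathbb{Z}^d$ measurable, $X=M\times\mathbb{Z}^d$, $\mu=\nu\times(\text{counting measure on }\mathbb{Z}^d)$, and $T(y,z)=(f(y),z+\tau(y))$ on $X$. Suppose that $T$ satisfies the mixing local limit theorem (MLLT) at some scale $L_n$. Then (a) $T$ is local global mixing with respect to $\mathbb{G}_O$; (b) $T$ is global global mixing with respect to $\mathbb{G}_{AO}$.
   Context: Notation: $\tau_n(y)=\sum_{j=0}^{n-1}\tau(f^j(y))$. $X$ carries the product metric ($\mathbb{Z}^d$ discrete), $\mu(\phi)=\int\phi\,d\mu$, $\nu(\phi)=\int\phi\,d\nu$, and $\lfloor\cdot\rfloor$ is the coordinatewise lower integer part. MLLT at scale $L_n$ ($L_n>0$, $L_n\to\infty$): there is a bounded continuous $p:\mathbb{R}^d\to[0,\infty)$ with $\int_{\mathbb{R}^d}p(z)\,dz=1$ such that for all $\phi_1,\phi_2\in C(M)$, every $\mathbb{Z}^d$-valued sequence $z_n^0$ with $z_n^0/L_n\to0$ and every $K<\infty$, $$\lim_{n\to\infty}\sup_{z\in\mathbb{R}^d,|z|<K}\Big|L_n^d\int\phi_1(y)\phi_2(f^n(y))\mathbf 1_{\tau_n(y)=z_n^0+\lfloor zL_n\rfloor}\,d\nu(y)-\nu(\phi_1)\nu(\phi_2)p(z)\Big|=0.$$ Cubes: a cube with center $z\in\mathbb{Z}^d$ and size $w\in\mathbb{Z}_+$ is $V=M\times\big((z+(-\lfloor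 w/2\rfloor,w-\lfloor w/2\rfloor]^d)\cap\mathbb{Z}^d\big)$. $\mathbb{G}_O$: bounded uniformly continuous $\Phi:X\to\mathbb{R}$ for which there is $\bar\Phi\in\mathbb{R}$ such that for all real $a_j<b_j$, $j=1,\dots,d$, $$\lim_{N\to\infty}\frac{1}{\prod_j(b_jN-a_jN)}\int_{\{(y,z):\,z\in\prod_j[a_jN,b_jN]\}}\Phi\,d\mu=\bar\Phi.$$ $\mathbb{G}_{AO}$: bounded uniformly continuous $\Phi:X\to\mathbb{R}$ for which there is $\bar\Phi\in\mathbb{R}$ such that for every $\varepsilon>0$ there are $b=b(\varepsilon),B_0=B_0(\varepsilon)\in\mathbb{Z}_+$ such that for all $B>B_0$ the number of $z\in(-B/2,B/2]^d\cap\mathbb{Z}^d$ for which the cube $V$ centered at $z$ of size $b$ satisfies $\big|\frac1{\mu(V)}\int_V\Phi\,d\mu-\bar\Phi\big|\le\varepsilon$ is greater than $(1-\varepsilon)B^d$. Local global mixing with respect to a space $\mathbb{G}$ of such functions: for every $\phi\in L^1(\mu)$ and $\Phi\in\mathbb{G}$, $\lim_{n\to\infty}\int\phi(x)\Phi(T^nx)\,d\mu(x)=\mu(\phi)\bar\Phi$. Global global mixing with respect to $\mathbb{G}_{AO}$: for all $\Phi_1,\Phi_2\in\mathbb{G}_{AO}$, $$\lim_{n\to\infty}\limsup_{V\in\mathcal V,\mu(V)\to\infty}\frac1{\mu(V)}\int_V\Phi_1(x)\Phi_2(T^nx)\,d\mu=\lim_{n\to\infty}\liminf_{V\in\mathcal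 V,\mu(V)\to\infty}\frac1{\mu(V)}\int_V\Phi_1(x)\Phi_2(T^nx)\,d\mu=\bar\Phi_1\bar\Phi_2,$$ where $\mathcal V$ is the collection of cubes containing $M\times\{0\}$. *)

(* Defs.v *)
From HB Require Import structures.
From mathcomp Require Import all_boot all_order all_algebra.
From mathcomp Require Import all_classical all_reals all_analysis.

Set Implicit Arguments.
Unset Strict Implicit.
Unset Printing Implicit Defensive.

Import Order.TTheory GRing.Theory Num.Theory.
Import numFieldNormedType.Exports.

Local Open Scope classical_set_scope.
Local Open Scope ring_scope.

(* Compatibility of the two structures (measurable = Borel) is not part of the
   join; it is the separate predicate [borel_space]. *)
#[short(type="measurableMetricType")]
HB.structure Definition MeasurableMetric (disp : measure_display)
    (R : numDomainType) :=
  { M of Metric R M & Measurable disp M }.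

Definition borel_space (disp : measure_display) (R : numDomainType)
    (M : measurableMetricType disp R) : Prop :=
  (measurable : set (set M)) = <<s (@open M) >>.

(* An alias of ['rV[int]_d] that can carry the discrete uniformity and
   sigma-algebra: the uniformity on row vectors comes from the one on the
   entries, and [int] has none. *)
Definition Zd (d : nat) : Type := 'rV[int]_d.

HB.instance Definition _ d := Countable.copy (Zd d) 'rV[int]_d.
HB.instance Definition _ d := GRing.Zmodule.copy (Zd d) 'rV[int]_d.
HB.instance Definition _ d := isPointed.Build (Zd d) 0.
HB.instance Definition _ d := hasNbhs.Build (Zd d) principal_filter.
HB.instance Definition _ d := Discrete_ofNbhs.Build (Zd d) erefl.
HB.instance Definition _ d := DiscreteUniform_ofNbhs.Build (Zd d).
HB.instance Definition _ {R : numDomainType} d :=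
  @DiscretePseudoMetric_ofUniform.Build R (Zd d).
HB.instance Definition _ d := @isMeasurable.Build default_measure_display
  (Zd d) discrete_measurable discrete_measurable0
  discrete_measurableC discrete_measurableU.

Definition coordZ (d : nat) (z : Zd d) (i : 'I_d) : int :=
  (z : 'rV[int]_d) ord0 i.

Definition Zd_to_Rd (R : realType) (d : nat) (z : Zd d) : 'rV[R]_d :=
  \row_i (coordZ z i)%:~R.

Definition floorZd (R : realType) (d : nat) (z : 'rV[R]_d) : Zd d :=
  (\row_i Num.floor (z ord0 i) : 'rV[int]_d).

(* [counting] is already declared sigma-finite at type [nat]; a separate head
   constant is needed to declare it sigma-finite on Z^d as well. *)
Section counting_Zd.
Context (R : realType) (d : nat).

Definition counting_Zd : set (Zd d) -> \bar R := counting.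

HB.instance Definition _ := Measure.copy counting_Zd (@counting (Zd d) R).

Lemma sigma_finite_counting_Zd : sigma_finite [set: Zd d] counting_Zd.
Proof.
exists (fun n => [set z : Zd d | pickle z = n]).
  by apply/seteqP; split=> // z _; exists (pickle z).
move=> n; split => //; rewrite /counting_Zd /counting asboolT ?ltry//.
have [[z zn]|nz] := pselect (exists z : Zd d, pickle z = n).
  apply: (@sub_finite_set _ _ [set z]); last exact: finite_set1.
  by move=> u /= un; apply: (pcan_inj pickleK); rewrite un zn.
rewrite (_ : [set _ | _] = set0)//.
by apply/seteqP; split=> // u /= un; case: nz; exists u.
Qed.

HB.instance Definition _ := Measure_isSigmaFinite.Build _ _ _
  counting_Zd sigma_finite_counting_Zd.

End counting_Zd.

(* Lebesgue measure on R^n, as the iterated product of the one-dimensional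
   Lebesgue measure; it lives on [n.-tuple R], whose sigma-algebra is generated
   by the coordinates (hence is the Borel one). *)
Section lebesgue_tuple.
Context (R : realType).
Local Notation RT := (measurableTypeR R).

Definition cons_pair (n : nat) (x : RT * n.-tuple RT) : n.+1.-tuple RT :=
  [the n.+1.-tuple RT of x.1 :: x.2].

Definition uncons_pair (n : nat) (t : n.+1.-tuple RT) : RT * n.-tuple RT :=
  (tnth t ord0, [tuple of behead t]).

Lemma cons_pairK n : cancel (@cons_pair n) (@uncons_pair n).
Proof.
move=> [x t]; rewrite /uncons_pair /cons_pair tnth0 /=; congr pair.
exact: val_inj.
Qed.

Lemma measurable_cons_pair n : measurable_fun setT (@cons_pair n).
Proof. exact: measurable_cons. Qed.

Lemma measurable_uncons_pair n : measurable_fun setT (@uncons_pair n).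
Proof.
apply: measurable_fun_pair; first exact: measurable_tnth.
exact: measurable_behead.
Qed.

Section cons_measure.
Context (n : nat) (m : {sigma_finite_measure set (n.-tuple RT) -> \bar R}).

Definition cons_measure : set (n.+1.-tuple RT) -> \bar R :=
  pushforward ((@lebesgue_measure R \x m)%E) (@cons_pair n).

Let preimage_measurable A : measurable A -> measurable (@cons_pair n @^-1` A).
Proof.
by move=> mA; rewrite -[X in measurable X]setTI; exact: measurable_cons_pair.
Qed.

Let cons_measure0 : cons_measure set0 = 0%E.
Proof. by rewrite /cons_measure /pushforward preimage_set0 measure0. Qed.

Let cons_measure_ge0 A : (0 <= cons_measure A)%E.
Proof. by rewrite /cons_measure /pushforward; exact: measure_ge0. Qed.

Let cons_measure_sigma_additive : semi_sigma_additive cons_measure.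
Proof.
move=> F mF tF mUF; rewrite /cons_measure /pushforward preimage_bigcup.
apply: measure_semi_sigma_additive.
- by move=> k; exact: preimage_measurable.
- apply/trivIsetP => /= i j _ _ ij; rewrite -preimage_setI.
  by move/trivIsetP : tF => /(_ _ _ _ _ ij) ->//; rewrite preimage_set0.
- by rewrite -preimage_bigcup; exact: preimage_measurable.
Qed.

HB.instance Definition _ := isMeasure.Build _ _ _ cons_measure
  cons_measure0 cons_measure_ge0 cons_measure_sigma_additive.

Let sigma_finite_cons_measure : sigma_finite setT cons_measure.
Proof.
have /sigma_finiteP[F [TF ndF Foo]] := sigma_finiteT (@lebesgue_measure R).
have /sigma_finiteP[G [TG ndG Goo]] := sigma_finiteT m.
exists (fun k => @uncons_pair n @^-1` (F k `*` G k)).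
  rewrite -preimage_bigcup; apply/seteqP; split=> // t _ /=.
  have [i _ Fi] : (\bigcup_i F i) (uncons_pair t).1 by rewrite -TF.
  have [j _ Gj] : (\bigcup_i G i) (uncons_pair t).2 by rewrite -TG.
  exists (maxn i j) => //; split => /=.
  - by move: Fi; exact/subsetPset/ndF/leq_maxl.
  - by move: Gj; exact/subsetPset/ndG/leq_maxr.
move=> k; have [mF Fkoo] := Foo k; have [mG Gkoo] := Goo k; split.
  rewrite -[X in measurable X]setTI; apply: measurable_uncons_pair => //.
  exact: measurableX.
rewrite /cons_measure /pushforward (_ : _ @^-1` _ = F k `*` G k).
  by rewrite product_measure1E// lte_mul_pinfty// ge0_fin_numE.
by rewrite -comp_preimage (_ : _ \o _ = id)//; apply/funext/cons_pairK.
Qed.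

HB.instance Definition _ := Measure_isSigmaFinite.Build _ _ _
  cons_measure sigma_finite_cons_measure.

End cons_measure.

Fixpoint lebesgue_tuple (n : nat) :
    {sigma_finite_measure set (n.-tuple RT) -> \bar R} :=
  if n is n'.+1 then [the sigma_finite_measure _ _ of
                        cons_measure (lebesgue_tuple n')]
  else [the sigma_finite_measure _ _ of \d_([tuple] : 0.-tuple RT)].

Definition integral_Rd (d : nat) (p : 'rV[R]_d -> R) : \bar R :=
  (\int[lebesgue_tuple d]_t (p (\row_i tnth t i))%:E)%E.

End lebesgue_tuple.

Section skew_product.
Context (disp : measure_display) (R : realType)
  (M : measurableMetricType disp R) (d : nat).
Implicit Types (nu : probability M R) (f : M -> M) (tau : M -> Zd d).

Definition measure_preserving nu f : Prop :=
  measurable_fun setT f /\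
  (forall A : set M, measurable A -> nu (f @^-1` A) = nu A).

Definition birkhoff_sum f tau (n : nat) (y : M) : Zd d :=
  \sum_(j < n) tau (iter j f y).

Definition skew_map f tau (x : M * Zd d) : M * Zd d := (f x.1, x.2 + tau x.1).

Definition skew_measure nu : {measure set (M * Zd d) -> \bar R} :=
  [the measure _ _ of (nu \x @counting_Zd R d)%E].

(* Only the radii K > 0 are considered: for K <= 0 the range of the supremum is
   empty, and the supremum in the extended reals is -oo. *)
Definition MLLT nu f tau (L : nat -> R) : Prop :=
  [/\ forall n, 0 < L n,
      L @ \oo --> +oo &
      exists p : 'rV[R]_d -> R,
      [/\ continuous p, bounded_fun p, (forall z, 0 <= p z),
          integral_Rd p = 1%E &
          forall (phi1 phi2 : M -> R) (z0 : nat -> Zd d) (K : R),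
          continuous phi1 -> continuous phi2 ->
          (L n)^-1 *: Zd_to_Rd R (z0 n) @[n --> \oo] --> (0 : 'rV[R]_d) ->
          0 < K ->
          ereal_sup [set (`| L n ^+ d *
              (\int[nu]_y (phi1 y * phi2 (iter n f y) *
                 \1_[set y' | birkhoff_sum f tau n y' =
                              z0 n + floorZd (L n *: z)] y))
              - (\int[nu]_y phi1 y) * (\int[nu]_y phi2 y) * p z |)%:E
            | z in [set z : 'rV[R]_d | `|z| < K]] @[n --> \oo] --> 0%E]].

Definition cube (z : Zd d) (w : nat) : set (M * Zd d) :=
  [set x | forall i : 'I_d,
     (coordZ z i - (w %/ 2)%:Z < coordZ x.2 i
      <= coordZ z i + (w - w %/ 2)%:Z)].

Definition average nu (V : set (M * Zd d)) (g : M * Zd d -> R) : R :=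
  (fine (skew_measure nu V))^-1 * \int[skew_measure nu]_(x in V) g x.

(* A class of global observables is represented by its graph: the relation
   between an observable Phi and its average. *)
Definition global_observables : Type := (M * Zd d -> R) -> R -> Prop.

Definition GO nu : global_observables := fun Phi Phibar =>
  [/\ bounded_fun Phi, unif_continuous Phi &
      forall a b : 'I_d -> R, (forall j, a j < b j) ->
        (\prod_j (b j * N%:R - a j * N%:R))^-1 *
          \int[skew_measure nu]_(x in
            [set x | forall j, a j * N%:R <= (coordZ x.2 j)%:~R <= b j * N%:R])
            Phi x
        @[N --> \oo] --> Phibar].

Definition good_centers nu (Phi : M * Zd d -> R) (Phibar eps : R)
    (b B : nat) : set (Zd d) :=
  [set z | (forall i, - (B%:R / 2) < ((coordZ z i)%:~R : R) <= B%:R / 2) /\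
           `| average nu (cube z b) Phi - Phibar | <= eps].

Definition GAO nu : global_observables := fun Phi Phibar =>
  [/\ bounded_fun Phi, unif_continuous Phi &
      forall eps : R, 0 < eps ->
      exists b B0 : nat,
      [/\ (0 < b)%N, (0 < B0)%N &
          forall B : nat, (B0 < B)%N ->
          (((1 - eps) * B%:R ^+ d)%:E <
           counting_Zd R (good_centers nu Phi Phibar eps b B))%E]].

Definition local_global_mixing nu (T : M * Zd d -> M * Zd d)
    (G : global_observables) : Prop :=
  forall (phi Phi : M * Zd d -> R) (Phibar : R),
    (skew_measure nu).-integrable setT (EFin \o phi) -> G Phi Phibar ->
    \int[skew_measure nu]_x (phi x * Phi (iter n T x)) @[n --> \oo] -->
      (\int[skew_measure nu]_x phi x) * Phibar.

(* The collection of cubes containing M x {0}, indexed by center and size, with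
   the filter "mu(V) tends to infinity". *)
Definition cubes_through0 : set (Zd d * nat) :=
  [set zw | (0 < zw.2)%N /\ [set x | x.2 = 0] `<=` cube zw.1 zw.2].

Definition large_cubes nu : set_system (Zd d * nat) :=
  filter_from [set: R] (fun C => cubes_through0 `&`
    [set zw | (C%:E < skew_measure nu (cube zw.1 zw.2))%E]).

Definition global_global_mixing nu (T : M * Zd d -> M * Zd d)
    (G : global_observables) : Prop :=
  forall (Phi1 Phi2 : M * Zd d -> R) (Phi1bar Phi2bar : R),
    G Phi1 Phi1bar -> G Phi2 Phi2bar ->
    let avg (n : nat) (zw : Zd d * nat) : \bar R :=
      (average nu (cube zw.1 zw.2) (fun x => Phi1 x * Phi2 (iter n T x)))%:E in
    (limf_esup (avg n) (large_cubes nu) @[n --> \oo]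
       --> (Phi1bar * Phi2bar)%:E) /\
    (limf_einf (avg n) (large_cubes nu) @[n --> \oo]
       --> (Phi1bar * Phi2bar)%:E).

End skew_product.

(* Main.v *)
Require Import Defs.
From mathcomp Require Import all_boot all_order all_algebra.
From mathcomp Require Import all_classical all_reals all_analysis.
From mathcomp Require Import measurable_realfun.
From mathcomp Require Import ring lra zify.

(** Write [tau_n] for the Birkhoff sums of [tau], so that
    [T^n (y, z) = (f^n y, z + tau_n y)]. Both statements follow from one fact
    about the triple (starting point [y], end point [f^n y], displacement
    [tau_n y]): its components become independent, and the displacement,
    rescaled by [L n], gets the density [p].

    This is made quantitative by comparing with Lebesgue measure. For continuous
    [phi1], [phi2] let [r_n t] be [L n ^+ d] times the integral of
    [phi1 * phi2 \o f^n] over the set where [tau_n + e] is the rounded point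
    [floor (L n t)]. Lattice cells have volume [L n ^- d], so integrating
    [r_n t * h (floor (L n t))] over [t] gives back the integral of
    [phi1 * phi2 \o f^n * h (tau_n + e)] ([cell_decomposition]). The local limit
    theorem makes [r_n] converge pointwise to [nu phi1 * nu phi2 * p]; as the total
    mass is [1] for [phi1 = phi2 = 1], the argument of Scheffe upgrades this to
    convergence in mean ([density_cvg_in_mean]). Hence the integral of
    [phi1 * phi2 \o f^n * h (tau_n + e)] is close to
    [nu phi1 * nu phi2 * lattice_mean p (L n) h], uniformly over bounded [h]
    ([asymptotic_independence]), where [lattice_mean] averages [h] over rounded
    points with density [p]. Comparing a shift [e] with the shift [0] shows that
    these means are asymptotically translation invariant ([lattice_mean_shift]).
    A partition of unity on the compact space [M] extends the decoupling to pairs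
    of uniformly continuous observables, uniformly in the fibre
    ([skew_decoupling]); from there on, an observable only matters through its
    fibre averages, a bounded function on [Zd d].

    For local global mixing it remains to see that [lattice_mean p (L n) A] tends
    to the average of [A] when the averages of [A] over dilated boxes converge:
    these averages give the weak limit of [A (floor (L n t))] on boxes, and [p] is
    approximated in mean by combinations of indicators of boxes
    ([lattice_mean_cvg]). Continuous functions are dense in [L1 nu], and the
    fibres are summed up by dominated convergence.

    For global global mixing, translation invariance allows one to replace the
    fibre averages of the second observable by their averages over blocks of a
    fixed size ([lattice_mean_block]). These are close to the global average
    except on a set of centers of small density, and a cube through the origin,
    even shifted by a bounded vector, cannot meet too many of those
    ([shifted_block_dev]). So the inner mean may be replaced by a constant, and
    what is left is the average of the first observable over a large cube through
    the origin ([box_mean_through0]). *)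


Set Implicit Arguments.
Unset Strict Implicit.
Unset Printing Implicit Defensive.

Import Order.TTheory GRing.Theory Num.Theory.
Import numFieldNormedType.Exports.
Local Open Scope classical_set_scope.
Local Open Scope ring_scope.

(** * Boxes and lattice cells in Euclidean space *)

Section lebesgue_boxes.
Context (R : realType).
Local Notation RT := (measurableTypeR R).

Lemma measurable_tuple_box (n : nat) (A : 'I_n -> set RT) :
  (forall i, measurable (A i)) ->
  measurable [set t : n.-tuple RT | forall i, A i (tnth t i)].
Proof.
move=> mA.
rewrite (_ : mkset _ = \bigcap_(i in [set: 'I_n]) ((fun t => tnth t i) @^-1` A i)).
  apply: fin_bigcap_measurable => [|i _]; first exact: finite_finset.
  rewrite -[X in measurable X]setTI.
  by apply: (measurable_tnth i) => //; exact: mA.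
by apply/seteqP; split=> t /= tA i; [move=> _; exact: tA|exact: (tA i I)].
Qed.

Lemma lebesgue_tuple_box (n : nat) (A : 'I_n -> set RT) :
  (forall i, measurable (A i)) ->
  lebesgue_tuple R n [set t | forall i, A i (tnth t i)] =
    (\prod_(i < n) (lebesgue_measure (A i)))%E.
Proof.
elim: n A => [|n IHn] A mA.
  rewrite big_ord0 /= (_ : mkset _ = setT) ?diracT//.
  by apply/seteqP; split=> // t _ [].
rewrite big_ord_recl -IHn; last by move=> i; exact: mA.
rewrite /= /cons_measure /pushforward.
rewrite (_ : _ @^-1` _ = A ord0 `*` [set t | forall i, A (lift ord0 i) (tnth t i)]).
  rewrite product_measure1E//.
  exact: (@measurable_tuple_box n (fun i => A (lift ord0 i)) (fun i => mA _)).
apply/seteqP; split=> [[x t] /= xtA|[x t] /= [xA tA] i].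
  split; first by have := xtA ord0; rewrite tnth0.
  by move=> i; have := xtA (lift ord0 i); rewrite tnthS.
by have [j ->|->] := unliftP ord0 i; rewrite ?tnth0 ?tnthS.
Qed.

End lebesgue_boxes.

Section lattice.
Context (R : realType) (d : nat).
Local Notation RT := (measurableTypeR R).
Local Notation D := (d.-tuple RT).
Local Notation lam := (lebesgue_tuple R d).

Lemma measurable_fun_from_Zd disp (T : measurableType disp) (g : Zd d -> T) :
  measurable_fun setT g.
Proof. by []. Qed.

(** A map into the countable set [Zd d] is measurable as soon as its fibres
    are. *)
Lemma measurable_fun_to_Zd disp (T : measurableType disp) (g : T -> Zd d) :
  (forall u, measurable [set t | g t = u]) -> measurable_fun setT g.
Proof.
move=> mg _ A _; rewrite setTI.
rewrite (_ : _ @^-1` A =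
    \bigcup_(k in [set k | exists2 u, A u & pickle u = k])
      [set t | pickle (g t) = k]).
  apply: bigcup_measurable => k [u Au <-].
  rewrite (_ : mkset _ = [set t | g t = u])//.
  apply/seteqP; split=> t /= gt; last by rewrite gt.
  exact: (pcan_inj pickleK).
apply/seteqP; split=> [t /= At|t [k [u Au <-]] /= gt].
  by exists (pickle (g t)) => //; exists (g t).
by rewrite /= (pcan_inj pickleK gt).
Qed.

(** The row vector with the entries of the tuple [t]: densities are defined on
    row vectors, the Lebesgue measure on tuples. *)
Definition row_of (t : D) : 'rV[R]_d := \row_i tnth t i.

(** The index of the lattice cell of side [1/s] in which [t] lies. *)
Definition cell_index (s : R) (t : D) : Zd d := floorZd (s *: row_of t).

Lemma cell_indexE (s : R) (t : D) (i : 'I_d) :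
  coordZ (cell_index s t) i = Num.floor (s * tnth t i).
Proof. by rewrite /coordZ /cell_index /floorZd !mxE. Qed.

Lemma Zd_eqP (u v : Zd d) : u = v <-> (forall i, coordZ u i = coordZ v i).
Proof.
by split=> [->//|uv]; apply/rowP => i; exact: uv.
Qed.

Lemma cellE (s : R) (u : Zd d) : 0 < s ->
  [set t | cell_index s t = u] =
  [set t : D | forall i, `[((coordZ u i)%:~R / s)%R,
                            ((coordZ u i + 1)%:~R / s)%R[%classic (tnth t i)].
Proof.
move=> s0; apply/seteqP; split=> t /=.
  move=> <- i /=; rewrite in_itv/= cell_indexE ler_pdivrMr// ltr_pdivlMr//.
  by rewrite mulrC floor_le_tmp/= floorD1_gt.
move=> tu; apply/Zd_eqP => i; rewrite cell_indexE; apply: floor_def.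
have := tu i; rewrite in_itv/= ler_pdivrMr// ltr_pdivlMr//.
by rewrite mulrC.
Qed.

Lemma measurable_cell (s : R) (u : Zd d) : 0 < s ->
  measurable [set t | cell_index s t = u].
Proof.
move=> s0; rewrite cellE//.
apply: (@measurable_tuple_box _ _ (fun i => `[((coordZ u i)%:~R / s)%R,
                            ((coordZ u i + 1)%:~R / s)%R[%classic)) => i.
exact: measurable_itv.
Qed.

Lemma lebesgue_tuple_cell (s : R) (u : Zd d) : 0 < s ->
  lam [set t | cell_index s t = u] = (s^-1 ^+ d)%:E.
Proof.
move=> s0; rewrite cellE//.
rewrite (@lebesgue_tuple_box _ _ (fun i => `[((coordZ u i)%:~R / s)%R,
                            ((coordZ u i + 1)%:~R / s)%R[%classic));
  last by move=> i; exact: measurable_itv.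
rewrite (eq_bigr (fun=> s^-1%:E)).
  by rewrite prodEFin prodr_const card_ord.
move=> i _; rewrite lebesgue_measure_itv/= lte_fin ltr_pM2r ?invr_gt0//.
rewrite ltr_int ltrDl ltr01 -EFinD -mulrBl -intrB.
by rewrite addrAC subrr add0r mul1r.
Qed.

Lemma measurable_cell_index (s : R) : 0 < s ->
  measurable_fun setT (cell_index s).
Proof.
by move=> s0; apply: measurable_fun_to_Zd => u; exact: measurable_cell.
Qed.

End lattice.

(** * Real-valued integrals *)

Lemma cvg0_le (R : realType) (T : Type) (F : set_system T) (FF : Filter F)
    (u v : T -> R) :
  (forall n, `|u n| <= v n) -> v n @[n --> F] --> (0 : R) ->
  u n @[n --> F] --> (0 : R).
Proof.
move=> uv v0; apply/norm_cvg0P.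
apply: (@squeeze_cvgr _ _ _ _ (fun=> 0) v) => //; last exact: cvg_cst.
by apply: nearW => n; rewrite normr_ge0 uv.
Qed.

Section real_integrals.
Context disp (Y : measurableType disp) (R : realType).
Variable m : {measure set Y -> \bar R}.
Local Notation L1 g := (m.-integrable setT (EFin \o g)).

Lemma L1_measurable (g : Y -> R) : L1 g -> measurable_fun setT g.
Proof. by move=> /integrableP[/measurable_EFinP]. Qed.

Lemma L1_le (g h : Y -> R) : measurable_fun setT g -> L1 h ->
  (forall y, `|g y| <= h y) -> L1 g.
Proof.
move=> mg ih gh; apply: (le_integrable measurableT _ _ ih).
  exact/measurable_EFinP.
move=> y _ /=; rewrite lee_fin (le_trans (gh y))//.
exact: ler_norm.
Qed.

Lemma L1_norm (g : Y -> R) : L1 g -> L1 (fun y => `|g y|).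
Proof. by move=> ig; exact: integrable_norm. Qed.

Lemma L1D (g h : Y -> R) : L1 g -> L1 h -> L1 (fun y => g y + h y).
Proof.
move=> ig ih; rewrite (_ : EFin \o _ = ((EFin \o g) \+ (EFin \o h))%E)//.
exact: integrableD.
Qed.

Lemma L1B (g h : Y -> R) : L1 g -> L1 h -> L1 (fun y => g y - h y).
Proof.
move=> ig ih; rewrite (_ : EFin \o _ = ((EFin \o g) \- (EFin \o h))%E)//.
exact: integrableB.
Qed.

Lemma L1Z (c : R) (g : Y -> R) : L1 g -> L1 (fun y => c * g y).
Proof.
move=> ig; rewrite (_ : EFin \o _ = (fun y => c%:E * (EFin \o g) y)%E)//.
exact: integrableZl.
Qed.

Lemma L1_sum (I : Type) (r : seq I) (P : pred I) (g : I -> Y -> R) :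
  (forall i, P i -> L1 (g i)) -> L1 (fun y => \sum_(i <- r | P i) g i y).
Proof.
move=> ig.
rewrite (_ : EFin \o _ = (fun y => \sum_(i <- r | P i) (g i y)%:E)%E).
  exact: (@integrable_sum _ _ _ m setT measurableT I r P (fun i => EFin \o g i)).
by apply/funext => y /=; rewrite sumEFin.
Qed.

Lemma L1_mul_bounded (C : R) (g h : Y -> R) : L1 g -> measurable_fun setT h ->
  (forall y, `|h y| <= C) -> L1 (fun y => g y * h y).
Proof.
move=> ig mh hC; apply: (@L1_le _ (fun y => C * `|g y|)).
- by apply: measurable_funM => //; exact: L1_measurable.
- by apply: L1Z; exact: L1_norm.
- by move=> y; rewrite normrM mulrC ler_wpM2r.
Qed.

Lemma L1_bounded (C : R) (h : Y -> R) : (m setT < +oo)%E ->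
  measurable_fun setT h -> (forall y, `|h y| <= C) -> L1 h.
Proof.
move=> moo mh hC; apply: measurable_bounded_integrable => //.
exists C; split; first exact: num_real.
by move=> M CM y _ /=; rewrite (le_trans (hC y))// ltW.
Qed.

Lemma Rint_sum (I : Type) (r : seq I) (P : pred I) (g : I -> Y -> R) :
  (forall i, P i -> L1 (g i)) ->
  \int[m]_y (\sum_(i <- r | P i) g i y) = \sum_(i <- r | P i) \int[m]_y g i y.
Proof.
move=> ig; elim: r => [|i r IHr].
  rewrite big_nil; under eq_Rintegral do rewrite big_nil.
  by rewrite Rintegral_cst// mul0r.
rewrite big_cons; under eq_Rintegral do rewrite big_cons.
have [Pi|nPi] := boolP (P i); last exact: IHr.
by rewrite RintegralD// ?IHr//; [exact: ig|exact: L1_sum].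
Qed.

Lemma le_norm_Rint (g h : Y -> R) : measurable_fun setT g -> L1 h ->
  (forall y, `|g y| <= h y) -> `|\int[m]_y g y| <= \int[m]_y h y.
Proof.
move=> mg ih gh; have ig := L1_le mg ih gh.
rewrite (le_trans (le_normr_Rintegral _ ig))//.
by apply: le_Rintegral => //; exact: L1_norm.
Qed.

Lemma le_norm_RintB (g1 g2 h : Y -> R) : L1 g1 -> L1 g2 -> L1 h ->
  (forall y, `|g1 y - g2 y| <= h y) ->
  `|\int[m]_y g1 y - \int[m]_y g2 y| <= \int[m]_y h y.
Proof.
move=> i1 i2 ih gh; rewrite -RintegralB//; apply: le_norm_Rint => //.
by apply: measurable_funB; exact: L1_measurable.
Qed.

Lemma Rint_indic (A : set Y) : measurable A -> \int[m]_y \1_A y = fine (m A).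
Proof. by move=> mA; rewrite /Rintegral integral_indic// setIT. Qed.

Lemma EFin_Rint (g : Y -> R) : L1 g ->
  (\int[m]_y g y)%:E = (\int[m]_y (g y)%:E)%E.
Proof. by move=> ig; rewrite /Rintegral fineK//; exact: integrable_fin_num. Qed.

(** Dominated convergence for real-valued functions. *)
Lemma Rint_dominated_cvg (g_ : nat -> Y -> R) (g h : Y -> R) :
  (forall n, measurable_fun setT (g_ n)) -> measurable_fun setT g -> L1 h ->
  {ae m, forall y n, `|g_ n y| <= h y} ->
  {ae m, forall y, g_ n y @[n --> \oo] --> g y} ->
  \int[m]_y g_ n y @[n --> \oo] --> \int[m]_y g y.
Proof.
move=> mg_ mg ih gh gg.
have [||||ig _ ] := @dominated_convergence _ _ _ m setT measurableT
  (fun n => EFin \o g_ n) (EFin \o g) (EFin \o h) _ _ _ ih.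
- by move=> n; exact/measurable_EFinP.
- exact/measurable_EFinP.
- by apply: filterS gg => y gy _; apply/cvg_EFin; [exact: nearW|exact: gy].
- by apply: filterS gh => y ghy n _; rewrite lee_fin ghy.
move=> cv; rewrite /Rintegral; apply: fine_cvg.
by rewrite fineK//; exact: integrable_fin_num.
Qed.

End real_integrals.

Section probability_integrals.
Context disp (Y : measurableType disp) (R : realType) (P : probability Y R).

Lemma prob_lty : (P setT < +oo)%E.
Proof. by rewrite probability_setT ltry. Qed.

Lemma Rint_prob_cst (c : R) : \int[P]_y c = c.
Proof. by rewrite Rintegral_cst// (congr1 fine (probability_setT P)) mulr1. Qed.

Lemma prob_L1_bounded (C : R) (h : Y -> R) :
  measurable_fun setT h -> (forall y, `|h y| <= C) ->
  P.-integrable setT (EFin \o h).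
Proof. by move=> mh hC; exact: (L1_bounded prob_lty mh hC). Qed.

Lemma prob_L1_cst (c : R) : P.-integrable setT (EFin \o (fun=> c)).
Proof. exact: (@prob_L1_bounded `|c|). Qed.

Lemma Rint_prob_le (C : R) (h : Y -> R) :
  measurable_fun setT h -> (forall y, `|h y| <= C) -> `|\int[P]_y h y| <= C.
Proof.
move=> mh hC; rewrite -[leRHS](Rint_prob_cst C).
by apply: le_norm_Rint => //; exact: prob_L1_cst.
Qed.

End probability_integrals.

(** * Integrals as averages over lattice cells *)

Section cell_decomposition.
Context (R : realType) (d : nat) disp (Y : measurableType disp)
  (m : {sigma_finite_measure set Y -> \bar R}).
Local Notation RT := (measurableTypeR R).
Local Notation D := (d.-tuple RT).
Local Notation lam := (lebesgue_tuple R d).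
Variables (sig : Y -> Zd d) (G : Y -> R) (s : R).
Hypotheses (s0 : 0 < s) (msig : measurable_fun setT sig)
  (iG : m.-integrable setT (EFin \o G)).

(** The coincidence set of two measurable maps into [Zd d]. *)
Lemma measurable_Zd_graph disp' (T : measurableType disp') (g h : T -> Zd d) :
  measurable_fun setT g -> measurable_fun setT h ->
  measurable [set t | g t = h t].
Proof.
move=> mg mh; rewrite (_ : mkset _ = \bigcup_k
    ((g @^-1` [set u | pickle u = k]) `&` (h @^-1` [set u | pickle u = k]))).
  apply: bigcup_measurable => k _; apply: measurableI.
    by rewrite -[X in measurable X]setTI; exact: mg.
  by rewrite -[X in measurable X]setTI; exact: mh.
apply/seteqP; split=> [t /= gh|t [k _ []/= <- hg]].
  by exists (pickle (g t)) => //=; rewrite gh.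
exact/esym/(pcan_inj pickleK hg).
Qed.

(** The density at [t] of the image of [G m] under [sig], smeared out uniformly
    over the cells of side [1/s]. *)
Definition cell_density (t : D) : R :=
  s ^+ d * \int[m]_y (G y * \1_[set y' | sig y' = cell_index s t] y).

Let H (yt : Y * D) : \bar R :=
  (s ^+ d * (G yt.1 * \1_[set yt | sig yt.1 = cell_index s yt.2] yt))%:E.

Let indicE (t : D) (y : Y) :
  \1_[set yt | sig yt.1 = cell_index s yt.2] (y, t) =
  \1_[set y' | sig y' = cell_index s t] y :> R.
Proof.
by rewrite !indicE; congr ((_ : bool)%:R); apply/idP/idP; rewrite !inE.
Qed.

Let indicE2 (t : D) (y : Y) :
  \1_[set yt | sig yt.1 = cell_index s yt.2] (y, t) =
  \1_[set t' | cell_index s t' = sig y] t :> R.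
Proof.
by rewrite !indicE; congr ((_ : bool)%:R); apply/idP/idP; rewrite !inE/=.
Qed.

Let mH : measurable_fun setT H.
Proof.
apply/measurable_EFinP; apply: measurable_funM => //.
apply: measurable_funM.
  exact: (measurableT_comp (L1_measurable iG)).
apply: measurable_indic; apply: measurable_Zd_graph.
  exact: (measurableT_comp msig).
exact: (measurableT_comp (measurable_cell_index s0) measurable_snd).
Qed.

Let sd_gt0 : 0 < s ^+ d. Proof. exact: exprn_gt0. Qed.

Let int_indic (y : Y) :
  (\int[lam]_t (\1_[set t' | cell_index s t' = sig y] t)%:E)%E =
    ((s ^+ d)^-1)%:E.
Proof.
have mc := measurable_cell (sig y) s0.
by rewrite integral_indic// setIT -exprVn; exact: lebesgue_tuple_cell.
Qed.

Let iind (y : Y) :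
  lam.-integrable setT (EFin \o \1_[set t' | cell_index s t' = sig y]).
Proof.
have mc := measurable_cell (sig y) s0.
apply/integrableP; split; first exact/measurable_EFinP/measurable_indic.
under eq_integral => t _ do rewrite /= ger0_norm//.
by rewrite int_indic ltry.
Qed.

Let iH : (m \x lam)%E.-integrable setT H.
Proof.
apply/integrable12ltyP => //.
have /integrableP[_] := iG; apply: le_lt_trans.
rewrite le_eqVlt; apply/orP; left; apply/eqP; apply: eq_integral => y _ /=.
under eq_integral => t _.
  rewrite indicE2 !normrM (@ger0_norm _ (\1__ _))//.
  rewrite (gtr0_norm sd_gt0) EFinM EFinM muleA.
  over.
rewrite integralZl//= -?EFinM ?int_indic//; last exact: iind.
by rewrite -EFinM mulrAC divff ?mul1r ?gt_eqF.
Qed.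

Lemma cell_densityE (t : D) : (cell_density t)%:E = (\int[m]_y H (y, t))%E.
Proof.
rewrite /cell_density -RintegralZl//; last first.
  apply: (@L1_mul_bounded _ _ _ _ 1) => //.
    by apply: measurable_indic; exact: measurable_Zd_graph.
  by move=> y; rewrite ger0_norm// indicE; case: (_ \in _).
rewrite EFin_Rint; last first.
  apply: L1Z; apply: (@L1_mul_bounded _ _ _ _ 1) => //.
    by apply: measurable_indic; exact: measurable_Zd_graph.
  by move=> y; rewrite ger0_norm// indicE; case: (_ \in _).
by apply: eq_integral => y _; rewrite /H indicE.
Qed.

Lemma L1_cell_density : lam.-integrable setT (EFin \o cell_density).
Proof.
rewrite (_ : EFin \o _ = fubini_G m H); last first.
  by apply/funext => t /=; rewrite cell_densityE.
have mG := measurable_fubini_G iH.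
apply/integrableP; split => //.
apply: le_lt_trans ((integrable21ltyP m lam mH).1 iH).
apply: ge0_le_integral => //=.
- exact: measurableT_comp.
- apply: (measurable_fun_fubini_tonelli_G (abse \o H)) => //=.
  exact: measurableT_comp.
- move=> t _; apply: le_abse_integral => //.
  exact: measurableT_comp.
Qed.

(** An integral over [Y] is the Lebesgue integral of its cell density: by Fubini,
    since each cell of side [1/s] has volume [s ^- d]. *)
Lemma cell_decomposition : \int[m]_y G y = \int[lam]_t cell_density t.
Proof.
apply: EFin_inj; rewrite !EFin_Rint//; last exact: L1_cell_density.
transitivity (\int[lam]_t fubini_G m H t)%E; last first.
  by apply: eq_integral => t _; rewrite cell_densityE.
rewrite integral21_prod_meas1// -integral12_prod_meas1//.
apply: eq_integral => y _; rewrite /fubini_F /H /=.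
under eq_integral => t _.
  rewrite indicE2 mulrA EFinM; over.
rewrite integralZl//= ?int_indic; last exact: iind.
by rewrite -EFinM mulrAC divff ?mul1r ?gt_eqF.
Qed.

End cell_decomposition.

(** * Asymptotic independence from the local limit theorem *)

Section continuous_functions.
Context disp (R : realType) (M : measurableMetricType disp R).

Lemma continuous_measurable (g : M -> R) : borel_space M -> continuous g ->
  measurable_fun setT g.
Proof.
move=> Mb cg; apply: (measurability _ (RGenOInfty.measurableE R)) => //.
move=> /= _ [_ [x ->] <-]; rewrite setTI Mb; apply: sub_sigma_algebra.
by move/continuousP : cg; apply; exact: interval_open.
Qed.

Lemma continuous_bounded (g : M -> R) : compact [set: M] -> continuous g ->
  exists2 C : R, 0 <= C & forall y, `|g y| <= C.
Proof.
move=> Mc cg.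
have : compact (g @` setT).
  by apply: continuous_compact => //; exact: continuous_subspaceT.
move/compact_bounded => [C [_ gC]]; exists (`|C| + 1) => [|y].
  by rewrite addr_ge0.
apply: (gC (`|C| + 1)); last by exists y.
by rewrite (le_lt_trans (ler_norm C))// ltrDl.
Qed.

End continuous_functions.

Section measurable_dynamics.
Context disp (R : realType) (M : measurableMetricType disp R) (d : nat).
Variables (f : M -> M) (tau : M -> Zd d).
Hypotheses (mf : measurable_fun setT f) (mtau : measurable_fun setT tau).

Lemma measurable_iter (n : nat) : measurable_fun setT (iter n f).
Proof.
elim: n => [|n IHn]; first exact: measurable_id.
exact: (measurableT_comp mf IHn).
Qed.

Lemma measurable_ZdD disp' (T : measurableType disp') (g h : T -> Zd d) :
  measurable_fun setT g -> measurable_fun setT h ->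
  measurable_fun setT (fun t => g t + h t).
Proof.
move=> mg mh; apply: measurable_fun_to_Zd => u.
rewrite (_ : mkset _ = [set t | g t = u - h t]).
  apply: measurable_Zd_graph => //.
  exact: (measurableT_comp (measurable_fun_from_Zd (fun v : Zd d => u - v)) mh).
by apply/seteqP; split=> t /= => [<-|->]; rewrite ?addrK ?subrK.
Qed.

Lemma measurable_birkhoff_sum (n : nat) :
  measurable_fun setT (birkhoff_sum f tau n).
Proof.
elim: n => [|n IHn].
  rewrite (_ : birkhoff_sum _ _ _ = fun=> 0)//.
  by apply/funext => y; rewrite /birkhoff_sum big_ord0.
rewrite (_ : birkhoff_sum _ _ _ =
    fun y => birkhoff_sum f tau n y + tau (iter n f y)).
  apply: measurable_ZdD => //.
  exact: (measurableT_comp mtau (measurable_iter n)).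
by apply/funext => y; rewrite /birkhoff_sum big_ord_recr.
Qed.

End measurable_dynamics.

Section local_limit.
Context (R : realType) (d : nat) (disp : measure_display)
  (M : measurableMetricType disp R) (nu : probability M R)
  (f : M -> M) (tau : M -> Zd d) (L : nat -> R) (p : 'rV[R]_d -> R).
Local Notation lam := (lebesgue_tuple R d).
Local Notation "'tau_' n" := (birkhoff_sum f tau n) (at level 1).

(** The consequence of the mixing local limit theorem that the argument needs:
    the limit is only taken at a fixed point, and the shift [e] is constant. *)
Definition pointwise_llt : Prop :=
  forall (phi1 phi2 : M -> R) (e : Zd d) (z : 'rV[R]_d),
    continuous phi1 -> continuous phi2 ->
    L n ^+ d * (\int[nu]_y (phi1 y * phi2 (iter n f y) *
       \1_[set y' | tau_ n y' = e + floorZd (L n *: z)] y)) @[n --> \oo] -->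
    (\int[nu]_y phi1 y) * (\int[nu]_y phi2 y) * p z.

Hypotheses (M_borel : borel_space M) (M_compact : compact [set: M]).
Hypotheses (mf : measurable_fun setT f) (mtau : measurable_fun setT tau).
Hypotheses (L_gt0 : forall n, 0 < L n) (llt : pointwise_llt).
Hypotheses (p_ge0 : forall z, 0 <= p z) (p_int : integral_Rd p = 1%E).

Let mtaun n : measurable_fun setT (tau_ n).
Proof. exact: measurable_birkhoff_sum. Qed.

Let mtauD n e : measurable_fun setT (fun y => tau_ n y + e).
Proof. by apply: measurable_ZdD => //; exact: mtaun. Qed.

(* The rescaled density of the displacement [tau_ n], shifted by [e] and weighted
   by [phi1] at the starting point and [phi2] at the end point. *)
Let r (phi1 phi2 : M -> R) (e : Zd d) (n : nat) :=
  cell_density nu (fun y => tau_ n y + e)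
    (fun y => phi1 y * phi2 (iter n f y)) (L n).

Let L1_phi12 (phi1 phi2 : M -> R) (n : nat) :
  continuous phi1 -> continuous phi2 ->
  nu.-integrable setT (EFin \o (fun y => phi1 y * phi2 (iter n f y))).
Proof.
move=> c1 c2; have [C2 _ phi2C] := continuous_bounded M_compact c2.
have [C1 _ phi1C] := continuous_bounded M_compact c1.
apply: (@L1_mul_bounded _ _ _ _ C2) => //.
  exact: (prob_L1_bounded _ (continuous_measurable M_borel c1) phi1C).
exact: (measurableT_comp (continuous_measurable M_borel c2) (measurable_iter mf n)).
Qed.

Let L1_r (phi1 phi2 : M -> R) (e : Zd d) (n : nat) :
  continuous phi1 -> continuous phi2 ->
  lam.-integrable setT (EFin \o r phi1 phi2 e n).
Proof. by move=> c1 c2; apply: L1_cell_density => //; exact: L1_phi12. Qed.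

Let r_cvg (phi1 phi2 : M -> R) (e : Zd d) t :
  continuous phi1 -> continuous phi2 -> r phi1 phi2 e n t @[n --> \oo] -->
    (\int[nu]_y phi1 y) * (\int[nu]_y phi2 y) * p (row_of t).
Proof.
move=> c1 c2; have := @llt phi1 phi2 (- e) (row_of t) c1 c2.
under eq_fun => n.
  rewrite (_ : [set _ | _] =
    [set y | tau_ n y + e = cell_index (L n) t]); first over.
  apply/seteqP; split=> y /= H; first by rewrite H addrAC addNr add0r.
  by rewrite -/(cell_index _ _) -H addrCA addNr addr0.
exact.
Qed.

Let one_cont : continuous (fun _ : M => 1 : R).
Proof. by move=> y; exact: cvg_cst. Qed.

Let p' t := p (row_of t).

(* [p'] is measurable as a pointwise limit of cell densities. *)
Let mp' : measurable_fun setT p'.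
Proof.
apply: (measurable_fun_cvg
    (h := fun n => r (fun=> 1) (fun=> 1) 0 n)) => [n|t _].
  exact: L1_measurable (L1_r _ _ one_cont one_cont).
have := @r_cvg _ _ 0 t one_cont one_cont.
by rewrite !Rint_prob_cst !mul1r.
Qed.

Lemma L1_density : lam.-integrable setT (EFin \o p').
Proof.
apply/integrableP; split; first exact/measurable_EFinP.
under eq_integral => t _ do rewrite /= ger0_norm ?p_ge0//.
by move: p_int; rewrite /integral_Rd => ->; rewrite ltry.
Qed.

Lemma Rint_density : \int[lam]_t p' t = 1.
Proof. by rewrite /Rintegral; move: p_int; rewrite /integral_Rd => ->. Qed.

Let r1_ge0 e n t : 0 <= r (fun=> 1) (fun=> 1) e n t.
Proof.
apply: mulr_ge0; first by rewrite exprn_ge0// ltW.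
by apply: Rintegral_ge0 => y _; rewrite !mul1r indicE ler0n.
Qed.

(** The positive parts of [r 1 1 e n - p'] tend to [0] in mean: both densities
    have integral [1], so these parts have the same integral as the positive
    parts of [p' - r 1 1 e n], which are dominated by [p']. *)
Let scheffe e : \int[lam]_t Num.max (r (fun=> 1) (fun=> 1) e n t - p' t) 0
  @[n --> \oo] --> (0 : R).
Proof.
set q := r (fun=> 1) (fun=> 1) e.
have iq n : lam.-integrable setT (EFin \o q n) by exact: L1_r.
have q1 n : \int[lam]_t q n t = 1.
  rewrite /q /r -cell_decomposition//.
    by under eq_Rintegral do rewrite mulr1; exact: Rint_prob_cst.
  exact: (L1_phi12 n one_cont one_cont).
have H : \int[lam]_t Num.max (p' t - q n t) 0 @[n --> \oo] -->
    \int[lam]_(t in setT) (0 : R).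
  apply: (Rint_dominated_cvg _ _ L1_density) => //.
  - move=> n; apply: measurable_maxr => //.
    by apply: measurable_funB => //; exact: L1_measurable.
  - apply: aeW => t n; rewrite ger0_norm ?le_max ?lexx ?orbT//.
    by rewrite ge_max p_ge0 andbT lerBlDr lerDl r1_ge0.
  - apply: aeW => t; apply: (cvg0_le _ (v := fun n => `|q n t - p' t|)) => [n|].
      rewrite distrC ger0_norm ?le_max ?lexx ?orbT//.
      by rewrite ge_max normr_ge0 ler_norm.
    rewrite -[X in _ --> X](normr0 R) -(subrr (p' t)).
    apply: cvg_norm; apply: cvgB; last exact: cvg_cst.
    have := @r_cvg _ _ e t one_cont one_cont.
    by rewrite !Rint_prob_cst !mul1r.
rewrite Rintegral_cst// mul0r in H.
rewrite (_ : (fun n => _) = (fun n => \int[lam]_t Num.max (p' t - q n t) 0))//.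
apply/funext => n.
have imax (g h : _ -> R) : lam.-integrable setT (EFin \o g) ->
    lam.-integrable setT (EFin \o h) ->
    lam.-integrable setT (EFin \o (fun t => Num.max (g t - h t) 0)).
  move=> ig ih; apply: (L1_le _ (L1_norm (L1B ig ih))).
    by apply: measurable_maxr => //; exact: L1_measurable (L1B ig ih).
  move=> t; rewrite ger0_norm ?le_max ?lexx ?orbT//.
  by rewrite ge_max normr_ge0 ler_norm.
have ip := L1_density.
rewrite (_ : (fun t => _) = (fun t => Num.max (p' t - q n t) 0 + (q n t - p' t))).
  rewrite /Rintegral -/(Rintegral _ _ _) RintegralD//; [|exact: imax|exact: L1B].
  by rewrite RintegralB// q1 Rint_density subrr addr0.
apply/funext => t; case: (leP (q n t) (p' t)) => h.
  rewrite max_r ?subr_le0// max_l ?subr_ge0//; lra.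
rewrite max_l ?subr_ge0 ?ltW// max_r ?subr_le0 ?ltW//; lra.
Qed.

(** The cell densities of [phi1 * phi2 \o f ^ n] converge in mean. The limit
    theorem only gives pointwise convergence; the missing domination comes from
    the case [phi1 = phi2 = 1], where the total masses are known. *)
Lemma density_cvg_in_mean (phi1 phi2 : M -> R) (e : Zd d) :
  continuous phi1 -> continuous phi2 ->
  \int[lam]_t `|cell_density nu (fun y => tau_ n y + e)
                  (fun y => phi1 y * phi2 (iter n f y)) (L n) t
               - (\int[nu]_y phi1 y) * (\int[nu]_y phi2 y) * p (row_of t)|
  @[n --> \oo] --> (0 : R).
Proof.
move=> c1 c2.
have [C1 C1_ge0 phi1C] := continuous_bounded M_compact c1.
have [C2 C2_ge0 phi2C] := continuous_bounded M_compact c2.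
pose C := C1 * C2; have C_ge0 : 0 <= C by rewrite mulr_ge0.
set c := (\int[nu]_y phi1 y) * (\int[nu]_y phi2 y).
have m1 := continuous_measurable M_borel c1.
have m2 := continuous_measurable M_borel c2.
have cC : `|c| <= C.
  by rewrite normrM ler_pM//; exact: Rint_prob_le.
set q := r (fun=> 1) (fun=> 1) e.
have iq n : lam.-integrable setT (EFin \o q n) by exact: L1_r.
have ip := L1_density.
have irp n : lam.-integrable setT
    (EFin \o (fun t => `|r phi1 phi2 e n t - c * p' t|)).
  by apply: L1_norm; apply: L1B; [exact: L1_r|exact: L1Z].
have ipq n : lam.-integrable setT (EFin \o (fun t => Num.max (q n t - p' t) 0)).
  apply: (L1_le _ (L1_norm (L1B (iq n) ip))).
    by apply: measurable_maxr => //; exact: L1_measurable (L1B (iq n) ip).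
  move=> t; rewrite ger0_norm ?le_max ?lexx ?orbT//.
  by rewrite ge_max normr_ge0 ler_norm.
have rq n t : `|r phi1 phi2 e n t| <= C * q n t.
  have Ln0 : 0 <= L n ^+ d by rewrite exprn_ge0// ltW.
  rewrite /q /r /cell_density normrM (ger0_norm Ln0) mulrCA ler_wpM2l//.
  have mi : measurable_fun setT
      (\1_[set y' | tau_ n y' + e = cell_index (L n) t] : M -> R).
    apply: measurable_indic; apply: measurable_Zd_graph => //; exact: mtauD.
  have i1 : nu.-integrable setT (EFin \o (fun y => 1 * 1 *
      \1_[set y' | tau_ n y' + e = cell_index (L n) t] y)).
    apply: (@prob_L1_bounded _ _ _ _ 1); first exact: measurable_funM.
    by move=> y; rewrite !mul1r ger0_norm// indicE; case: (_ \in _).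
  rewrite -RintegralZl//; apply: le_norm_Rint.
  - apply: measurable_funM => //; exact: L1_measurable (L1_phi12 n c1 c2).
  - exact: L1Z.
  - move=> y; rewrite !mul1r normrM (@ger0_norm _ (\1__ _))//.
    by rewrite ler_wpM2r// normrM ler_pM.
(* The part of the difference that is dominated by the limit density; what is
   left is controlled by the excess of [q n] over [p']. *)
pose g n t := Num.min `|r phi1 phi2 e n t - c * p' t| (2 * C * p' t).
have p2C t : 0 <= 2 * C * p' t by rewrite mulr_ge0 ?p_ge0// mulr_ge0.
have ig0 n t : 0 <= g n t by rewrite le_min normr_ge0 p2C.
have mg n : measurable_fun setT (g n).
  apply: measurable_minr; first exact: L1_measurable (irp n).
  exact: measurable_funM.
have ig n : lam.-integrable setT (EFin \o g n).
  apply: (L1_le (mg n) (irp n)) => t.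
  by rewrite ger0_norm// ge_min lexx.
have g0 : \int[lam]_t g n t @[n --> \oo] --> (0 : R).
  rewrite -[X in _ --> X](mul0r (fine (lam setT))) -Rintegral_cst//.
  apply: (Rint_dominated_cvg _ _ (L1Z (2 * C) ip)) => //.
    by apply: aeW => t n; rewrite ger0_norm// ge_min lexx orbT.
  apply: aeW => t.
  apply: (cvg0_le _ (v := fun n => `|r phi1 phi2 e n t - c * p' t|)) => [n|].
    by rewrite ger0_norm// ge_min lexx.
  rewrite -[X in _ --> X](normr0 R) -(subrr (c * p' t)).
  by apply: cvg_norm; apply: cvgB; [exact: r_cvg|exact: cvg_cst].
apply: (cvg0_le _ (v := fun n => \int[lam]_t g n t +
    C * \int[lam]_t Num.max (q n t - p' t) 0)) => [n|]; last first.
  rewrite [X in _ --> X](_ : 0 = 0 + C * 0); last by rewrite mulr0 addr0.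
  by apply: cvgD => //; apply: cvgM; [exact: cvg_cst|exact: scheffe].
rewrite -RintegralZl// -RintegralD//; last exact: L1Z.
rewrite ger0_norm ?Rintegral_ge0//.
apply: (le_Rintegral measurableT (irp n) (L1D (ig n) (L1Z C (ipq n)))).
move=> t _; rewrite /g.
have m0 : 0 <= Num.max (q n t - p' t) 0 by rewrite le_max lexx orbT.
case: (leP `|r phi1 phi2 e n t - c * p' t| (2 * C * p' t)) => h.
  by rewrite lerDl mulr_ge0.
rewrite (le_trans (ler_normB _ _))// (le_trans (lerD (rq n t) (lexx _)))//.
rewrite normrM (ger0_norm (p_ge0 _)) -/(p' t).
have h1 : `|c| * p' t <= C * p' t by rewrite ler_wpM2r// p_ge0.
have h2 : C * (q n t - p' t) <= C * Num.max (q n t - p' t) 0.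
  by rewrite ler_wpM2l// le_max lexx.
lra.
Qed.

(** Along the dynamics, the starting point, the point reached and the rescaled
    displacement become independent, uniformly over all bounded functions [h] of
    the displacement. *)
Lemma asymptotic_independence (phi1 phi2 : M -> R) (e : Zd d) :
  continuous phi1 -> continuous phi2 ->
  exists2 delta : nat -> R, delta n @[n --> \oo] --> (0 : R) &
    forall n (B : R) (h : Zd d -> R), (forall u, `|h u| <= B) ->
    `|\int[nu]_y (phi1 y * phi2 (iter n f y) * h (tau_ n y + e))
      - (\int[nu]_y phi1 y) * (\int[nu]_y phi2 y) *
        \int[lam]_t (p (row_of t) * h (cell_index (L n) t))| <= B * delta n.
Proof.
move=> c1 c2.
exists (fun n => \int[lam]_t `|r phi1 phi2 e n t
  - (\int[nu]_y phi1 y) * (\int[nu]_y phi2 y) * p (row_of t)|).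
  exact: density_cvg_in_mean.
move=> n B h hB; set c := (\int[nu]_y phi1 y) * (\int[nu]_y phi2 y).
have ip := L1_density; have ir := L1_r e n c1 c2.
have mhc : measurable_fun setT (fun t => h (cell_index (L n) t)).
  exact: (measurableT_comp (measurable_fun_from_Zd h)
                           (measurable_cell_index (L_gt0 n))).
have mht : measurable_fun setT (fun y => h (tau_ n y + e)).
  exact: (measurableT_comp (measurable_fun_from_Zd h) (mtauD n e)).
rewrite (cell_decomposition (L_gt0 n) (mtauD n e)); last first.
  by apply: (L1_mul_bounded _ mht) => //; exact: L1_phi12.
rewrite (_ : cell_density _ _ _ _ =
    fun t => r phi1 phi2 e n t * h (cell_index (L n) t)); last first.
  apply/funext => t; rewrite /r /cell_density -mulrA; congr (_ * _).
  rewrite -RintegralZr//; last first.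
    apply: (@L1_mul_bounded _ _ _ _ 1); first exact: L1_phi12.
      by apply: measurable_indic; apply: measurable_Zd_graph => //; exact: mtauD.
    by move=> y; rewrite ger0_norm// indicE; case: (_ \in _).
  apply: eq_Rintegral => y _.
  have [E|E] := pselect (tau_ n y + e = cell_index (L n) t).
    by rewrite E mulrAC.
  by rewrite indicE memNset// !mulr0 mul0r.
have iph := L1_mul_bounded ip mhc (fun t => hB _).
rewrite -(RintegralZl c measurableT iph) -RintegralB//; last 2 first.
- exact: (L1_mul_bounded ir mhc (fun t => hB _)).
- exact: L1Z.
have irp : lam.-integrable setT (EFin \o (fun t => `|r phi1 phi2 e n t - c * p' t|)).
  by apply: L1_norm; apply: L1B => //; exact: L1Z.
rewrite -(RintegralZl B measurableT irp); apply: le_norm_Rint.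
- apply: measurable_funB.
    exact: L1_measurable (L1_mul_bounded ir mhc (fun t => hB _)).
  exact: L1_measurable (L1Z c iph).
- exact: L1Z.
- move=> t; rewrite mulrA -mulrBl normrM mulrC ler_wpM2r//.
Qed.

End local_limit.

(** Any fixed [z] lies in a ball over which the limit is uniform, and a constant
    shift is negligible against [L n]. *)
Lemma MLLT_pointwise (R : realType) (d : nat) (disp : measure_display)
    (M : measurableMetricType disp R) (nu : probability M R) (f : M -> M)
    (tau : M -> Zd d) (L : nat -> R) : MLLT nu f tau L ->
  exists p : 'rV[R]_d -> R, [/\ continuous p, bounded_fun p,
    (forall z, 0 <= p z), integral_Rd p = 1%E & pointwise_llt nu f tau L p].
Proof.
case=> L_gt0 Loo [p [cp bp p0 p1 H]]; exists p; split => //.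
move=> phi1 phi2 e z c1 c2.
have Linv : (L n)^-1 @[n --> \oo] --> (0 : R) by apply/gtr0_cvgV0 => //; exact: nearW.
have e0 : (L n)^-1 *: Zd_to_Rd R e @[n --> \oo] --> (0 : 'rV[R]_d).
  by rewrite -[X in _ --> X](scale0r (Zd_to_Rd R e)); exact: cvgZr_tmp.
have z0 : 0 < `|z| + 1 by rewrite ltr_wpDl.
have := H phi1 phi2 (fun=> e) (`|z| + 1) c1 c2 e0 z0.
set S := (fun n => ereal_sup _) => S0.
set u := (X in X @ \oo --> _); set c := (X in _ --> X).
suff uc : (`|u n - c|)%:E @[n --> \oo] --> 0%E.
  have : `|u n - c| @[n --> \oo] --> (0 : R) by exact: (fine_cvg uc).
  move=> /norm_cvg0P uc0.
  rewrite (_ : u = fun n => (u n - c) + c); last by apply/funext => n; rewrite subrK.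
  by rewrite -[X in _ --> X]add0r; apply: cvgD => //; exact: cvg_cst.
apply: (@squeeze_cvge _ _ _ _ (fun=> 0%E) _ S) => //; last exact: cvg_cst.
apply: nearW => n; rewrite lee_fin normr_ge0 /=.
apply: ereal_sup_ubound; exists z => //=.
by rewrite ltrDl.
Qed.

(** * Finite-rank approximation of uniformly continuous observables *)

Section partition_of_unity.
Import finmap.
Local Open Scope classical_set_scope.
Local Open Scope ring_scope.
Context (R : realType) (disp : measure_display) (M : measurableMetricType disp R).

Lemma mdist_continuous (c : M) : continuous (fun y : M => mdist c y : R).
Proof.
move=> y; apply/cvgrPdist_lt => eps eps0.
near=> y'.
have yy' : mdist y y' < eps :> R.
  have : ball y eps y' by near: y'; exact: nbhsx_ballx.
  by rewrite ballEmdist.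
have h1 : mdist c y' <= mdist c y + mdist y y' := metric_triangle c y y'.
have h2 : mdist c y <= mdist c y' + mdist y' y := metric_triangle c y' y.
rewrite (metric_sym y' y) in h2; apply: le_lt_trans yy'.
by rewrite ler_norml lerBlDl lerBrDr addrC lerBlDr h1 h2.
Unshelve. all: by end_near. Qed.

(** A partition of unity subordinate to a cover by balls of radius [delta]: the
    normalised bumps [max (delta - mdist c y) 0]. *)
Lemma partition_of_unity (delta : R) : compact [set: M] -> 0 < delta ->
  exists (I : finType) (c : I -> M) (psi : I -> M -> R),
    [/\ forall i, continuous (psi i), forall i y, 0 <= psi i y,
        forall y, \sum_i psi i y = 1 &
        forall i y, psi i y != 0 -> ball (c i) delta y].
Proof.
move=> Mc d0.
have [D' _ cov] : finite_subset_cover [set: M] (fun c : M => ball c delta) [set: M].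
  have := Mc; rewrite compact_cover; apply.
    move=> c _.
    rewrite (_ : ball c delta =
        (fun y => mdist c y : R) @^-1` `]-oo, delta[%classic).
      by apply: open_comp => // y _; exact: mdist_continuous.
    by rewrite ballEmdist; apply/seteqP; split => y /=; rewrite in_itv.
  by move=> y _; exists y => //; exact: ballxx.
pose h (i : fset_sub_type D') (y : M) : R := Num.max (delta - mdist (fsval i) y) 0.
have h0 i y : 0 <= h i y by rewrite le_max lexx orbT.
have hc i : continuous (h i).
  move=> y; apply: (@continuous_max _ _ (fun y => delta - mdist (fsval i) y) (fun=> 0)).
    by apply: cvgB; [exact: cvg_cst|exact: mdist_continuous].
  exact: cvg_cst.
have hs y : 0 < \sum_i h i y.
  have [c cD cy] := cov y I.
  rewrite (bigD1 (FSetSub cD))//= ltr_pwDl ?sumr_ge0//.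
  by move: cy; rewrite ballEmdist /h lt_max subr_gt0 /= => ->.
exists (fset_sub_type D'), (fun i => fsval i),
  (fun i y => (\sum_j h j y)^-1 * h i y); split.
- move=> i y; apply: cvgM; last exact: hc.
  apply: cvgV; first by rewrite gt_eqF.
  by apply: cvg_big => [|j _]; [exact: add_continuous|exact: hc].
- by move=> i y; rewrite mulr_ge0// invr_ge0 ltW.
- by move=> y; rewrite -mulr_sumr mulVf// gt_eqF.
- move=> i y; rewrite mulf_eq0 negb_or => /andP[_]; rewrite ballEmdist /=.
  by rewrite ltNge; apply: contraNN => le; rewrite /h max_r// subr_le0.
Qed.

(** A uniformly continuous observable is uniformly close to a finite sum of
    products of a continuous function of [y] and a function of [z]. *)
Lemma finite_rank_approx (d : nat) (Phi : M * Zd d -> R) (eps : R) :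
  compact [set: M] -> unif_continuous Phi -> 0 < eps ->
  exists (I : finType) (c : I -> M) (psi : I -> M -> R),
    [/\ forall i, continuous (psi i), forall i y, 0 <= psi i y,
        forall y, \sum_i psi i y = 1 &
        forall y z, `|Phi (y, z) - \sum_i psi i y * Phi (c i, z)| <= eps].
Proof.
move=> Mc /unif_continuousP /(_ eps) + eps0 => /(_ eps0) [delta d0 H].
have [I [c [psi [cpsi psi0 psi1 psib]]]] := partition_of_unity Mc d0.
exists I, c, psi; split => // y z.
rewrite -[Phi (y, z)]mul1r -(psi1 y) mulr_suml -sumrB.
rewrite (le_trans (ler_norm_sum _ _ _))//.
rewrite -[leRHS]mul1r -(psi1 y) mulr_suml; apply: ler_sum => i _.
rewrite -mulrBr normrM (ger0_norm (psi0 _ _)).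
have [->|ne0] := eqVneq (psi i y) 0; first by rewrite !mul0r.
rewrite ler_wpM2l// distrC ltW//.
have := H ((c i, z), (y, z)); apply; split => /=; first exact: psib.
exact: ballxx.
Qed.

End partition_of_unity.

(** * Decoupling of observables *)

Section slices.
Context (R : realType) (disp : measure_display)
  (M : measurableMetricType disp R) (d : nat).
Implicit Types (nu : probability M R) (Phi : M * Zd d -> R).

(** The average of an observable over a fibre [M * {z}]. *)
Definition slice_mean nu Phi (z : Zd d) : R := \int[nu]_y Phi (y, z).

Lemma slice_continuous Phi (z : Zd d) :
  unif_continuous Phi -> continuous (fun y => Phi (y, z)).
Proof.
move=> /unif_continuousP cPhi y; apply/cvgrPdist_lt => eps eps0.
have [delta d0 H] := cPhi _ eps0.
near=> y'.
have := H ((y, z), (y', z)); apply; split => /=; last exact: ballxx.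
near: y'; exact: nbhsx_ballx.
Unshelve. all: by end_near. Qed.

Lemma measurable_from_slices Phi :
  (forall z, measurable_fun setT (fun y => Phi (y, z))) ->
  measurable_fun setT Phi.
Proof.
move=> mPhi _ B mB; rewrite setTI.
rewrite (_ : Phi @^-1` B = \bigcup_k
    \bigcup_(z in [set z | pickle z = k]) (((fun y => Phi (y, z)) @^-1` B) `*` [set z])).
  apply: bigcup_measurable => k _.
  have [[z zk]|nz] := pselect (exists z : Zd d, pickle z = k).
    rewrite (_ : [set _ | _] = [set z]).
      rewrite bigcup_set1; apply: measurableX => //.
      by rewrite -[X in measurable X]setTI; exact: mPhi.
    apply/seteqP; split=> u /= => [uk|->//].
    by apply: (pcan_inj pickleK); rewrite uk zk.
  rewrite (_ : [set _ | _] = set0) ?bigcup_set0//.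
  by apply/seteqP; split=> // u /= uk; case: nz; exists u.
apply/seteqP; split=> [[y z] /= yz|[y z] [k _ [u _ [/= + ->]]]//].
by exists (pickle z) => //; exists z.
Qed.

Lemma bounded_observable Phi : bounded_fun Phi ->
  exists2 C : R, 0 <= C & forall x, `|Phi x| <= C.
Proof.
move=> [C [_ PhiC]]; exists (`|C| + 1) => [|x]; first by rewrite addr_ge0.
by apply: (PhiC (`|C| + 1)) => //; rewrite (le_lt_trans (ler_norm C))// ltrDl.
Qed.

Lemma measurable_slice Phi (z : Zd d) : borel_space M ->
  unif_continuous Phi -> measurable_fun setT (fun y => Phi (y, z)).
Proof.
by move=> Mb cPhi; apply: continuous_measurable => //; exact: slice_continuous.
Qed.

Lemma measurable_observable Phi : borel_space M -> unif_continuous Phi ->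
  measurable_fun setT Phi.
Proof.
move=> Mb cPhi; apply: measurable_from_slices => z.
by apply: continuous_measurable => //; exact: slice_continuous.
Qed.

End slices.

Section lattice_mean.
Context (R : realType) (d : nat) (p : 'rV[R]_d -> R).
Local Notation lam := (lebesgue_tuple R d).
Hypotheses (p_ge0 : forall z, 0 <= p z)
  (p_L1 : lam.-integrable setT (EFin \o (fun t => p (row_of t))))
  (p_int1 : \int[lam]_t p (row_of t) = 1).

(** The mean of [h] at the lattice points obtained by rounding down [s t], where
    [t] has density [p]. *)
Definition lattice_mean (s : R) (h : Zd d -> R) : R :=
  \int[lam]_t (p (row_of t) * h (cell_index s t)).

Lemma measurable_lattice (s : R) (h : Zd d -> R) : 0 < s ->
  measurable_fun setT (fun t => h (cell_index s t)).
Proof.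
move=> s0; exact: (measurableT_comp (measurable_fun_from_Zd h)
                                    (measurable_cell_index s0)).
Qed.

Lemma L1_lattice (s B : R) (h : Zd d -> R) : 0 < s -> (forall u, `|h u| <= B) ->
  lam.-integrable setT (EFin \o (fun t => p (row_of t) * h (cell_index s t))).
Proof.
move=> s0 hB; apply: (L1_mul_bounded p_L1 (measurable_lattice h s0)) => t.
exact: hB.
Qed.

Lemma lattice_mean_norm_le (s B : R) (h : Zd d -> R) : 0 < s ->
  (forall u, `|h u| <= B) -> `|lattice_mean s h| <= B.
Proof.
move=> s0 hB; rewrite -[leRHS]mulr1 -p_int1 -RintegralZl//.
apply: le_norm_Rint; [exact: L1_measurable (L1_lattice s0 hB)|exact: L1Z|].
by move=> t; rewrite normrM (ger0_norm (p_ge0 _)) mulrC ler_wpM2r.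
Qed.

Lemma lattice_meanB (s B1 B2 : R) (h1 h2 : Zd d -> R) : 0 < s ->
  (forall u, `|h1 u| <= B1) -> (forall u, `|h2 u| <= B2) ->
  lattice_mean s (fun u => h1 u - h2 u) = lattice_mean s h1 - lattice_mean s h2.
Proof.
move=> s0 hB1 hB2; rewrite -RintegralB//;
  [|exact: (L1_lattice s0 hB1)|exact: (L1_lattice s0 hB2)].
by apply: eq_Rintegral => t _; rewrite mulrBr.
Qed.

Lemma lattice_meanZ (s B a : R) (h : Zd d -> R) : 0 < s ->
  (forall u, `|h u| <= B) ->
  lattice_mean s (fun u => a * h u) = a * lattice_mean s h.
Proof.
move=> s0 hB; rewrite -RintegralZl//; last exact: (L1_lattice s0 hB).
by apply: eq_Rintegral => t _; rewrite mulrCA.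
Qed.

Lemma lattice_mean_cst (s a : R) : lattice_mean s (fun=> a) = a.
Proof.
rewrite /lattice_mean; under eq_Rintegral do rewrite mulrC.
by rewrite RintegralZl// p_int1 mulr1.
Qed.

Lemma lattice_mean_sum (s B : R) (I : Type) (r : seq I) (P : pred I)
    (h : I -> Zd d -> R) : 0 < s -> (forall i u, `|h i u| <= B) ->
  lattice_mean s (fun u => \sum_(i <- r | P i) h i u) =
    \sum_(i <- r | P i) lattice_mean s (h i).
Proof.
move=> s0 hB; rewrite -Rint_sum => [|i _]; last exact: (L1_lattice s0 (hB i)).
by apply: eq_Rintegral => t _; rewrite mulr_sumr.
Qed.

Lemma lattice_mean_le (s B1 B2 : R) (h1 h2 : Zd d -> R) : 0 < s ->
  (forall u, `|h1 u| <= B1) -> (forall u, `|h2 u| <= B2) ->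
  (forall u, h1 u <= h2 u) -> lattice_mean s h1 <= lattice_mean s h2.
Proof.
move=> s0 hB1 hB2 h12; apply: le_Rintegral => //;
  [exact: (L1_lattice s0 hB1)|exact: (L1_lattice s0 hB2)|].
by move=> t _; rewrite ler_wpM2l.
Qed.

End lattice_mean.

Section decoupling.
Context (R : realType) (d : nat) (disp : measure_display)
  (M : measurableMetricType disp R) (nu : probability M R)
  (f : M -> M) (tau : M -> Zd d) (L : nat -> R) (p : 'rV[R]_d -> R).
Local Notation lam := (lebesgue_tuple R d).
Local Notation "'tau_' n" := (birkhoff_sum f tau n) (at level 1).
Hypotheses (M_borel : borel_space M) (M_compact : compact [set: M]).
Hypotheses (mf : measurable_fun setT f) (mtau : measurable_fun setT tau).
Hypotheses (L_gt0 : forall n, 0 < L n) (llt : pointwise_llt nu f tau L p).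
Hypotheses (p_ge0 : forall z, 0 <= p z) (p_int : integral_Rd p = 1%E).

Let p_L1 : lam.-integrable setT (EFin \o (fun t => p (row_of t))).
Proof. exact: (L1_density M_borel M_compact mf mtau L_gt0 llt p_ge0 p_int). Qed.

Let p_int1 : \int[lam]_t p (row_of t) = 1.
Proof. exact: Rint_density. Qed.

Lemma measurable_skew_slice (Phi : M * Zd d -> R) (n : nat) (z : Zd d) :
  unif_continuous Phi ->
  measurable_fun setT (fun y => Phi (iter n f y, z + tau_ n y)).
Proof.
move=> cPhi; apply: (measurableT_comp (measurable_observable M_borel cPhi)).
apply: measurable_fun_pair; first exact: measurable_iter.
by apply: measurable_ZdD => //; exact: measurable_birkhoff_sum.
Qed.

(** For two uniformly continuous observables, the correlation over the fibre
    [M * {z}] asymptotically only depends on their fibre averages, uniformly in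
    [z]: finite-rank approximation reduces this to finitely many applications of
    [asymptotic_independence]. *)
Lemma skew_decoupling (Phi1 Phi2 : M * Zd d -> R) (C1 C2 eps : R) :
  unif_continuous Phi1 -> unif_continuous Phi2 ->
  (forall x, `|Phi1 x| <= C1) -> (forall x, `|Phi2 x| <= C2) -> 0 < eps ->
  \forall n \near \oo, forall z : Zd d,
    `|\int[nu]_y (Phi1 (y, z) * Phi2 (iter n f y, z + tau_ n y))
      - slice_mean nu Phi1 z *
        lattice_mean p (L n) (fun u => slice_mean nu Phi2 (z + u))| <= eps.
Proof.
move=> cPhi1 cPhi2 Phi1C Phi2C eps0.
have C1_ge0 : 0 <= C1 by exact: le_trans (normr_ge0 _) (Phi1C point).
have C2_ge0 : 0 <= C2 by exact: le_trans (normr_ge0 _) (Phi2C point).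
pose eta := eps / (4 * (C1 + C2 + 1)).
have den0 : 0 < 4 * (C1 + C2 + 1) by rewrite mulr_gt0// ltr_wpDl// addr_ge0.
have eta0 : 0 < eta by rewrite divr_gt0.
have etaC : (C1 + C2) * eta <= eps / 4.
  have -> : eps / 4 = (C1 + C2 + 1) * eta.
    by rewrite /eta; field; rewrite gt_eqF// ltr_wpDl// addr_ge0.
  by rewrite ler_wpM2r ?ltW// ltrDl.
have [I1 [c1 [psi1 [cpsi1 psi1_ge0 psi1_sum H1]]]] :=
  finite_rank_approx M_compact cPhi1 eta0.
have [I2 [c2 [psi2 [cpsi2 psi2_ge0 psi2_sum H2]]]] :=
  finite_rank_approx M_compact cPhi2 eta0.
have psi1_le i y : psi1 i y <= 1.
  by rewrite -(psi1_sum y) (bigD1 i)//= lerDl sumr_ge0.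
have psi2_le i y : psi2 i y <= 1.
  by rewrite -(psi2_sum y) (bigD1 i)//= lerDl sumr_ge0.
have mpsi1 i := continuous_measurable M_borel (cpsi1 i).
have mpsi2 i := continuous_measurable M_borel (cpsi2 i).
have ipsi1 i : nu.-integrable setT (EFin \o psi1 i).
  by apply: (@prob_L1_bounded _ _ _ _ (1)) => // y; rewrite ger0_norm.
have ipsi2 i : nu.-integrable setT (EFin \o psi2 i).
  by apply: (@prob_L1_bounded _ _ _ _ (1)) => // y; rewrite ger0_norm.
have /choice[delta0 delta0P] : forall ij : I1 * I2, exists delta : nat -> R,
    delta n @[n --> \oo] --> (0 : R) /\
    forall n (B : R) (h : Zd d -> R), (forall u, `|h u| <= B) ->
    `|\int[nu]_y (psi1 ij.1 y * psi2 ij.2 (iter n f y) * h (tau_ n y + 0))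
      - (\int[nu]_y psi1 ij.1 y) * (\int[nu]_y psi2 ij.2 y) *
        lattice_mean p (L n) h| <= B * delta n.
  move=> [i j]; have [delta dl0 dlP] := asymptotic_independence M_borel M_compact
    mf mtau L_gt0 llt p_ge0 p_int 0 (cpsi1 i) (cpsi2 j).
  by exists delta.
pose Delta n := \sum_i \sum_j C1 * (C2 * delta0 (i, j) n).
have Delta0 : Delta n @[n --> \oo] --> (0 : R).
  rewrite [X in _ --> X](_ : 0 = \sum_(i : I1) \sum_(j : I2) C1 * (C2 * 0)); last first.
    by rewrite big1// => i _; rewrite big1// => j _; rewrite !mulr0.
  apply: cvg_big => [|i _]; first exact: add_continuous.
  apply: cvg_big => [|j _]; first exact: add_continuous.
  apply: cvgM; first exact: cvg_cst.
  apply: cvgM; first exact: cvg_cst.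
  exact: (delta0P (i, j)).1.
have eps2 : 0 < eps / 2 by rewrite divr_gt0.
near=> n => z.
have Dn : Delta n <= eps / 2.
  rewrite (le_trans (ler_norm _))//.
  by near: n; exact: (cvgr0_norm_le _ Delta0 _ eps2).
pose Psi1 y := \sum_i psi1 i y * Phi1 (c1 i, z).
pose Psi2 y u := \sum_j psi2 j y * Phi2 (c2 j, u).
have Psi1C y : `|Psi1 y| <= C1.
  rewrite (le_trans (ler_norm_sum _ _ _))// -[leRHS]mul1r -(psi1_sum y) mulr_suml.
  by apply: ler_sum => i _; rewrite normrM ger0_norm// ler_wpM2l.
have Psi2C y u : `|Psi2 y u| <= C2.
  rewrite (le_trans (ler_norm_sum _ _ _))// -[leRHS]mul1r -(psi2_sum y) mulr_suml.
  by apply: ler_sum => i _; rewrite normrM ger0_norm// ler_wpM2l.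
have mPhi1 u := measurable_slice u M_borel cPhi1.
have mPhi2 u := measurable_slice u M_borel cPhi2.
have mtaun : measurable_fun setT (tau_ n) by exact: measurable_birkhoff_sum.
have mzt : measurable_fun setT (fun y => z + tau_ n y).
  exact: measurable_ZdD.
have mfn := measurable_iter mf n.
have mPhi2n j : measurable_fun setT (fun y => Phi2 (c2 j, z + tau_ n y)).
  exact: (measurableT_comp
    (measurable_fun_from_Zd (fun u => Phi2 (c2 j, u))) mzt).
have mPsi1 : measurable_fun setT Psi1.
  by apply: measurable_sum => i; exact: measurable_funM.
have mPsi2n : measurable_fun setT (fun y => Psi2 (iter n f y) (z + tau_ n y)).
  apply: measurable_sum => j; apply: measurable_funM => //.
  exact: (measurableT_comp (mpsi2 j) mfn).
have mPhi2T := measurable_skew_slice n z cPhi2.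
(* Replacing the observables by their finite-rank approximations. *)
have step1 : `|\int[nu]_y (Phi1 (y, z) * Phi2 (iter n f y, z + tau_ n y)) -
    \int[nu]_y (Psi1 y * Psi2 (iter n f y) (z + tau_ n y))| <= (C1 + C2) * eta.
  rewrite -RintegralB//; last 2 first.
  - apply: (@prob_L1_bounded _ _ _ _ (C1 * C2)); first exact: measurable_funM.
    by move=> y; rewrite normrM ler_pM.
  - apply: (@prob_L1_bounded _ _ _ _ (C1 * C2)); first exact: measurable_funM.
    by move=> y; rewrite normrM ler_pM.
  apply: Rint_prob_le; first by apply: measurable_funB; exact: measurable_funM.
  move=> y; set a := Phi1 _; set b := Phi2 _; set a' := Psi1 _; set b' := Psi2 _ _.
  have -> : a * b - a' * b' = a * (b - b') + b' * (a - a') by ring.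
  rewrite (le_trans (ler_normD _ _))// !normrM mulrDl lerD//.
    by rewrite ler_pM//; [exact: Phi1C|exact: H2].
  by rewrite ler_pM//; [exact: Psi2C|exact: H1].
have E1 : \int[nu]_y (Psi1 y * Psi2 (iter n f y) (z + tau_ n y)) =
    \sum_i \sum_j Phi1 (c1 i, z) * \int[nu]_y
      (psi1 i y * psi2 j (iter n f y) * Phi2 (c2 j, z + (tau_ n y + 0))).
  have ib i j : nu.-integrable setT (EFin \o (fun y =>
      psi1 i y * psi2 j (iter n f y) * Phi2 (c2 j, z + (tau_ n y + 0)))).
    apply: (@prob_L1_bounded _ _ _ _ (1 * 1 * C2)).
      apply: measurable_funM; last first.
        by rewrite (_ : (fun y => _) = fun y => Phi2 (c2 j, z + tau_ n y))//;
          apply/funext => y; rewrite addr0.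
      by apply: measurable_funM => //; exact: (measurableT_comp (mpsi2 j) mfn).
    move=> y; rewrite !normrM !(ger0_norm (psi1_ge0 _ _)).
    by rewrite (ger0_norm (psi2_ge0 _ _)) !ler_pM// mulr_ge0.
  transitivity (\int[nu]_y (\sum_i \sum_j Phi1 (c1 i, z) *
      (psi1 i y * psi2 j (iter n f y) * Phi2 (c2 j, z + (tau_ n y + 0))))).
    apply: eq_Rintegral => y _; rewrite mulr_suml; apply: eq_bigr => i _.
    by rewrite mulr_sumr; apply: eq_bigr => j _; rewrite addr0; ring.
  rewrite Rint_sum => [|i _]; last by apply: L1_sum => j _; exact: L1Z.
  apply: eq_bigr => i _; rewrite Rint_sum => [|j _]; last exact: L1Z.
  by apply: eq_bigr => j _; rewrite RintegralZl.
pose S2 := \sum_i \sum_j Phi1 (c1 i, z) * ((\int[nu]_y psi1 i y) *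
  (\int[nu]_y psi2 j y) * lattice_mean p (L n) (fun u => Phi2 (c2 j, z + u))).
have step2 : `|\int[nu]_y (Psi1 y * Psi2 (iter n f y) (z + tau_ n y)) - S2|
    <= eps / 2.
  apply: le_trans Dn; rewrite E1 /S2 -sumrB (le_trans (ler_norm_sum _ _ _))//.
  apply: ler_sum => i _; rewrite -sumrB (le_trans (ler_norm_sum _ _ _))//.
  apply: ler_sum => j _; rewrite -mulrBr normrM ler_pM//.
  exact: ((delta0P (i, j)).2 n C2 (fun u => Phi2 (c2 j, z + u)) (fun u => Phi2C _)).
pose B1 := \sum_i (\int[nu]_y psi1 i y) * Phi1 (c1 i, z).
pose B2 u := \sum_j (\int[nu]_y psi2 j y) * Phi2 (c2 j, u).
have B1E : B1 = \int[nu]_y Psi1 y.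
  rewrite Rint_sum => [|i _]; last first.
    by apply: (@L1_mul_bounded _ _ _ _ C1).
  by apply: eq_bigr => i _; rewrite RintegralZr.
have B2E u : B2 u = \int[nu]_y Psi2 y u.
  rewrite Rint_sum => [|i _]; last first.
    by apply: (@L1_mul_bounded _ _ _ _ C2).
  by apply: eq_bigr => i _; rewrite RintegralZr.
have mPsi2 u : measurable_fun setT (Psi2 ^~ u).
  by apply: measurable_sum => i; exact: measurable_funM.
have A1B1 : `|slice_mean nu Phi1 z - B1| <= eta.
  rewrite B1E /slice_mean -RintegralB//;
    [|exact: prob_L1_bounded|exact: prob_L1_bounded].
  by apply: Rint_prob_le => //; exact: measurable_funB.
have A2B2 u : `|slice_mean nu Phi2 u - B2 u| <= eta.
  rewrite B2E /slice_mean -RintegralB//;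
    [|exact: prob_L1_bounded|exact: prob_L1_bounded].
  by apply: Rint_prob_le => //; exact: measurable_funB.
have B1C : `|B1| <= C1 by rewrite B1E; exact: Rint_prob_le.
have B2C u : `|B2 u| <= C2 by rewrite B2E; exact: Rint_prob_le.
have A2C u : `|slice_mean nu Phi2 u| <= C2 by exact: Rint_prob_le.
have S2E : S2 = B1 * lattice_mean p (L n) (fun u => B2 (z + u)).
  rewrite (lattice_mean_sum p_L1 (B := C2)) => [|//|j u]; last first.
    rewrite normrM -[leRHS]mul1r ler_pM//.
    by apply: Rint_prob_le => // y; rewrite ger0_norm.
  rewrite mulr_suml; apply: eq_bigr => i _; rewrite mulr_sumr; apply: eq_bigr => j _.
  by rewrite (lattice_meanZ p_L1 (B := C2))//; ring.
have step3 : `|S2 - slice_mean nu Phi1 z *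
    lattice_mean p (L n) (fun u => slice_mean nu Phi2 (z + u))| <= (C1 + C2) * eta.
  rewrite S2E; set EB := lattice_mean _ _ _; set EA := lattice_mean _ _ _.
  set a := slice_mean _ _ _.
  have -> : B1 * EB - a * EA = B1 * (EB - EA) + EA * (B1 - a) by ring.
  rewrite (le_trans (ler_normD _ _))// !normrM mulrDl lerD// ler_pM//.
  - rewrite -(lattice_meanB p_L1 (B1 := C2) (B2 := C2))//.
    by apply: lattice_mean_norm_le => // u; rewrite distrC.
  - exact: lattice_mean_norm_le.
  - by rewrite distrC.
set T1 := \int[nu]_y (Phi1 _ * _) in step1 *.
set S1 := \int[nu]_y (Psi1 _ * _) in step1 step2 *.
set T2 := slice_mean _ _ _ * _ in step3 *.
have -> : T1 - T2 = (T1 - S1) + (S1 - S2) + (S2 - T2) by ring.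
rewrite (le_trans (ler_normD _ _))// (le_trans (lerD (ler_normD _ _) (lexx _)))//.
lra.
Unshelve. all: by end_near. Qed.

(** The mean of a bounded function at the rounded points is asymptotically
    invariant under lattice translations. *)
Lemma lattice_mean_shift (e : Zd d) :
  exists2 delta : nat -> R, delta n @[n --> \oo] --> (0 : R) &
    forall n (B : R) (h : Zd d -> R), (forall u, `|h u| <= B) ->
    `|lattice_mean p (L n) (fun u => h (u + e)) - lattice_mean p (L n) h|
      <= B * delta n.
Proof.
have c1 : continuous (fun _ : M => 1 : R) by move=> y; exact: cvg_cst.
have [d1 d1_0 H1] := asymptotic_independence M_borel M_compact
    mf mtau L_gt0 llt p_ge0 p_int e c1 c1.
have [d0 d0_0 H0] := asymptotic_independence M_borel M_compact
    mf mtau L_gt0 llt p_ge0 p_int 0 c1 c1.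
exists (fun n => d1 n + d0 n).
  by rewrite -[X in _ --> X](addr0 (0 : R)); exact: cvgD.
move=> n B h hB.
pose a := \int[nu]_y (1 * h (tau_ n y + e)).
have h1 : `|a - lattice_mean p (L n) h| <= B * d1 n.
  by have := H1 n B h hB; rewrite !Rint_prob_cst !mul1r.
have h0 : `|a - lattice_mean p (L n) (fun u => h (u + e))| <= B * d0 n.
  have := H0 n B (fun u => h (u + e)) (fun u => hB _).
  rewrite !Rint_prob_cst !mul1r.
  rewrite (_ : \int[nu]_y _ = a)//.
  by apply: eq_Rintegral => y _; rewrite addr0.
rewrite (le_trans (ler_distD a _ _))// addrC mulrDr lerD//.
by rewrite distrC.
Qed.

End decoupling.

(** * Density of the continuous functions in mean *)

Section distance_to_set.
Context (R : realType) (disp : measure_display)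
  (M : measurableMetricType disp R) (A : set M).
Hypothesis A0 : A !=set0.

(** The distance from [y] to the set [A], meaningful for [A] nonempty. *)
Definition set_dist (y : M) : R := inf [set mdist y a | a in A].

Let lb0 y : lbound [set mdist y a | a in A] (0 : R).
Proof. by move=> _ [a _ <-]; exact: mdist_ge0. Qed.

Let hlb y : has_lbound [set (mdist y a : R) | a in A].
Proof. by exists 0; exact: lb0. Qed.

Let ne y : [set (mdist y a : R) | a in A] !=set0.
Proof. by case: A0 => a Aa; exists (mdist y a); exists a. Qed.

Lemma set_dist_ge0 y : 0 <= set_dist y.
Proof. by apply: lb_le_inf => //; exact: lb0. Qed.

Lemma set_dist0 y : A y -> set_dist y = 0.
Proof.
move=> Ay; apply/eqP; rewrite eq_le set_dist_ge0 andbT.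
by apply: ge_inf => //; exists y => //; exact: mdistxx.
Qed.

Lemma set_dist_gt0 y : closed A -> ~ A y -> 0 < set_dist y.
Proof.
move=> cA nAy.
have : nbhs y (~` A) by apply: open_nbhs_nbhs; split => //; exact: closed_openC.
move=> /nbhs_ballP[r /= r0 yr]; apply: (lt_le_trans r0).
apply: lb_le_inf => // _ [a Aa <-]; rewrite leNgt; apply/negP => ya.
by apply: (yr a) => //; rewrite ballEmdist.
Qed.

Lemma set_dist_lip y y' : set_dist y <= mdist y y' + set_dist y'.
Proof.
rewrite -lerBlDl; apply: lb_le_inf => // _ [a Aa <-]; rewrite lerBlDl.
apply: (@le_trans _ _ (mdist y a)); last exact: metric_triangle.
by apply: ge_inf => //; exists a.
Qed.

Lemma set_dist_continuous : continuous set_dist.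
Proof.
move=> y; apply/cvgrPdist_lt => eps eps0.
near=> y'.
have yy' : mdist y y' < eps :> R.
  have : ball y eps y' by near: y'; exact: nbhsx_ballx.
  by rewrite ballEmdist.
apply: le_lt_trans yy'.
have := set_dist_lip y y'; have := set_dist_lip y' y.
rewrite (metric_sym y' y) => h1 h2.
by rewrite ler_norml lerBlDr h2 andbT lerBrDr addrC lerBlDr addrC.
Unshelve. all: by end_near. Qed.

End distance_to_set.

Section continuous_dense.
Import HBSimple.
Context (R : realType) (disp : measure_display)
  (M : measurableMetricType disp R) (nu : probability M R).
Hypotheses (M_borel : borel_space M) (M_compact : compact [set: M]).
Local Notation L1 g := (nu.-integrable setT (EFin \o g)).

(** Functions that are limits in mean of continuous functions. *)
Definition mean_approximable (g : M -> R) : Prop := L1 g /\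
  forall eps, 0 < eps ->
    exists2 h : M -> R, continuous h & \int[nu]_y `|g y - h y| <= eps.

Let L1_continuous (h : M -> R) : continuous h -> L1 h.
Proof.
move=> ch; have [C _ hC] := continuous_bounded M_compact ch.
exact: (prob_L1_bounded _ (continuous_measurable M_borel ch) hC).
Qed.

Lemma continuous_mean_approximable (h : M -> R) :
  continuous h -> mean_approximable h.
Proof.
move=> ch; split; first exact: L1_continuous.
move=> eps eps0; exists h => //.
by under eq_Rintegral do rewrite subrr normr0; rewrite Rint_prob_cst ltW.
Qed.

Let mean_triangle (g h k : M -> R) : L1 g -> L1 h -> L1 k ->
  \int[nu]_y `|g y - k y| <=
  \int[nu]_y `|g y - h y| + \int[nu]_y `|h y - k y|.
Proof.
move=> ig ih ik; rewrite -RintegralD//;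
  [|by apply: L1_norm; exact: L1B|by apply: L1_norm; exact: L1B].
apply: le_Rintegral => //; first by apply: L1_norm; exact: L1B.
  by apply: L1D; apply: L1_norm; exact: L1B.
by move=> y _; exact: ler_distD.
Qed.

Lemma mean_approximable_lim (g : M -> R) : L1 g ->
  (forall eps, 0 < eps ->
     exists2 h, mean_approximable h & \int[nu]_y `|g y - h y| <= eps) ->
  mean_approximable g.
Proof.
move=> ig H; split => // eps eps0.
have eps2 : 0 < eps / 2 by rewrite divr_gt0.
have [h [ih Hh] gh] := H _ eps2; have [k ck hk] := Hh _ eps2.
exists k => //; rewrite (splitr eps).
by rewrite (le_trans (mean_triangle ig ih (L1_continuous ck)))// lerD.
Qed.

Lemma mean_approximableD (g1 g2 : M -> R) :
  mean_approximable g1 -> mean_approximable g2 ->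
  mean_approximable (fun y => g1 y + g2 y).
Proof.
move=> [i1 H1] [i2 H2]; split; first exact: L1D.
move=> eps eps0; have eps2 : 0 < eps / 2 by rewrite divr_gt0.
have [h1 ch1 gh1] := H1 _ eps2; have [h2 ch2 gh2] := H2 _ eps2.
exists (fun y => h1 y + h2 y).
  by move=> y; apply: cvgD; [exact: ch1|exact: ch2].
rewrite (splitr eps) (le_trans _ (lerD gh1 gh2))//.
have j1 := L1_continuous ch1; have j2 := L1_continuous ch2.
rewrite -RintegralD//; [|by apply: L1_norm; exact: L1B|by apply: L1_norm; exact: L1B].
apply: le_Rintegral => //; first by apply: L1_norm; apply: L1B; exact: L1D.
  by apply: L1D; apply: L1_norm; exact: L1B.
move=> y _; rewrite (_ : _ - _ = (g1 y - h1 y) + (g2 y - h2 y)); last by ring.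
exact: ler_normD.
Qed.

Lemma mean_approximableZ (c : R) (g : M -> R) :
  mean_approximable g -> mean_approximable (fun y => c * g y).
Proof.
move=> [ig H]; split; first exact: L1Z.
move=> eps eps0; have c0 : 0 < `|c| + 1 by rewrite ltr_wpDl.
have [h ch gh] := H (eps / (`|c| + 1)) (divr_gt0 eps0 c0).
exists (fun y => c * h y).
  by move=> y; apply: cvgM; [exact: cvg_cst|exact: ch].
have j := L1_continuous ch.
under eq_Rintegral do rewrite -mulrBr normrM.
rewrite RintegralZl//; last by apply: L1_norm; exact: L1B.
rewrite (le_trans (ler_wpM2l (normr_ge0 c) gh))// mulrCA ler_piMr//; first exact: ltW.
by rewrite ler_pdivrMr// mul1r lerDl.
Qed.

Lemma mean_approximable_sum (I : Type) (r : seq I) (g : I -> M -> R) :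
  (forall i, mean_approximable (g i)) ->
  mean_approximable (fun y => \sum_(i <- r) g i y).
Proof.
move=> H; elim: r => [|i r IHr].
  rewrite (_ : (fun _ => _) = fun=> 0); last first.
    by apply/funext => y; rewrite big_nil.
  by apply: continuous_mean_approximable => y; exact: cvg_cst.
rewrite (_ : (fun _ => _) = fun y => g i y + \sum_(j <- r) g j y); last first.
  by apply/funext => y; rewrite big_cons.
exact: mean_approximableD.
Qed.

(** Pointwise limits dominated by a constant. *)
Lemma mean_approximable_cvg (g_ : nat -> M -> R) (g : M -> R) (C : R) :
  measurable_fun setT g -> (forall n, mean_approximable (g_ n)) ->
  (forall n y, `|g_ n y| <= C) -> (forall y, `|g y| <= C) ->
  (forall y, g_ n y @[n --> \oo] --> g y) -> mean_approximable g.
Proof.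
move=> mg Hg_ g_C gC g_g.
have ig : L1 g by exact: (prob_L1_bounded _ mg gC).
apply: mean_approximable_lim => // eps eps0.
have : \int[nu]_y `|g y - g_ n y| @[n --> \oo] --> \int[nu]_y (0 : R).
  apply: (Rint_dominated_cvg (h := fun=> C + C)) => //.
  - move=> n; apply: measurableT_comp => //.
    by apply: measurable_funB => //; exact: L1_measurable (Hg_ n).1.
  - exact: prob_L1_cst.
  - by apply: aeW => y n; rewrite normr_id (le_trans (ler_normB _ _))// lerD.
  - apply: aeW => y; rewrite -[X in _ --> X](normr0 R) -(subrr (g y)).
    by apply: cvg_norm; apply: cvgB => //; exact: cvg_cst.
rewrite Rint_prob_cst => H0.
have [n _ /(_ n) Hn] := cvgr0_norm_le _ H0 _ eps0.
exists (g_ n) => //; apply: le_trans (Hn _) => /=; last exact: leqnn.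
exact: ler_norm.
Qed.

(** The indicator of an open set is the pointwise limit of the functions
    [min 1 (n * set_dist (~` U) y)]. *)
Lemma open_mean_approximable (U : set M) : open U -> mean_approximable (\1_U).
Proof.
move=> oU; have [A0|] := pselect (~` U = set0).
  rewrite -(setCK U) A0 setC0; apply: continuous_mean_approximable => y.
  by rewrite indicT; exact: cvg_cst.
move=> /eqP/set0P A0.
have cA : closed (~` U) by exact: open_closedC.
have mU : measurable U by rewrite M_borel; exact: sub_sigma_algebra.
pose h n y : R := Num.min 1 (n%:R * set_dist (~` U) y).
have hge0 n y : 0 <= h n y by rewrite le_min ler01 mulr_ge0// set_dist_ge0.
apply: (@mean_approximable_cvg h _ 1).
- exact: measurable_indic.
- move=> n; apply: continuous_mean_approximable => y.
  apply: (@continuous_min _ _ (fun=> 1) (fun y => n%:R * set_dist (~` U) y)).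
    exact: cvg_cst.
  by apply: cvgM; [exact: cvg_cst|exact: set_dist_continuous].
- by move=> n y; rewrite ger0_norm// ge_min lexx.
- by move=> y; rewrite ger0_norm// indicE; case: (_ \in _).
move=> y; rewrite indicE; have [Uy|nUy] := boolP (y \in U); last first.
  rewrite (_ : (fun n => _) = fun=> 0); first exact: cvg_cst.
  apply/funext => n; rewrite /h set_dist0 ?mulr0 ?min_r//.
  by move=> Uy; move/negP : nUy; apply; rewrite inE.
have dy : 0 < set_dist (~` U) y.
  by apply: set_dist_gt0 => //; rewrite inE in Uy; exact.
apply: cvg_near_cst; near=> n.
rewrite /h min_l// -ler_pdivrMr//; near: n; exact: nbhs_infty_ger.
Unshelve. all: by end_near. Qed.

(** Dynkin: the sets with approximable indicator form a lambda-system that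
    contains the open sets, which generate the Borel sets. *)
Lemma measurable_mean_approximable (A : set M) :
  measurable A -> mean_approximable (\1_A).
Proof.
move=> mA.
suff sub : <<s (@open M) >> `<=`
    [set B | measurable B /\ mean_approximable (\1_B)].
  by apply: (sub A _).2; rewrite -M_borel.
have b1 (B : set M) y : `|\1_B y| <= 1 :> R.
  by rewrite ger0_norm// indicE; case: (_ \in _).
apply: lambda_system_subset => //; first by move=> B C oB oC; exact: openI.
  split.
  - by [].
  - by split => //; apply: open_mean_approximable; exact: openT.
  - move=> B C CB [mB HB] [mC HC]; split; first exact: measurableD.
    rewrite (_ : \1_(B `\` C) = fun y => \1_B y + (-1) * \1_C y).
      by apply: mean_approximableD => //; exact: mean_approximableZ.
    apply/funext => y; rewrite !indicE in_setD.
    have [Cy|nCy] := boolP (y \in C).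
      by rewrite (_ : y \in B) /= ?subrr ?mulr1 ?subrr// inE; apply: CB; rewrite -inE.
    by rewrite andbT mulr0 addr0.
  - move=> F ndF HF.
    have mF : measurable (\bigcup_i F i).
      by apply: bigcup_measurable => i _; exact: (HF i).1.
    split => //; apply: (@mean_approximable_cvg (fun n => \1_(F n)) _ 1) => //.
      by move=> n; exact: (HF n).2.
    move=> y; rewrite indicE; have [Fy|nFy] := boolP (y \in _); last first.
      rewrite (_ : (fun n => _) = fun=> 0); first exact: cvg_cst.
      apply/funext => n; rewrite indicE memNset// => Fny.
      by move/negP : nFy; apply; rewrite inE; exists n.
    rewrite inE in Fy; have [n _ Fny] := Fy.
    apply: cvg_near_cst; exists n => // m /= nm; rewrite indicE mem_set//.
    by have /subsetPset := ndF _ _ nm; exact.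
move=> U oU; split; first by rewrite M_borel; exact: sub_sigma_algebra.
exact: open_mean_approximable.
Qed.

Lemma continuous_dense_in_mean (g : M -> R) : L1 g -> mean_approximable g.
Proof.
move=> ig; apply: mean_approximable_lim => // eps eps0.
have [s [is_ _ s0]] := approximation_sfun_integrable measurableT ig.
have s0' : \int[nu]_y `|g y - s n y| @[n --> \oo] --> (0 : R).
  exact: (fine_cvg s0).
have [N _ HN] := cvgr0_norm_le _ s0' _ eps0.
exists (s N); last exact: le_trans (ler_norm _) (HN N (leqnn N)).
rewrite (_ : (s N : M -> R) = fun y =>
    \sum_(x <- finmap.enum_fset (fset_set (range (s N))))
      x * \1_(s N @^-1` [set x]) y).
  apply: mean_approximable_sum => x; apply: mean_approximableZ.
  exact: measurable_mean_approximable.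
by apply/funext => y; rewrite {1}fimfunE fsbig_finite.
Qed.

End continuous_dense.

(** * Lattice boxes and integrals over finitely many fibres *)

Section lattice_boxes.
Context (d : nat).
Implicit Types (c u z : Zd d) (w : nat).

(** The lattice point at offset [k] from the corner [c]. *)
Definition box_point c w (k : {ffun 'I_d -> 'I_w}) : Zd d :=
  (\row_i (coordZ c i + (k i)%:Z) : 'rV[int]_d).

(** The enumeration of the lattice points [z] with [c i <= z i < c i + w] for
    all [i]. *)
Definition box c w : seq (Zd d) :=
  [seq box_point c k | k <- enum {ffun 'I_d -> 'I_w}].

Lemma coordZ_row (g : 'I_d -> int) i : coordZ (\row_j g j : 'rV[int]_d) i = g i.
Proof. by rewrite /coordZ mxE. Qed.

Lemma coordZD u z i : coordZ (u + z) i = coordZ u i + coordZ z i.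
Proof. by rewrite /coordZ mxE. Qed.

Lemma coordZN u i : coordZ (- u) i = - coordZ u i.
Proof. by rewrite /coordZ mxE. Qed.

Lemma box_uniq c w : uniq (box c w).
Proof.
rewrite map_inj_uniq ?enum_uniq// => k k' /Zd_eqP kk'.
apply/ffunP => i; apply: val_inj; have := kk' i.
by rewrite !coordZ_row => /addrI [].
Qed.

Lemma size_box c w : size (box c w) = (w ^ d)%N.
Proof. by rewrite size_map -cardE card_ffun !card_ord. Qed.

Lemma mem_box c w z :
  reflect (forall i, coordZ c i <= coordZ z i < coordZ c i + w%:Z)
          (z \in box c w).
Proof.
apply: (iffP mapP) => [[k _ ->] i|H].
  by rewrite coordZ_row lerDl ltrD2l ltz_nat ltn_ord andbT.
have H' i : (`|coordZ z i - coordZ c i|%N < w)%N.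
  by have /andP[] := H i; lia.
exists [ffun i => Ordinal (H' i)]; first by rewrite mem_enum.
apply/Zd_eqP => i; rewrite coordZ_row ffunE /=.
by have /andP[] := H i; lia.
Qed.

Lemma box_shift c w u : map (fun z => z + u) (box c w) = box (c + u) w.
Proof.
rewrite -map_comp; apply: eq_map => k /=; apply/Zd_eqP => i.
by rewrite coordZD !coordZ_row coordZD addrAC.
Qed.

Lemma sum_box_shift (R : realType) c w u (g : Zd d -> R) :
  \sum_(z <- box c w) g (z + u) = \sum_(z <- box (c + u) w) g z.
Proof. by rewrite -box_shift [RHS]big_map. Qed.

End lattice_boxes.

Section finite_fibres.
Context (R : realType) (d : nat).
Local Notation lam := (lebesgue_tuple R d).

Lemma L1_cell (u : Zd d) (l : R) : 0 < l ->
  lam.-integrable setT (EFin \o (\1_[set t | cell_index l t = u] : _ -> R)).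
Proof.
move=> l0; apply/integrableP; split.
  by apply/measurable_EFinP/measurable_indic; exact: measurable_cell.
under eq_integral => t _ do rewrite /= ger0_norm//.
rewrite integral_indic//; last exact: measurable_cell.
rewrite setIT; have := ltry ((l^-1) ^+ d).
by rewrite -(lebesgue_tuple_cell u l0); exact.
Qed.

Lemma cell_index_sum (s : seq (Zd d)) (g : Zd d -> R) (l : R) : uniq s ->
  (forall u, u \notin s -> g u = 0) ->
  (fun t => g (cell_index l t)) =
  (fun t => \sum_(u <- s) g u * \1_[set t | cell_index l t = u] t).
Proof.
move=> us gs; apply/funext => t.
have [ts|ts] := boolP (cell_index l t \in s); last first.
  rewrite gs// big_seq big1// => u us'; rewrite indicE memNset ?mulr0//=.
  by move=> E; rewrite E us' in ts.
rewrite (bigD1_seq (cell_index l t))//= indicE mem_set// mulr1.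
rewrite big1 ?addr0// => u /eqP ut; rewrite indicE memNset ?mulr0//=.
exact/nesym.
Qed.

Lemma L1_lattice_finite (s : seq (Zd d)) (g : Zd d -> R) (l : R) : 0 < l ->
  uniq s -> (forall u, u \notin s -> g u = 0) ->
  lam.-integrable setT (EFin \o (fun t => g (cell_index l t))).
Proof.
move=> l0 us gs; rewrite (cell_index_sum _ us gs).
by apply: L1_sum => u _; apply: L1Z; exact: L1_cell.
Qed.

(** The integral of a finitely supported function of the cell index is the sum
    of its values times the volume of a cell. *)
Lemma Rint_lattice_finite (s : seq (Zd d)) (g : Zd d -> R) (l : R) : 0 < l ->
  uniq s -> (forall u, u \notin s -> g u = 0) ->
  \int[lam]_t g (cell_index l t) = (l^-1) ^+ d * \sum_(u <- s) g u.
Proof.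
move=> l0 us gs; rewrite (cell_index_sum _ us gs).
rewrite Rint_sum => [|u _]; last by apply: L1Z; exact: L1_cell.
rewrite mulr_sumr; apply: eq_bigr => u _.
rewrite RintegralZl//; last exact: L1_cell.
rewrite Rint_indic; last exact: measurable_cell.
by rewrite (congr1 fine (lebesgue_tuple_cell u l0)) mulrC.
Qed.

Context (disp : measure_display) (M : measurableMetricType disp R)
  (nu : probability M R).
Local Notation cnt := (@counting_Zd R d).
Local Notation mu := (skew_measure d nu).

Lemma counting_seq (s : seq (Zd d)) : uniq s ->
  cnt [set z | z \in s] = (size s)%:R%:E.
Proof.
move=> us; rewrite /counting_Zd /counting asboolT; last exact: finite_seq.
congr ((_%:R)%:E); apply/esym/perm_size/uniq_perm => //.
  exact: finmap.fset_uniq.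
by move=> z; apply/idP/idP; rewrite in_fset_set ?inE//; exact: finite_seq.
Qed.

Lemma Rint_counting_at (h : Zd d -> R) (u : Zd d) :
  (\int[cnt]_z (h z * \1_[set z | z = u] z)%:E)%E = (h u)%:E.
Proof.
transitivity (\int[cnt]_z ((h u)%:E * (\1_[set z | z = u] z)%:E))%E.
  apply: eq_integral => z _; rewrite -EFinM indicE.
  by have [->//|zu] := eqVneq z u; rewrite memNset ?mulr0//; exact/eqP.
have c1 : cnt [set z | z = u] = 1%E.
  rewrite (_ : [set z | _] = [set z | z \in [:: u]]); first exact: counting_seq.
  by apply/seteqP; split=> z /=; rewrite inE => /eqP.
rewrite integralZl//; last first.
  apply/integrableP; split; first exact/measurable_EFinP/measurable_indic.
  under eq_integral => t _ do rewrite /= ger0_norm//.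
  rewrite integral_indic// setIT; have := ltry (1 : R).
  by rewrite -[X in (X < _)%E]c1; exact.
rewrite integral_indic// setIT -[RHS]mule1; congr (_ * _)%E; exact: c1.
Qed.

Lemma measurable_fibre (u : Zd d) : measurable [set x : M * Zd d | x.2 = u].
Proof.
rewrite (_ : mkset _ = setT `*` [set u]); first exact: measurableX.
by apply/seteqP; split=> [[y z] /=|[y z] /= [_ ->]].
Qed.

Lemma skew_measure_seq (s : seq (Zd d)) : uniq s ->
  mu [set x | x.2 \in s] = (size s)%:R%:E.
Proof.
move=> us; rewrite (_ : mkset _ = setT `*` [set z | z \in s]); last first.
  by apply/seteqP; split=> [[y z]|[y z] []].
rewrite /skew_measure /= product_measure1E//.
by rewrite [X in (X * _)%E](probability_setT nu) mul1e; exact: counting_seq.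
Qed.

Section bounded_integrand.
Variables (g : M * Zd d -> R) (C : R).
Hypotheses (mg : measurable_fun setT g) (gC : forall x, `|g x| <= C).

Lemma L1_fibre (u : Zd d) :
  mu.-integrable setT (EFin \o (fun x => g x * \1_[set x | x.2 = u] x)).
Proof.
have C0 : 0 <= C by exact: le_trans (normr_ge0 _) (gC point).
have m1 : measurable_fun setT (fun x : M * Zd d => g x * \1_[set x | x.2 = u] x).
  by apply: measurable_funM => //; apply: measurable_indic; exact: measurable_fibre.
have ic : mu.-integrable setT (EFin \o (fun x => C * \1_[set x | x.2 = u] x)).
  apply: L1Z; apply/integrableP; split.
    by apply/measurable_EFinP/measurable_indic; exact: measurable_fibre.
  under eq_integral => t _ do rewrite /= ger0_norm//.
  rewrite integral_indic//; last exact: measurable_fibre.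
  rewrite setIT (_ : mkset _ = [set x | x.2 \in [:: u]]).
    have := ltry (1 : R).
    by rewrite -[X in (X < _)%E](@skew_measure_seq [:: u])//; exact.
  by apply/seteqP; split=> x /=; rewrite inE => /eqP.
apply: (L1_le m1 ic) => x; rewrite normrM (@ger0_norm _ (\1__ _))//.
by rewrite ler_wpM2r.
Qed.

Lemma Rint_fibre (u : Zd d) :
  \int[mu]_x (g x * \1_[set x | x.2 = u] x) = slice_mean nu g u.
Proof.
apply: EFin_inj; rewrite EFin_Rint; last exact: L1_fibre.
rewrite -(integral12_prod_meas1 (m1 := nu) (m2 := cnt) (L1_fibre u)).
rewrite /slice_mean EFin_Rint; last first.
  apply: (@prob_L1_bounded _ _ _ _ C) => //.
  exact: (measurableT_comp mg (measurable_pair2 u)).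
apply: eq_integral => y _; rewrite /fubini_F /=.
by rewrite -(Rint_counting_at (fun z => g (y, z)) u).
Qed.

(** An integral over the fibres above [Q] is a finite sum as soon as [Q] is
    contained in a finite list. *)
Lemma Rint_fibres (s : seq (Zd d)) (Q : set (Zd d)) : uniq s ->
  Q `<=` [set z | z \in s] ->
  \int[mu]_(x in [set x | Q x.2]) g x =
    \sum_(u <- s) \1_Q u * slice_mean nu g u.
Proof.
move=> us Qs; rewrite Rintegral_mkcond.
transitivity (\int[mu]_x (\sum_(u <- s)
    \1_Q u * (g x * \1_[set x | x.2 = u] x))).
  apply: eq_Rintegral => x _; rewrite /patch.
  have [xQ|xQ] := boolP (x.2 \in Q).
    have xs : x.2 \in s by apply: Qs; rewrite -inE.
    rewrite mem_set; last by rewrite inE in xQ.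
    rewrite (bigD1_seq x.2)//= !indicE xQ mem_set// mul1r mulr1.
    rewrite big1 ?addr0// => u /eqP ux; rewrite [X in _ * (_ * X)]indicE.
    by rewrite memNset ?mulr0//=; exact/nesym.
  rewrite memNset; last by move=> /= Qx; move: xQ; rewrite mem_set.
  rewrite big1// => u _; have [xu|xu] := eqVneq x.2 u.
    by rewrite indicE -xu (negbTE xQ) mul0r.
  by rewrite [X in _ * (_ * X)]indicE memNset ?mulr0//=; exact/eqP.
rewrite Rint_sum => [|u _]; last by apply: L1Z; exact: L1_fibre.
by apply: eq_bigr => u _; rewrite RintegralZl ?Rint_fibre//; exact: L1_fibre.
Qed.

Lemma Rint_fibres_seq (s : seq (Zd d)) : uniq s ->
  \int[mu]_(x in [set x | x.2 \in s]) g x = \sum_(u <- s) slice_mean nu g u.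
Proof.
move=> us; rewrite (Rint_fibres us (Q := [set z | z \in s]))//.
rewrite big_seq [RHS]big_seq; apply: eq_bigr => u us'.
by rewrite indicE mem_set// mul1r.
Qed.

End bounded_integrand.

(** The least point of the cube of size [w] centered at [z]: the cube with
    half-open intervals [(z i - w %/ 2, z i + (w - w %/ 2)]] is the union of the
    fibres over the box with this corner. *)
Definition cube_corner (z : Zd d) (w : nat) : Zd d :=
  (\row_i (coordZ z i - (w %/ 2)%:Z + 1) : 'rV[int]_d).

Lemma cubeE (z : Zd d) (w : nat) :
  cube (M := M) z w = [set x | x.2 \in box (cube_corner z w) w].
Proof.
apply/seteqP; split=> [x /= H|x /= /mem_box H i].
  by apply/mem_box => i; rewrite coordZ_row; have := H i; lia.
by have := H i; rewrite coordZ_row; lia.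
Qed.

Lemma skew_measure_cube (z : Zd d) (w : nat) :
  mu (cube z w) = (w%:R ^+ d)%:E.
Proof. by rewrite cubeE skew_measure_seq ?box_uniq// size_box natrX. Qed.

Lemma average_cube (g : M * Zd d -> R) (C : R) (z : Zd d) (w : nat) :
  measurable_fun setT g -> (forall x, `|g x| <= C) ->
  average nu (cube z w) g =
    (w%:R ^+ d)^-1 * \sum_(u <- box (cube_corner z w) w) slice_mean nu g u.
Proof.
move=> mg gC; rewrite /average skew_measure_cube cubeE.
by rewrite (Rint_fibres_seq mg gC)// box_uniq.
Qed.

End finite_fibres.

(** * Box averages determine weak limits *)

Section box_weak_limit.
Context (R : realType) (d : nat).
Local Notation RT := (measurableTypeR R).
Local Notation D := (d.-tuple RT).
Local Notation lam := (lebesgue_tuple R d).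

(** The half-open box with corners [a] and [b]. *)
Definition real_box (a b : 'I_d -> R) : set D :=
  [set t | forall j, a j <= tnth t j < b j].

(** The lattice points of [N] times the closed box with corners [a] and [b]. *)
Definition lattice_box (a b : 'I_d -> R) (N : nat) : set (Zd d) :=
  [set u | forall j, a j * N%:R <= (coordZ u j)%:~R <= b j * N%:R].

Lemma measurable_real_box (a b : 'I_d -> R) : measurable (real_box a b).
Proof.
rewrite (_ : real_box a b = [set t | forall j, `[a j, b j[%classic (tnth t j)]).
  apply: (@measurable_tuple_box _ _ (fun j => `[a j, b j[%classic)) => j.
  exact: measurable_itv.
by apply/seteqP; split=> t /= H j; have := H j; rewrite /= in_itv.
Qed.

Lemma lebesgue_real_box (a b : 'I_d -> R) : (forall j, a j <= b j) ->
  lam (real_box a b) = (\prod_j (b j - a j))%:E.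
Proof.
move=> ab.
rewrite (_ : real_box a b = [set t | forall j, `[a j, b j[%classic (tnth t j)]).
  rewrite (@lebesgue_tuple_box _ _ (fun j => `[a j, b j[%classic)) => [|j].
    rewrite -prodEFin; apply: eq_bigr => j _; rewrite lebesgue_measure_itv/= lte_fin.
    have [//|ba] := ltP (a j) (b j).
    by rewrite (_ : b j = a j) ?subrr//; apply/eqP; rewrite eq_le ba ab.
  exact: measurable_itv.
by apply/seteqP; split=> t /= H j; have := H j; rewrite /= in_itv.
Qed.

Lemma L1_real_box (a b : 'I_d -> R) : (forall j, a j <= b j) ->
  lam.-integrable setT (EFin \o (\1_(real_box a b) : D -> R)).
Proof.
move=> ab; have mB := measurable_real_box a b.
apply/integrableP; split; first exact/measurable_EFinP/measurable_indic.
under eq_integral => t _ do rewrite /= ger0_norm//.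
rewrite integral_indic// setIT; have := ltry (\prod_j (b j - a j)).
by rewrite -(lebesgue_real_box ab); exact.
Qed.

Lemma hyperplane_null (j : 'I_d) (x : R) :
  {ae lam, forall t : D, tnth t j != x}.
Proof.
exists [set t | forall i, (if i == j then [set x] else setT) (tnth t i)].
have mA i : measurable ((if i == j then [set x] else setT) : set RT).
  by case: ifP => _; [exact: measurable_set1|exact: measurableT].
split.
- exact: (@measurable_tuple_box _ _ (fun i => if i == j then [set x] else setT)).
- rewrite (@lebesgue_tuple_box _ _ (fun i => if i == j then [set x] else setT))//.
  by rewrite (bigD1 j)//= eqxx lebesgue_measure_set1 mul0e.
- move=> t /= /negP; rewrite negbK => /eqP tj i.
  by case: eqVneq => // ->.
Qed.

(** A finite enumeration of a superset of [lattice_box a b N]. *)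
Definition lattice_box_cover (a b : 'I_d -> R) (N : nat) : seq (Zd d) :=
  box (\row_j Num.floor (a j * N%:R) : 'rV[int]_d)
    (\sum_j `|Num.floor (b j * N%:R) - Num.floor (a j * N%:R)|%N).+1.

Lemma lattice_box_sub_cover (a b : 'I_d -> R) (N : nat) :
  lattice_box a b N `<=` [set u | u \in lattice_box_cover a b N].
Proof.
move=> u H; apply/mem_box => j; rewrite coordZ_row.
have /andP[h1 h2] := H j.
have k1 : Num.floor (a j * N%:R) <= coordZ u j.
  by rewrite -(@intrKfloor R (coordZ u j)); exact: le_floor.
have k2 : coordZ u j <= Num.floor (b j * N%:R).
  by rewrite -(@intrKfloor R (coordZ u j)); exact: le_floor.
rewrite k1 /=; apply: (le_lt_trans k2).
have : (`|Num.floor (b j * N%:R) - Num.floor (a j * N%:R)| <=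
    \sum_i `|Num.floor (b i * N%:R) - Num.floor (a i * N%:R)|)%N.
  by rewrite (bigD1 j)//= leq_addr.
move: (\sum_i _)%N (Num.floor (b j * N%:R)) (Num.floor (a j * N%:R)) => S F G.
by lia.
Qed.

(** The sum of [A] over [lattice_box a b N]. *)
Definition lattice_box_sum (a b : 'I_d -> R) (N : nat) (A : Zd d -> R) : R :=
  \sum_(u <- lattice_box_cover a b N) \1_(lattice_box a b N) u * A u.

Lemma lattice_box_sumE (a b : 'I_d -> R) (N : nat) (A : Zd d -> R) (l : R) :
  0 < l ->
  \int[lam]_t (\1_(lattice_box a b N) (cell_index l t) * A (cell_index l t)) =
    (l^-1) ^+ d * lattice_box_sum a b N A.
Proof.
move=> l0; rewrite /lattice_box_sum.
rewrite -(Rint_lattice_finite (s := lattice_box_cover a b N)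
  (g := fun u => \1_(lattice_box a b N) u * A u) l0)//.
  exact: box_uniq.
move=> u us; rewrite indicE memNset ?mul0r// => uQ.
by move: us; rewrite (lattice_box_sub_cover uQ).
Qed.

Lemma near_le_eq (u v : nat -> R) (x y : R) :
  u n @[n --> \oo] --> x -> v n @[n --> \oo] --> y -> x != y ->
  \forall n \near \oo, (u n <= v n) = (x <= y).
Proof.
move=> ux vy; rewrite neq_lt => /orP[xy|yx]; near=> n.
  rewrite (ltW xy); apply: (@le_trans _ _ ((x + y) / 2)); apply: ltW.
    by near: n; apply: (cvgr_lt x) => //; lra.
  by near: n; apply: (cvgr_gt y) => //; lra.
rewrite leNgt [RHS]leNgt yx /=; apply/negbTE; rewrite negbK.
apply: (@lt_trans _ _ ((x + y) / 2)).
  by near: n; apply: (cvgr_lt y) => //; lra.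
by near: n; apply: (cvgr_gt x) => //; lra.
Unshelve. all: by end_near. Qed.

Section scale.
Variable L : nat -> R.
Hypotheses (L_gt0 : forall n, 0 < L n) (Loo : L n @[n --> \oo] --> +oo).

Let Linv : (L n)^-1 @[n --> \oo] --> (0 : R).
Proof. by apply/gtr0_cvgV0 => //; exact: nearW. Qed.

Let N n := Num.truncn (L n).

Lemma cell_index_cvg (x : R) :
  (Num.floor (L n * x))%:~R / L n @[n --> \oo] --> x.
Proof.
apply/subr_cvg0; apply: (cvg0_le _ _ Linv) => n; rewrite distrC.
  rewrite (_ : x - _ = (L n * x - (Num.floor (L n * x))%:~R) / L n); last first.
    by rewrite mulrBl mulrAC mulfV ?mul1r// gt_eqF.
  have Ln0 : 0 <= (L n)^-1 by rewrite invr_ge0 ltW.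
  rewrite normrM (ger0_norm Ln0) -[leRHS]mul1r ler_wpM2r//.
  have h1 : (Num.floor (L n * x))%:~R <= L n * x by exact: floor_le_tmp.
  have h2 : L n * x < (Num.floor (L n * x) + 1)%:~R by exact: floorD1_gt.
  rewrite ger0_norm ?subr_ge0// lerBlDr; apply: ltW.
  by rewrite addrC -[X in _ + X]/(1%:~R) -intrD.
Qed.

Lemma truncn_scale_cvg : (N n)%:R / L n @[n --> \oo] --> (1 : R).
Proof.
apply/subr_cvg0; apply: (cvg0_le _ _ Linv) => n; rewrite distrC.
  rewrite (_ : 1 - _ = (L n - (N n)%:R) / L n); last first.
    by rewrite mulrBl mulfV// gt_eqF.
  have Ln0 : 0 <= (L n)^-1 by rewrite invr_ge0 ltW.
  rewrite normrM (ger0_norm Ln0) -[leRHS]mul1r ler_wpM2r//.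
  have /andP[h1 h2] := truncn_itv (ltW (L_gt0 n)).
  rewrite ger0_norm ?subr_ge0// lerBlDr; apply: ltW.
  by rewrite addrC natr1.
Qed.

Lemma truncn_scale_oo : N n @[n --> \oo] --> \oo.
Proof.
apply/cvgnyPge => K; near=> n.
rewrite truncn_ge_nat; last exact: ltW.
near: n; exact: (cvgryPge _).1.
Unshelve. all: by end_near. Qed.

(** After rescaling by [L n], the lattice points of a dilated closed box fill up
    the half-open real box: the indicators converge off the hyperplanes spanned
    by the faces, which are null. The dilation factor is the integer part of
    [L n], as box averages are only known along integers. *)
Lemma lattice_box_cvg (a b : 'I_d -> R) : (forall j, a j < b j) ->
  \int[lam]_t `|\1_(lattice_box a b (N n)) (cell_index (L n) t)
                - \1_(real_box a b) t| @[n --> \oo] --> (0 : R).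
Proof.
move=> ab.
have [W [_ HW]] := cvg_seq_bounded (cvgP _ Linv).
have W1 n : (L n)^-1 <= `|W| + 1.
  have WW : W < `|W| + 1 by rewrite (le_lt_trans (ler_norm W))// ltrDl.
  have Ln0 : 0 <= (L n)^-1 by rewrite invr_ge0 ltW.
  by have := HW _ WW n I; rewrite /= ger0_norm.
pose K := `|W| + 1 + \sum_j (`|a j| + `|b j|).
have Kj j : `|W| + 1 + (`|a j| + `|b j|) <= K.
  by rewrite lerD2l (bigD1 j)//= lerDl sumr_ge0// => i _; rewrite addr_ge0.
have K0 : - K <= K by rewrite ge0_cp// !addr_ge0// sumr_ge0// => i _; rewrite addr_ge0.
have iB := L1_real_box (fun j : 'I_d => K0).
have mQ n : measurable_fun setT
    (fun t => \1_(lattice_box a b (N n)) (cell_index (L n) t) : R).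
  exact: measurable_lattice.
have mB : measurable_fun setT (\1_(real_box a b) : D -> R).
  by apply: measurable_indic; exact: measurable_real_box.
rewrite -[X in _ --> X](mul0r (fine (lam setT))) -Rintegral_cst//.
(* Both boxes lie in the cube of side [2 K], since [1 / L n] is bounded. *)
apply: (Rint_dominated_cvg _ _ iB) => //.
- by move=> n; apply: measurableT_comp => //; exact: measurable_funB.
- apply: aeW => t n; rewrite normr_id.
  have [tK|tK] := pselect (real_box (fun=> - K) (fun=> K) t).
    rewrite [X in _ <= X]indicE mem_set// !indicE.
    by case: (_ \in _); case: (_ \in _);
      rewrite /= ?subrr ?subr0 ?sub0r ?normrN ?normr0 ?normr1.
  have tB : ~ real_box a b t.
    apply: contra_not tK => tab j; have /andP[h1 h2] := tab j.
    have := Kj j; have := ler_norm (b j); have := ler_norm (- a j).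
    have := normr_ge0 W; have := normr_ge0 (a j); have := normr_ge0 (b j).
    by rewrite normrN => *; apply/andP; split; lra.
  have tQ : ~ lattice_box a b (N n) (cell_index (L n) t).
    apply: contra_not tK => tQ j; have /andP[h1 h2] := tQ j.
    rewrite cell_indexE in h1 h2.
    have f1 : (Num.floor (L n * tnth t j))%:~R <= L n * tnth t j by exact: floor_le_tmp.
    have f2 : L n * tnth t j < (Num.floor (L n * tnth t j) + 1)%:~R by exact: floorD1_gt.
    rewrite intrD in f2.
    have /andP[n1 _] := truncn_itv (ltW (L_gt0 n)).
    have n0 : 0 <= (N n)%:R :> R by [].
    have na : - `|a j| * L n <= a j * (N n)%:R.
      rewrite mulNr lerNl -mulNr (le_trans (ler_norm _))// normrM normrN.
      by rewrite (ger0_norm n0) ler_wpM2l.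
    have nb : b j * (N n)%:R <= `|b j| * L n.
      rewrite (le_trans (ler_norm _))// normrM.
      by rewrite (ger0_norm n0) ler_wpM2l.
    have l1 : 1 <= (`|W| + 1) * L n by rewrite -ler_pdivrMr// div1r.
    have := Kj j; have W0 := normr_ge0 W; have a0 := normr_ge0 (a j).
    have b0 := normr_ge0 (b j) => Kj'.
    have t1 : - `|a j| <= tnth t j.
      rewrite -(ler_pM2r (L_gt0 n)) mulrC [leRHS]mulrC mulrC.
      by apply: le_trans f1; apply: le_trans h1.
    have t2 : tnth t j < `|b j| + (`|W| + 1).
      rewrite -(ltr_pM2r (L_gt0 n)) mulrDl [ltLHS]mulrC; apply: (lt_le_trans f2).
      by apply: lerD => //; apply: le_trans h2 nb.
    by apply/andP; split; lra.
  by rewrite !indicE !memNset// subrr normr0.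
- have H : {ae lam, forall t : D, forall j, tnth t j != a j /\ tnth t j != b j}.
    apply: filter_forall => j; apply: filterI.
      exact: hyperplane_null.
    exact: hyperplane_null.
  apply: filterS H => t tab.
  have En : \forall n \near \oo, forall j,
      (a j * (N n)%:R <= (Num.floor (L n * tnth t j))%:~R) = (a j <= tnth t j) /\
      ((Num.floor (L n * tnth t j))%:~R <= b j * (N n)%:R) = (tnth t j <= b j).
    apply: filter_forall => j; have [ta tb] := tab j.
    have rN c : c * ((N n)%:R / L n) @[n --> \oo] --> c.
      rewrite -[X in _ --> X]mulr1.
      by apply: cvgM; [exact: cvg_cst|exact: truncn_scale_cvg].
    have ta' : a j != tnth t j by rewrite eq_sym.
    have Ea := near_le_eq (rN (a j)) (@cell_index_cvg (tnth t j)) ta'.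
    have Eb := near_le_eq (@cell_index_cvg (tnth t j)) (rN (b j)) tb.
    apply: filterS2 Ea Eb => n <- <-.
    by rewrite !mulrA !ler_pM2r// invr_gt0.
  apply: cvg_near_cst; apply: filterS En => n En.
  rewrite (_ : \1_(lattice_box _ _ _) _ = \1_(real_box a b) t) ?subrr ?normr0//.
  rewrite !indicE; congr ((_ : bool)%:R); apply/idP/idP; rewrite !inE => Hn j.
    have := Hn j; rewrite cell_indexE; have [-> ->] := En j.
    by rewrite [X in _ -> _ && X]lt_neqAle (tab j).2.
  rewrite cell_indexE; have [-> ->] := En j.
  by have /andP[-> /ltW ->] := Hn j.
Qed.

End scale.
End box_weak_limit.

Section weak_limit.
Context (R : realType) (d : nat).
Local Notation RT := (measurableTypeR R).
Local Notation D := (d.-tuple RT).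
Local Notation lam := (lebesgue_tuple R d).

(** The averages of [A] over dilated boxes converge to [Abar]. *)
Definition box_averages_cvg (A : Zd d -> R) (Abar : R) : Prop :=
  forall a b : 'I_d -> R, (forall j, a j < b j) ->
    (\prod_j (b j * N%:R - a j * N%:R))^-1 * lattice_box_sum a b N A
      @[N --> \oo] --> Abar.

Section step.
Variables (L : nat -> R) (A : Zd d -> R) (C Abar : R).
Hypotheses (L_gt0 : forall n, 0 < L n) (Loo : L n @[n --> \oo] --> +oo).
Hypotheses (AC : forall u, `|A u| <= C) (HA : box_averages_cvg A Abar).

Lemma L1_mul_lattice (q : D -> R) (n : nat) : lam.-integrable setT (EFin \o q) ->
  lam.-integrable setT (EFin \o (fun t => q t * A (cell_index (L n) t))).
Proof.
move=> iq; apply: (L1_mul_bounded iq (measurable_lattice A (L_gt0 n))) => t.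
exact: AC.
Qed.

(** The function [A] at the rounded points [L n t] has mean value close to [Abar]
    over every fixed box. *)
Lemma box_mean_cvg (a b : 'I_d -> R) : (forall j, a j < b j) ->
  \int[lam]_t (\1_(real_box a b) t * A (cell_index (L n) t)) @[n --> \oo] -->
    (\int[lam]_t \1_(real_box a b) t) * Abar.
Proof.
move=> ab; have ab' j := ltW (ab j).
pose N n := Num.truncn (L n).
have C0 : 0 <= C by exact: le_trans (normr_ge0 _) (AC point).
have Noo := truncn_scale_oo L_gt0 Loo.
have vol0 : 0 < \prod_j (b j - a j) by apply: prodr_gt0 => j _; rewrite subr_gt0.
have mB := measurable_real_box a b.
rewrite Rint_indic// (congr1 fine (lebesgue_real_box ab')) /=.
(* The normalised sum over the dilated lattice box. *)
pose X n := \int[lam]_t (\1_(lattice_box a b (N n)) (cell_index (L n) t) *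
                         A (cell_index (L n) t)).
have XE n : (0 < N n)%N -> X n = ((N n)%:R / L n) ^+ d * (\prod_j (b j - a j) *
    ((\prod_j (b j * (N n)%:R - a j * (N n)%:R))^-1 *
      lattice_box_sum a b (N n) A)).
  move=> N0; rewrite /X lattice_box_sumE//.
  have -> : \prod_j (b j * (N n)%:R - a j * (N n)%:R) =
      \prod_j (b j - a j) * (N n)%:R ^+ d.
    under eq_bigr do rewrite -mulrBl.
    by rewrite big_split /= prodr_const card_ord.
  rewrite exprMn !mulrA; congr (_ * _).
  rewrite invfM !mulrA -[RHS]mulrA mulrAC.
  have v0 : \prod_j (b j - a j) != 0 by rewrite gt_eqF.
  have N0' : (N n)%:R ^+ d != 0 :> R by rewrite expf_neq0// pnatr_eq0 -lt0n.
  set v := \prod_j _ in v0 *; set m := (N n)%:R ^+ d in N0' *.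
  set l := (L n)^-1 ^+ d.
  by field; rewrite v0 N0'.
have Xcvg : X n @[n --> \oo] --> \prod_j (b j - a j) * Abar.
  have H : ((N n)%:R / L n) ^+ d * (\prod_j (b j - a j) *
    ((\prod_j (b j * (N n)%:R - a j * (N n)%:R))^-1 *
      lattice_box_sum a b (N n) A)) @[n --> \oo] -->
      1 ^+ d * (\prod_j (b j - a j) * Abar).
    apply: cvgM.
      apply: (@cvg_comp _ _ _ (fun n => (N n)%:R / L n) (fun x => x ^+ d)
        _ (nbhs (1 : R))).
        exact: (truncn_scale_cvg L_gt0 Loo).
      exact: exprn_continuous.
    apply: cvgM; first exact: cvg_cst.
    exact: (cvg_comp _ _ Noo (HA ab)).
  rewrite expr1n mul1r in H; apply: cvg_trans H; apply: near_eq_cvg.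
  have : \forall n \near \oo, (0 < N n)%N by move/cvgnyPgt : Noo; apply.
  by apply: filterS => n /XE.
have D0 : \int[lam]_t (\1_(real_box a b) t * A (cell_index (L n) t)) - X n
    @[n --> \oo] --> (0 : R).
  apply: (cvg0_le _ (v := fun n => C * \int[lam]_t
      `|\1_(lattice_box a b (N n)) (cell_index (L n) t) - \1_(real_box a b) t|)).
    move=> n; have iB := L1_real_box ab'.
    have mQ : measurable_fun setT
        (fun t => \1_(lattice_box a b (N n)) (cell_index (L n) t) : R).
      exact: measurable_lattice.
    have iQ : lam.-integrable setT (EFin \o
        (fun t => \1_(lattice_box a b (N n)) (cell_index (L n) t) : R)).
      apply: (L1_lattice_finite (s := lattice_box_cover a b (N n))
        (g := \1_(lattice_box a b (N n)))) => //.
        exact: box_uniq.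
      move=> u us; rewrite indicE memNset// => uQ.
      by move: us; rewrite (lattice_box_sub_cover uQ).
    have id := L1_norm (L1B iQ iB).
    rewrite -RintegralZl//; apply: le_norm_RintB.
    - exact: (L1_mul_lattice n iB).
    - exact: (L1_mul_lattice n iQ).
    - exact: L1Z.
    - by move=> t; rewrite -mulrBl normrM distrC mulrC ler_wpM2r.
  rewrite -[X in _ --> X](mulr0 C).
  exact: (cvgM (cvg_cst C) (lattice_box_cvg L_gt0 Loo ab)).
rewrite -[X in _ --> X]add0r.
rewrite (_ : (fun n => _) = fun n => \int[lam]_t (\1_(real_box a b) t *
    A (cell_index (L n) t)) - X n + X n); first exact: cvgD.
by apply/funext => n; rewrite subrK.
Qed.

End step.
End weak_limit.

Section step_approximation.
Context (R : realType) (d : nat) (p : 'rV[R]_d -> R).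
Local Notation RT := (measurableTypeR R).
Local Notation D := (d.-tuple RT).
Local Notation lam := (lebesgue_tuple R d).
Hypotheses (p_cont : continuous p) (p_bnd : bounded_fun p)
  (p_ge0 : forall z, 0 <= p z)
  (p_L1 : lam.-integrable setT (EFin \o (fun t => p (row_of t)))).

Let s (k : nat) : R := k.+1%:R.

Let s_gt0 k : 0 < s k. Proof. by rewrite ltr0n. Qed.

Let s_oo : s k @[k --> \oo] --> +oo.
Proof. by rewrite (cvg_shiftS (fun n => n%:R : R)); exact: cvgr_idn. Qed.

Lemma rounded_point_cvg (t : D) :
  (s k)^-1 *: Zd_to_Rd R (cell_index (s k) t) @[k --> \oo] --> row_of t.
Proof.
apply/cvg_ballP => e e0.
have H : \forall k \near \oo, forall j : 'I_d,
    ball (tnth t j) e ((s k)^-1 * (coordZ (cell_index (s k) t) j)%:~R).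
  apply: filter_forall => j.
  have /cvg_ballP /(_ e e0) := @cell_index_cvg R s s_gt0 s_oo (tnth t j).
  by apply: filterS => k; rewrite cell_indexE mulrC.
apply: filterS H => k Hk; split => // i j.
by rewrite /row_of /Zd_to_Rd !mxE; exact: Hk.
Qed.

Lemma cell_real_box (l : R) (v : Zd d) : 0 < l ->
  [set t : D | cell_index l t = v] =
  real_box (fun j => (coordZ v j)%:~R / l) (fun j => (coordZ v j + 1)%:~R / l).
Proof.
by move=> l0; rewrite cellE.
Qed.

Let grid (K k : nat) : seq (Zd d) :=
  box (\row_j (- (K * k.+1)%:Z) : 'rV[int]_d) (K * k.+1 + K * k.+1).

Let B (K : nat) : set D := real_box (fun=> - K%:R) (fun=> K%:R).

Let gridE (K k : nat) (t : D) : (cell_index (s k) t \in grid K k) = (t \in B K).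
Proof.
pose m := (K * k.+1)%:Z.
have mE : m%:~R = s k * K%:R :> R by rewrite /m -pmulrn natrM mulrC.
have fl x : (Num.floor (s k * x))%:~R <= s k * x by exact: floor_le_tmp.
have fS x : s k * x < (Num.floor (s k * x) + 1)%:~R by exact: floorD1_gt.
apply/idP/idP => [/mem_box H|]; rewrite inE; [move=> j|move=> H].
  have := H j; rewrite coordZ_row cell_indexE PoszD -/m => /andP[h1 h2].
  rewrite -(ler_pM2l (s_gt0 k)) -(ltr_pM2l (s_gt0 k)) mulrN -mE -mulrNz.
  rewrite (le_trans _ (fl _)) ?ler_int//=.
  rewrite (lt_le_trans (fS _))// ler_int; move: h1 h2; clear; clearbody m.
  by move: (Num.floor _) => F; lia.
apply/mem_box => j; have /andP[h1 h2] := H j.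
rewrite coordZ_row cell_indexE PoszD -/m.
rewrite -(ler_pM2l (s_gt0 k)) mulrN -mE -mulrNz in h1.
rewrite -(ltr_pM2l (s_gt0 k)) -mE in h2.
have h3 := le_lt_trans h1 (fS _); have h4 := le_lt_trans (fl _) h2.
rewrite !ltr_int in h3 h4; move: h3 h4; clear; clearbody m.
by move: (Num.floor _) => F; lia.
Qed.

(** A bounded continuous integrable density can be approximated in mean by a
    finite combination of indicators of lattice cells. *)
Lemma step_approximation (eps : R) : 0 < eps ->
  exists (l : R) (vs : seq (Zd d)) (c : Zd d -> R), 0 < l /\
    \int[lam]_t `|p (row_of t)
      - \sum_(v <- vs) c v * \1_[set t | cell_index l t = v] t| <= eps.
Proof.
move=> eps0; have eps2 : 0 < eps / 2 by rewrite divr_gt0.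
have [Cp Cp0 pC] : exists2 C : R, 0 <= C & forall z, `|p z| <= C.
  have [C [_ pC]] := p_bnd; exists (`|C| + 1) => [|z]; first by rewrite addr_ge0.
  by apply: (pC (`|C| + 1)) => //; rewrite (le_lt_trans (ler_norm C))// ltrDl.
have iB K : lam.-integrable setT (EFin \o (\1_(B K) : D -> R)).
  by apply: L1_real_box => j; rewrite ge0_cp.
have mB K : measurable_fun setT (\1_(B K) : D -> R).
  by apply: measurable_indic; exact: measurable_real_box.
have mp := L1_measurable p_L1.
have B1 K t : `|\1_(B K) t| <= 1 :> R.
  by rewrite ger0_norm// indicE; case: (_ \in _).
have ipB K := L1_mul_bounded p_L1 (mB K) (B1 K).
(* Truncation to a large box. *)
have trunc : \int[lam]_t `|p (row_of t) - p (row_of t) * \1_(B K) t|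
    @[K --> \oo] --> (0 : R).
  rewrite -[X in _ --> X](mul0r (fine (lam setT))) -Rintegral_cst//.
  apply: (Rint_dominated_cvg _ _ p_L1) => //.
  - move=> K; apply: measurableT_comp => //; apply: measurable_funB => //.
    exact: measurable_funM.
  - apply: aeW => t K; rewrite normr_id indicE; case: (_ \in _).
      by rewrite mulr1 subrr normr0.
    by rewrite mulr0 subr0 ger0_norm.
  - apply: aeW => t; apply: cvg_near_cst.
    have H : \forall K \near \oo, forall j, `|tnth t j| < K%:R.
      by apply: filter_forall => j; exact: nbhs_infty_gtr.
    apply: filterS H => K H; rewrite indicE mem_set ?mulr1 ?subrr ?normr0//.
    by move=> j; have := H j; rewrite ltr_norml => /andP[/ltW -> ->].
have [K _ /(_ K (leqnn K)) HK] := cvgr0_norm_le _ trunc _ eps2.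
pose q k (t : D) := \1_(B K) t * p ((s k)^-1 *: Zd_to_Rd R (cell_index (s k) t)).
have mq k : measurable_fun setT (q k).
  apply: measurable_funM => //.
  exact: (measurable_lattice (fun u => p ((s k)^-1 *: Zd_to_Rd R u))).
have iq k : lam.-integrable setT (EFin \o q k).
  apply: (L1_mul_bounded (iB K)); last by move=> t; exact: pC.
  exact: (measurable_lattice (fun u => p ((s k)^-1 *: Zd_to_Rd R u))).
(* Rounding to the cells inside the box. *)
have round : \int[lam]_t `|p (row_of t) * \1_(B K) t - q k t|
    @[k --> \oo] --> (0 : R).
  rewrite -[X in _ --> X](mul0r (fine (lam setT))) -Rintegral_cst//.
  apply: (Rint_dominated_cvg _ _ (L1Z (Cp + Cp) (iB K))) => //.
  - move=> k; apply: measurableT_comp => //; apply: measurable_funB => //.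
    exact: measurable_funM.
  - apply: aeW => t k; rewrite normr_id /q [\1__ _ * p _]mulrC -mulrBl normrM.
    rewrite (@ger0_norm _ (\1__ _))// ler_wpM2r//.
    by rewrite (le_trans (ler_normB _ _))// lerD.
  - apply: aeW => t; rewrite -[X in _ --> X](normr0 R); apply: cvg_norm.
    rewrite -(subrr (p (row_of t) * \1_(B K) t)); apply: cvgB; first exact: cvg_cst.
    rewrite /q mulrC; apply: cvgM; first exact: cvg_cst.
    apply: (@cvg_comp _ _ _ _ p _ (nbhs (row_of t))); last exact: p_cont.
    exact: rounded_point_cvg.
have [k _ /(_ k (leqnn k)) Hk] := cvgr0_norm_le _ round _ eps2.
pose c v := if v \in grid K k then p ((s k)^-1 *: Zd_to_Rd R v) else 0.
exists (s k), (grid K k), c; split => //.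
rewrite (_ : (fun t => _) = (fun t => `|p (row_of t) - q k t|)); last first.
  apply/funext => t; congr (`|_ - _|).
  have gs u : u \notin grid K k -> c u = 0 by rewrite /c => /negbTE ->.
  have /(congr1 (fun F => F t)) /= <- := cell_index_sum (s k) (box_uniq _ _) gs.
  rewrite /c gridE /q indicE; case: (_ \in _); first by rewrite mul1r.
  by rewrite mul0r.
rewrite (splitr eps).
apply: (@le_trans _ _ (\int[lam]_t `|p (row_of t) - p (row_of t) * \1_(B K) t|
  + \int[lam]_t `|p (row_of t) * \1_(B K) t - q k t|)); last first.
  by apply: lerD; [apply: le_trans HK|apply: le_trans Hk]; exact: ler_norm.
rewrite -RintegralD//; [|by apply: L1_norm; exact: L1B|by apply: L1_norm; exact: L1B].
apply: le_Rintegral => //; first by apply: L1_norm; exact: L1B.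
  by apply: L1D; apply: L1_norm; exact: L1B.
by move=> t _; exact: ler_distD.
Qed.

(** Box averages determine the limit of the means with density [p]. *)
Lemma lattice_mean_cvg (L : nat -> R) (A : Zd d -> R) (C Abar : R) :
  (forall n, 0 < L n) -> L n @[n --> \oo] --> +oo ->
  (forall u, `|A u| <= C) -> box_averages_cvg A Abar ->
  \int[lam]_t p (row_of t) = 1 ->
  lattice_mean p (L n) A @[n --> \oo] --> Abar.
Proof.
move=> L0 Loo AC HA p1.
have C0 : 0 <= C by exact: le_trans (normr_ge0 _) (AC point).
apply/cvgrPdist_le => eps eps0.
have den0 : 0 < C + `|Abar| + 1 by rewrite ltr_wpDl// addr_ge0.
have [l [vs [c [l0 Hq]]]] :=
  step_approximation (divr_gt0 (divr_gt0 eps0 (ltr0Sn _ 1)) den0).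
set q := (fun t : D => \sum_(v <- vs) c v * \1_[set t | cell_index l t = v] t) in Hq.
have ic v : lam.-integrable setT
    (EFin \o (\1_[set t : D | cell_index l t = v] : D -> R)).
  exact: L1_cell.
have iq : lam.-integrable setT (EFin \o q).
  by apply: L1_sum => v _; apply: L1Z.
have mc v : \int[lam]_t (\1_[set t | cell_index l t = v] t * A (cell_index (L n) t))
    @[n --> \oo] --> (\int[lam]_t \1_[set t | cell_index l t = v] t) * Abar.
  rewrite (cell_real_box v l0); apply: box_mean_cvg => // j.
  by rewrite ltr_pM2r ?invr_gt0// ltr_int ltrDl.
have qcvg : \int[lam]_t (q t * A (cell_index (L n) t)) @[n --> \oo] -->
    (\int[lam]_t q t) * Abar.
  rewrite (_ : (fun n => _) = fun n => \sum_(v <- vs) c v *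
      \int[lam]_t (\1_[set t | cell_index l t = v] t * A (cell_index (L n) t))).
    rewrite Rint_sum => [|v _]; last exact: L1Z.
    rewrite mulr_suml; apply: cvg_big => [|v _]; first exact: add_continuous.
    rewrite RintegralZl// -mulrA; apply: cvgM; first exact: cvg_cst.
    exact: mc.
  apply/funext => n.
  have ia v := L1_mul_lattice L0 AC n (ic v).
  transitivity (\int[lam]_t (\sum_(v <- vs) c v *
      (\1_[set t | cell_index l t = v] t * A (cell_index (L n) t)))).
    apply: eq_Rintegral => t _; rewrite mulr_suml.
    by apply: eq_bigr => v _; rewrite mulrA.
  rewrite Rint_sum => [|v _]; last by apply: L1Z; exact: ia.
  by apply: eq_bigr => v _; rewrite RintegralZl//; exact: ia.
have eps2 : 0 < eps / 2 by rewrite divr_gt0.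
have /cvgrPdist_le /(_ _ eps2) := qcvg; apply: filterS => n Hn.
set E := lattice_mean _ _ _; set Q := \int[lam]_t (q t * _) in Hn.
set I := \int[lam]_t q t in Hn.
set delta := _ / _ / _ in Hq.
have pq : `|1 - I| <= delta.
  rewrite -p1; apply: le_trans Hq; apply: le_norm_RintB => //.
  by apply: L1_norm; exact: L1B.
have EQ : `|Q - E| <= C * delta.
  apply: (@le_trans _ _ (C * \int[lam]_t `|p (row_of t) - q t|)); last first.
    by rewrite ler_wpM2l.
  have ipq := L1_norm (L1B p_L1 iq).
  rewrite -RintegralZl//; apply: le_norm_RintB.
  - exact: (L1_mul_lattice L0 AC n iq).
  - exact: (L1_mul_lattice L0 AC n p_L1).
  - exact: L1Z.
  - by move=> t; rewrite -mulrBl normrM distrC mulrC ler_wpM2r.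
have -> : Abar - E = (1 - I) * Abar + (I * Abar - Q) + (Q - E) by ring.
rewrite (le_trans (ler_normD _ _))// (le_trans (lerD (ler_normD _ _) (lexx _)))//.
have d0 : 0 <= delta by rewrite ltW// !divr_gt0.
have h1 : `|(1 - I) * Abar| <= `|Abar| * delta.
  by rewrite normrM mulrC ler_wpM2l.
have h2 : (C + `|Abar| + 1) * delta = eps / 2.
  by rewrite /delta mulrC divfK// gt_eqF.
lra.
Qed.

End step_approximation.

(** * Local global mixing *)

Section local_global.
Context (R : realType) (d : nat) (disp : measure_display)
  (M : measurableMetricType disp R) (nu : probability M R)
  (f : M -> M) (tau : M -> Zd d) (L : nat -> R) (p : 'rV[R]_d -> R).
Local Notation lam := (lebesgue_tuple R d).
Local Notation cnt := (@counting_Zd R d).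
Local Notation mu := (skew_measure d nu).
Local Notation "'tau_' n" := (birkhoff_sum f tau n) (at level 1).

(** Fubini on the fibres; as a null set of the counting measure is empty, the
    fibrewise integrability holds on every fibre. *)
Lemma skew_fubini (g : M * Zd d -> R) : mu.-integrable setT (EFin \o g) ->
  [/\ forall z, nu.-integrable setT (EFin \o (fun y => g (y, z))),
      cnt.-integrable setT (EFin \o (fun z => \int[nu]_y g (y, z))) &
      \int[mu]_x g x = \int[cnt]_z \int[nu]_y g (y, z)].
Proof.
move=> ig.
have mg := L1_measurable ig; have mEg : measurable_fun setT (EFin \o g).
  exact/measurable_EFinP.
have iz z : nu.-integrable setT (EFin \o (fun y => g (y, z))).
  have [Z [_ Z0 sub]] := @ae_integrable2 _ _ _ _ _ nu cnt _ ig.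
  apply: contrapT => nz.
  have zZ : [set u | u \in [:: z]] `<=` Z.
    move=> u /=; rewrite inE => /eqP ->; apply: sub => H; apply: nz; exact: H.
  have : (cnt [set u | u \in [:: z]] <= cnt Z)%E by apply: le_measure; rewrite ?inE.
  by rewrite counting_seq// Z0 lee_fin ler10.
have E z : (\int[nu]_y g (y, z))%:E = fubini_G nu (EFin \o g) z.
  by rewrite EFin_Rint.
have iG : cnt.-integrable setT (EFin \o (fun z => \int[nu]_y g (y, z))).
  apply/integrableP; split => //.
  apply: le_lt_trans ((integrable21ltyP nu cnt mEg).1 ig).
  apply: ge0_le_integral => // z _.
  change (`|(\int[nu]_y g (y, z))%:E| <= \int[nu]_y `|(EFin \o g) (y, z)|)%E.
  rewrite E.
  apply: le_abse_integral => //.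
  exact/measurable_EFinP/L1_measurable/iz.
split => //; apply: EFin_inj; rewrite !EFin_Rint//.
transitivity (\int[cnt]_z fubini_G nu (EFin \o g) z)%E.
  by rewrite integral21_prod_meas1.
by apply: eq_integral => z _; rewrite E.
Qed.

Lemma iter_skew_map (n : nat) (x : M * Zd d) :
  iter n (skew_map f tau) x = (iter n f x.1, x.2 + tau_ n x.1).
Proof.
elim: n => [|n IHn]; first by rewrite /birkhoff_sum big_ord0 addr0; case: x.
by rewrite iterS IHn /skew_map /= /birkhoff_sum big_ord_recr /= addrA.
Qed.

(** Heine-Cantor, for a function of the first component. *)
Lemma unif_continuous_fst (g : M -> R) : compact [set: M] -> continuous g ->
  unif_continuous (fun x : M * Zd d => g x.1).
Proof.
move=> Mc cg; apply/unif_continuousP => eps eps0.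
have eps2 : 0 < eps / 2 by rewrite divr_gt0.
have cov : \forall delta \near (0 : R)^'+, forall y, [set: M] y ->
    forall y', ball y delta y' -> ball (g y) eps (g y').
  have := Mc; rewrite compact_near_coveringP => /(_ R (0^'+)
    (fun delta y => forall y', ball y delta y' -> ball (g y) eps (g y'))).
  apply => y _.
  have /nbhs_ballP[r /= r0 Hr] : nbhs y [set y' | ball (g y) (eps / 2) (g y')].
    by apply: cg; exact: nbhsx_ballx.
  have r2 : 0 < r / 2 by rewrite divr_gt0.
  exists (ball y (r / 2), [set delta | delta < r / 2]).
    by split; [exact: nbhsx_ballx|exact: nbhs_right_lt].
  move=> [y1 delta] /= [yy1 dr] y' y1y'.
  have b1 : ball (g y) (eps / 2) (g y1).
    by apply: Hr; apply: le_ball yy1; rewrite ler_pdivrMr// ler_pMr// ler1n.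
  have b2 : ball (g y) (eps / 2) (g y').
    apply: Hr; rewrite (splitr r); apply: ball_triangle yy1 _.
    by apply: le_ball y1y'; exact: ltW.
  by rewrite (splitr eps); apply: ball_triangle (ball_sym b1) b2.
have [delta d0 Hd] : exists2 delta : R, 0 < delta &
    forall y y', ball y delta y' -> ball (g y) eps (g y').
  near (0 : R)^'+ => delta; exists delta => // y y'.
  have Hd : forall y, [set: M] y -> forall y', ball y delta y' ->
    ball (g y) eps (g y') by near: delta; exact: cov.
  exact: (Hd y I).
by exists delta => // -[[y z] [y' z']] [/= yy' _]; exact: Hd.
Unshelve. all: by end_near. Qed.

Hypotheses (M_borel : borel_space M) (M_compact : compact [set: M]).
Hypotheses (mf : measurable_fun setT f) (mtau : measurable_fun setT tau).
Hypotheses (L_gt0 : forall n, 0 < L n) (Loo : L n @[n --> \oo] --> +oo)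
  (llt : pointwise_llt nu f tau L p).
Hypotheses (p_cont : continuous p) (p_bnd : bounded_fun p)
  (p_ge0 : forall z, 0 <= p z) (p_int : integral_Rd p = 1%E).

Let p_L1 : lam.-integrable setT (EFin \o (fun t => p (row_of t))).
Proof. exact: (L1_density M_borel M_compact mf mtau L_gt0 llt p_ge0 p_int). Qed.

Let p_int1 : \int[lam]_t p (row_of t) = 1.
Proof. exact: Rint_density. Qed.

Section observable.
Variables (Phi : M * Zd d -> R) (Phibar C : R).
Hypotheses (PhiG : GO nu Phi Phibar) (C_ge0 : 0 <= C)
  (PhiC : forall x, `|Phi x| <= C).

Let cPhi : unif_continuous Phi. Proof. by case: PhiG. Qed.

Let mPhi := measurable_observable M_borel cPhi.

Lemma GO_box_averages : box_averages_cvg (slice_mean nu Phi) Phibar.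
Proof.
move=> a b ab; have [_ _ /(_ a b ab)] := PhiG.
rewrite (_ : (fun N => _) = fun N : nat =>
  (\prod_j (b j * N%:R - a j * N%:R))^-1 *
    lattice_box_sum a b N (slice_mean nu Phi))//.
apply/funext => N; congr (_ * _).
have us : uniq (lattice_box_cover a b N) by exact: box_uniq.
have H := Rint_fibres nu mPhi PhiC us (@lattice_box_sub_cover _ _ a b N).
exact: H.
Qed.

Let slice_bnd u : `|slice_mean nu Phi u| <= C.
Proof.
by apply: Rint_prob_le => //; exact: (measurable_slice u M_borel cPhi).
Qed.

Lemma fibre_mixing_continuous (g : M -> R) (z : Zd d) : continuous g ->
  \int[nu]_y (g y * Phi (iter n f y, z + tau_ n y)) @[n --> \oo] -->
    (\int[nu]_y g y) * Phibar.
Proof.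
move=> cg; have [Cg Cg0 gC] := continuous_bounded M_compact cg.
have lim : lattice_mean p (L n) (slice_mean nu Phi) @[n --> \oo] --> Phibar.
  exact: (lattice_mean_cvg p_cont p_bnd p_ge0 p_L1 L_gt0 Loo slice_bnd
                           GO_box_averages p_int1).
have [delta delta0 Hdelta] := lattice_mean_shift M_borel M_compact
    mf mtau L_gt0 llt p_ge0 p_int z.
have lim' : lattice_mean p (L n) (fun u => slice_mean nu Phi (z + u))
    @[n --> \oo] --> Phibar.
  rewrite (_ : (fun n => _) = fun n =>
    (lattice_mean p (L n) (fun u => slice_mean nu Phi (u + z)) -
     lattice_mean p (L n) (slice_mean nu Phi)) +
     lattice_mean p (L n) (slice_mean nu Phi)); last first.
    apply/funext => n; rewrite subrK; congr lattice_mean.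
    by apply/funext => u; rewrite addrC.
  rewrite -[X in _ --> X]add0r; apply: cvgD => //.
  apply: (cvg0_le _ (v := fun n => C * delta n)) => [n|]; first exact: Hdelta.
  by rewrite -[X in _ --> X](mulr0 C); exact: (cvgM (cvg_cst C) delta0).
have H := skew_decoupling M_borel M_compact mf mtau L_gt0 llt p_ge0 p_int
  (unif_continuous_fst M_compact cg) cPhi (fun x => gC x.1) PhiC.
rewrite (_ : (fun n => _) = fun n =>
  (\int[nu]_y (g y * Phi (iter n f y, z + tau_ n y)) -
   (\int[nu]_y g y) * lattice_mean p (L n) (fun u => slice_mean nu Phi (z + u))) +
   (\int[nu]_y g y) * lattice_mean p (L n) (fun u => slice_mean nu Phi (z + u)));
  last by apply/funext => n; rewrite subrK.
rewrite -[X in _ --> X]add0r; apply: cvgD.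
  apply/cvgr0Pnorm_le => eps eps0; apply: filterS (H _ eps0) => n; exact.
exact: (cvgM (cvg_cst _) lim').
Qed.

Let mPhin n z : measurable_fun setT (fun y => Phi (iter n f y, z + tau_ n y)).
Proof. exact: measurable_skew_slice. Qed.

(** Mixing for an integrable function [g] on the fibre [M * {z}], by density of
    the continuous functions. *)
Lemma fibre_mixing (g : M -> R) (z : Zd d) :
  nu.-integrable setT (EFin \o g) ->
  \int[nu]_y (g y * Phi (iter n f y, z + tau_ n y)) @[n --> \oo] -->
    (\int[nu]_y g y) * Phibar.
Proof.
move=> ig; apply/cvgrPdist_le => eps eps0.
have den0 : 0 < C + `|Phibar| + 1 by rewrite ltr_wpDl// addr_ge0.
pose eta := eps / 2 / (C + `|Phibar| + 1).
have eta0 : 0 < eta by rewrite !divr_gt0.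
have [_ /(_ _ eta0)[h ch gh]] := continuous_dense_in_mean M_borel M_compact ig.
have [Ch _ hC] := continuous_bounded M_compact ch.
have ih : nu.-integrable setT (EFin \o h).
  exact: (prob_L1_bounded _ (continuous_measurable M_borel ch) hC).
have igh := L1_norm (L1B ig ih).
have eps2 : 0 < eps / 2 by rewrite divr_gt0.
have /cvgrPdist_le /(_ _ eps2) := fibre_mixing_continuous z ch.
apply: filterS => n Hn.
have D1 : `|\int[nu]_y h y * Phibar - \int[nu]_y g y * Phibar| <= `|Phibar| * eta.
  rewrite -mulrBl normrM mulrC ler_wpM2l// distrC (le_trans _ gh)//.
  exact: le_norm_RintB.
have D2 : `|\int[nu]_y (g y * Phi (iter n f y, z + tau_ n y)) -
    \int[nu]_y (h y * Phi (iter n f y, z + tau_ n y))| <= C * eta.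
  apply: (@le_trans _ _ (C * \int[nu]_y `|g y - h y|)); last by rewrite ler_wpM2l.
  rewrite -RintegralZl//; apply: le_norm_RintB.
  - by apply: (L1_mul_bounded ig (mPhin n z)) => y; exact: PhiC.
  - by apply: (L1_mul_bounded ih (mPhin n z)) => y; exact: PhiC.
  - exact: L1Z.
  - by move=> y; rewrite -mulrBl normrM mulrC ler_wpM2r.
have E : (C + `|Phibar| + 1) * eta = eps / 2.
  by rewrite /eta mulrC divfK// gt_eqF.
set a := \int[nu]_y g y * Phibar in D1 *.
set b := \int[nu]_y h y * Phibar in D1 Hn.
set a' := \int[nu]_y (g y * _) in D2 *.
set b' := \int[nu]_y (h y * _) in D2 Hn.
have -> : a - a' = - (b - a) + (b - b') - (a' - b') by ring.
rewrite (le_trans (ler_normB _ _))// (le_trans (lerD (ler_normD _ _) (lexx _)))//.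
rewrite normrN; lra.
Qed.

(** The fibres are put together by dominated convergence over [Zd d]. *)
Lemma local_global_cvg (phi : M * Zd d -> R) :
  mu.-integrable setT (EFin \o phi) ->
  \int[mu]_x (phi x * Phi (iter n (skew_map f tau) x)) @[n --> \oo] -->
    (\int[mu]_x phi x) * Phibar.
Proof.
move=> iphi.
have mT n : measurable_fun setT (fun x => Phi (iter n (skew_map f tau) x)).
  rewrite (_ : (fun x => _) = fun x => Phi (iter n f x.1, x.2 + tau_ n x.1)).
    by apply: measurable_from_slices => z; exact: mPhin.
  by apply/funext => x; rewrite iter_skew_map.
have iprod n : mu.-integrable setT
    (EFin \o (fun x => phi x * Phi (iter n (skew_map f tau) x))).
  by apply: (L1_mul_bounded iphi (mT n)) => x; exact: PhiC.
have [iz ic Ephi] := skew_fubini iphi.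
have [_ icn _] := skew_fubini (L1_norm iphi).
rewrite Ephi -RintegralZr//.
rewrite (_ : (fun n => _) = fun n => \int[cnt]_z
    \int[nu]_y (phi (y, z) * Phi (iter n f y, z + tau_ n y))); last first.
  apply/funext => n; have [_ _ ->] := skew_fubini (iprod n).
  apply: eq_Rintegral => z _; apply: eq_Rintegral => y _.
  by rewrite iter_skew_map.
apply: (Rint_dominated_cvg _ _ (L1Z C icn)) => //.
- apply: aeW => z n.
  rewrite -RintegralZl//; last exact: L1_norm (iz z).
  have := L1_mul_bounded (iz z) (mPhin n z) (fun y => PhiC _).
  move=> /L1_measurable mm; apply: le_norm_Rint => //.
    by apply: L1Z; exact: L1_norm (iz z).
  by move=> y; rewrite normrM mulrC ler_wpM2r.
- by apply: aeW => z; exact: fibre_mixing (iz z).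
Qed.

End observable.
End local_global.

(** * Averages over cubes containing the origin *)

Section cube_averages.
Context (R : realType) (d : nat).
Implicit Types (A : Zd d -> R) (c u z : Zd d) (b r w m : nat).

(** The average of [A] over the box with corner [c] and side [w]. *)
Definition box_mean A c w : R := (w%:R ^+ d)^-1 * \sum_(z <- box c w) A z.

(** The average of [A] over the cube of size [b] centered at [z]. *)
Definition block_mean A b z : R :=
  (b%:R ^+ d)^-1 * \sum_(u <- box (cube_corner 0 b) b) A (u + z).

Lemma cube_corner_shift z b : cube_corner z b = cube_corner 0 b + z.
Proof.
by apply/Zd_eqP => i; rewrite coordZD !coordZ_row [coordZ 0 i]mxE; lia.
Qed.

Lemma block_meanE A b z : block_mean A b z = box_mean A (cube_corner z b) b.
Proof. by rewrite /block_mean sum_box_shift -cube_corner_shift. Qed.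

Lemma sum_pred_count (s : seq (Zd d)) (P : pred (Zd d)) :
  \sum_(z <- s) (P z)%:R = (count P s)%:R :> R.
Proof.
rewrite -sum1_count natr_sum [RHS]big_mkcond; apply: eq_bigr => z _.
by case: (P z).
Qed.

Lemma sum_cst_box (x : R) c w : \sum_(z <- box c w) x = w%:R ^+ d * x.
Proof.
by rewrite big_const_seq count_predT iter_addr_0 size_box -natrX mulr_natl.
Qed.

Lemma box_mean_norm_le A C c w : (0 < w)%N -> (forall z, `|A z| <= C) ->
  `|box_mean A c w| <= C.
Proof.
move=> w0 AC; have wd : 0 < w%:R ^+ d :> R by rewrite exprn_gt0// ltr0n.
have wdV : 0 <= (w%:R ^+ d)^-1 :> R by rewrite invr_ge0 ltW.
rewrite normrM (ger0_norm wdV) mulrC ler_pdivrMr//.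
rewrite (le_trans (ler_norm_sum _ _ _))//.
rewrite (le_trans (ler_sum _ (fun z _ => AC z)))//.
by rewrite sum_cst_box mulrC.
Qed.

(** The box with corner [c] and side [w] contains the origin. *)
Definition through0 c w : Prop := forall i, coordZ c i <= 0 < coordZ c i + w%:Z.

(** All coordinates of [u] are at most [r] in absolute value. *)
Definition bounded_by r u : Prop := forall i, `|coordZ u i| <= r%:Z.

(** The corner of the box of side [2 m] whose points have coordinates in
    [(- m, m]]. *)
Definition centered_corner m : Zd d := (\row_i (1 - m%:Z) : 'rV[int]_d).

(** The centers whose block average is not within [eps] of [Abar]. *)
Definition bad_center A b Abar eps : pred (Zd d) :=
  fun z => ~~ (`|block_mean A b z - Abar| <= eps).

(** The combinatorial content of membership in [GAO]: for a suitable block size,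
    the centers with a bad block average have small density in all large centered
    boxes. Only even sides are needed, for which the box is symmetric. *)
Definition almost_averages A Abar : Prop := forall eps, 0 < eps ->
  exists b m0, (0 < b)%N /\ forall m, (m0 < m)%N ->
    (count (bad_center A b Abar eps) (box (centered_corner m) (m + m)))%:R
      <= eps * (m + m)%:R ^+ d :> R.

Lemma count_sub_uniq (T : eqType) (s1 s2 : seq T) (P : pred T) :
  uniq s1 -> {subset s1 <= s2} -> (count P s1 <= count P s2)%N.
Proof.
move=> us1 s12; rewrite -!size_filter; apply: uniq_leq_size.
  exact: filter_uniq.
by move=> x; rewrite !mem_filter => /andP[-> /s12].
Qed.

Lemma through0_sub_centered c u w r : through0 c w -> bounded_by r u ->
  {subset box (c + u) w <= box (centered_corner (w + r)) ((w + r) + (w + r))}.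
Proof.
move=> c0 ur z /mem_box H; apply/mem_box => i.
have := H i; have := c0 i; have := ur i; rewrite coordZD coordZ_row.
by move: (coordZ c i) (coordZ u i) (coordZ z i) => x y t; lia.
Qed.

(** Most blocks centered in a translate of a cube through the origin have an
    average close to [Abar]: a box of side [w] through the origin, shifted by at
    most [w], lies in the centered box of side [4 w], whence the factor
    [4 ^+ d]. *)
Lemma shifted_block_dev A C b m0 Abar eps c u w r : 0 <= eps ->
  (0 < b)%N -> (forall z, `|A z| <= C) ->
  (forall m, (m0 < m)%N ->
    (count (bad_center A b Abar eps) (box (centered_corner m) (m + m)))%:R
      <= eps * (m + m)%:R ^+ d :> R) ->
  through0 c w -> bounded_by r u -> (m0 < w)%N -> (r <= w)%N ->
  \sum_(z <- box c w) `|block_mean A b (z + u) - Abar| <=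
    w%:R ^+ d * (eps * (1 + (C + `|Abar|) * 4 ^+ d)).
Proof.
move=> eps0 b0 AC Hbad c0 ur mw rw.
have C0 : 0 <= C by exact: le_trans (normr_ge0 _) (AC 0).
have K0 : 0 <= C + `|Abar| by rewrite addr_ge0.
rewrite (sum_box_shift c w u (fun z => `|block_mean A b z - Abar|)).
apply: (@le_trans _ _ (\sum_(z <- box (c + u) w)
    (eps + (C + `|Abar|) * (bad_center A b Abar eps z)%:R))).
  apply: ler_sum => z _; have [bad|] := boolP (bad_center A b Abar eps z).
    rewrite mulr1 (le_trans (ler_normB _ _))// -[leLHS]add0r lerD// lerD2r.
    by rewrite block_meanE; exact: box_mean_norm_le.
  by rewrite negbK mulr0 addr0.
rewrite big_split /= sum_cst_box -mulr_sumr sum_pred_count.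
rewrite mulrA mulrDr mulr1 [w%:R ^+ d * eps]mulrC lerD//.
apply: (@le_trans _ _ ((C + `|Abar|) * (eps * ((w + r) + (w + r))%:R ^+ d))).
  rewrite ler_wpM2l// (le_trans _ (Hbad (w + r)%N _))//; last first.
    exact: leq_trans mw (leq_addr _ _).
  rewrite ler_nat; apply: count_sub_uniq; first exact: box_uniq.
  exact: through0_sub_centered.
have le4 : ((w + r) + (w + r))%:R ^+ d <= 4 ^+ d * w%:R ^+ d :> R.
  rewrite -exprMn lerXn2r ?nnegrE ?mulr_ge0//.
  by rewrite -natrM ler_nat; lia.
rewrite [leRHS](_ : _ = (C + `|Abar|) * (eps * (4 ^+ d * w%:R ^+ d))); last by ring.
by rewrite !ler_wpM2l.
Qed.

(** Folner: a large box and its translate by [u] nearly coincide. *)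
Lemma count_box_shiftC c u w r : bounded_by r u -> (r <= w)%N ->
  (count [predC box (c + u)%R w] (box c w) <= w ^ d - (w - r) ^ d)%N.
Proof.
move=> ur rw.
have := count_predC (mem (box (c + u) w)) (box c w); rewrite size_box => <-.
rewrite -[leqLHS](addKn (count (mem (box (c + u) w)) (box c w))) leq_sub2l//.
(* The corner of the intersection of the two boxes. *)
pose c' : Zd d :=
  (\row_i (Num.max (coordZ c i) (coordZ c i + coordZ u i)) : 'rV[int]_d).
rewrite -(size_box c') -size_filter; apply: uniq_leq_size; first exact: box_uniq.
move=> z /mem_box H; rewrite mem_filter; apply/andP; split.
  apply/mem_box => i; have := H i; have := ur i.
  rewrite coordZD coordZ_row.
  by move: (coordZ c i) (coordZ u i) (coordZ z i) => x y t; lia.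
apply/mem_box => i; have := H i; have := ur i.
rewrite coordZ_row.
by move: (coordZ c i) (coordZ u i) (coordZ z i) => x y t; lia.
Qed.

Lemma sum_box_shift_dev A C c u w r : (forall z, `|A z| <= C) ->
  bounded_by r u -> (r <= w)%N ->
  `|\sum_(z <- box c w) A z - \sum_(z <- box (c + u) w) A z| <=
    (C + C) * (w ^ d - (w - r) ^ d)%:R.
Proof.
move=> AC ur rw.
have C0 : 0 <= C by exact: le_trans (normr_ge0 _) (AC 0).
have bnd (P : pred (Zd d)) (s : seq (Zd d)) (N : nat) : (count P s <= N)%N ->
    `|\sum_(z <- s | P z) A z| <= C * N%:R.
  move=> PN; rewrite (le_trans (ler_norm_sum _ _ _))//.
  apply: (@le_trans _ _ (\sum_(z <- s | P z) C)).
    by apply: ler_sum => z _; exact: AC.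
  rewrite big_const_seq iter_addr_0 -[C *+ _]mulr_natr ler_wpM2l// ler_nat.
  exact: PN.
rewrite (bigID (mem (box (c + u) w))) /= [X in _ - X](bigID (mem (box c w))) /=.
have -> : \sum_(z <- box (c + u) w | z \in box c w) A z =
          \sum_(z <- box c w | z \in box (c + u) w) A z.
  rewrite -[LHS]big_filter -[RHS]big_filter; apply: perm_big; apply: uniq_perm.
  - by rewrite filter_uniq// box_uniq.
  - by rewrite filter_uniq// box_uniq.
  - by move=> z; rewrite !mem_filter andbC.
rewrite opprD addrACA subrr add0r (le_trans (ler_normB _ _))// mulrDl lerD//.
  by apply: bnd; exact: count_box_shiftC.
apply: bnd; have := @count_box_shiftC (c + u) (- u) w r; rewrite addrK; apply => //.
by move=> i; rewrite coordZN normrN.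
Qed.

Lemma boundary_cvg0 r :
  (w ^ d - (w - r) ^ d)%:R / w%:R ^+ d @[w --> \oo] --> (0 : R).
Proof.
have winv : (w%:R)^-1 @[w --> \oo] --> (0 : R).
  apply/gtr0_cvgV0; last exact: cvgr_idn.
  by exists 1%N => // w /= w0; rewrite ltr0n.
have H : 1 - (1 - r%:R * (w%:R)^-1) ^+ d @[w --> \oo] -->
    (1 - (1 - r%:R * 0) ^+ d : R).
  apply: cvgB; first exact: cvg_cst.
  apply: (@cvg_comp _ _ _ (fun w : nat => 1 - r%:R * (w%:R)^-1 : R) (fun x => x ^+ d)
    _ (nbhs (1 - r%:R * 0 : R))); last exact: exprn_continuous.
  apply: cvgB; first exact: cvg_cst.
  exact: (cvgM (cvg_cst _) winv).
rewrite mulr0 subr0 expr1n subrr in H; apply: cvg_trans H; apply: near_eq_cvg.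
exists (r + 1)%N => // w /= rw.
have w0 : (0 < w)%N by lia.
have w0' : w%:R != 0 :> R by rewrite pnatr_eq0 -lt0n.
rewrite natrB; last first.
  by case: (d) => [|d']; rewrite ?expn0// leq_exp2r// leq_subr.
rewrite !natrX natrB; last by lia.
rewrite mulrBl divff ?expf_neq0// -exprVn -exprMn mulrBl divff//.
Qed.

(** Averages over large boxes through the origin: replacing [A] by its block
    averages costs a boundary term, and most block averages are close to
    [Abar]. *)
Lemma box_mean_through0 A C Abar eps : (forall z, `|A z| <= C) ->
  almost_averages A Abar -> 0 < eps ->
  exists W : nat, forall w c, (W <= w)%N -> (0 < w)%N -> through0 c w ->
    `|box_mean A c w - Abar| <= eps.
Proof.
move=> AC HA eps0.
have C0 : 0 <= C by exact: le_trans (normr_ge0 _) (AC 0).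
pose kappa := 1 + (C + `|Abar|) * 4 ^+ d.
have kappa0 : 0 < kappa by rewrite ltr_pwDl// mulr_ge0// addr_ge0.
have eta0 : 0 < eps / 2 / kappa by rewrite !divr_gt0.
have [b [m0 [b0 Hbad]]] := HA _ eta0.
have den0 : 0 < C + C + 1 by rewrite ltr_wpDl// addr_ge0.
have bd0 : 0 < eps / 2 / (C + C + 1) by rewrite !divr_gt0.
have [W1 _ HW1] := cvgr0_norm_le _ (boundary_cvg0 b) _ bd0.
exists (W1 + m0 + b + 1)%N => w c Ww w0 c0.
have wd0 : 0 < w%:R ^+ d :> R by rewrite exprn_gt0// ltr0n.
have bd : 0 < b%:R ^+ d :> R by rewrite exprn_gt0// ltr0n.
have mw : (m0 < w)%N by lia.
have bw : (b <= w)%N by lia.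
have h1 : `|\sum_(z <- box c w) A z - \sum_(z <- box c w) block_mean A b z| <=
    (C + C) * (w ^ d - (w - b) ^ d)%:R.
  have -> : \sum_(z <- box c w) block_mean A b z = (b%:R ^+ d)^-1 *
      \sum_(u <- box (cube_corner 0 b) b) \sum_(z <- box (c + u) w) A z.
    rewrite -mulr_sumr exchange_big /=; congr (_ * _); apply: eq_bigr => u _.
    by rewrite -sum_box_shift; apply: eq_bigr => z _; rewrite addrC.
  have -> : \sum_(z <- box c w) A z = (b%:R ^+ d)^-1 *
      \sum_(u <- box (cube_corner (0 : Zd d) b) b) \sum_(z <- box c w) A z.
    by rewrite sum_cst_box mulrA mulVf ?mul1r// gt_eqF.
  have bdV : 0 <= (b%:R ^+ d)^-1 :> R by rewrite invr_ge0 ltW.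
  rewrite -mulrBr -sumrB normrM (ger0_norm bdV).
  rewrite mulrC ler_pdivrMr// mulrC -(sum_cst_box _ (cube_corner (0 : Zd d) b)).
  rewrite (le_trans (ler_norm_sum _ _ _))// big_seq [leRHS]big_seq.
  apply: ler_sum => u /mem_box ub; apply: sum_box_shift_dev => // i.
  have := ub i; rewrite coordZ_row [coordZ 0 i]mxE.
  by move: (coordZ u i) => x; lia.
have h2 : `|\sum_(z <- box c w) block_mean A b z - w%:R ^+ d * Abar| <=
    w%:R ^+ d * (eps / 2).
  rewrite -(sum_cst_box _ c) -sumrB (le_trans (ler_norm_sum _ _ _))//.
  have := @shifted_block_dev A C b m0 Abar _ c 0 w 0 (ltW eta0) b0 AC Hbad c0.
  rewrite -/kappa divfK ?gt_eqF//; under eq_bigr do rewrite addr0.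
  by apply=> // i; rewrite [coordZ 0 i]mxE normr0.
have h3 : (w ^ d - (w - b) ^ d)%:R <= eps / 2 / (C + C + 1) * w%:R ^+ d :> R.
  rewrite -ler_pdivrMr// (le_trans (ler_norm _))//.
  by apply: HW1 => /=; lia.
have h4 : (C + C) * (w ^ d - (w - b) ^ d)%:R <= w%:R ^+ d * (eps / 2).
  rewrite (le_trans (ler_wpM2l _ h3)) ?addr_ge0//.
  rewrite [leLHS](_ : _ = w%:R ^+ d * (eps / 2) * ((C + C) / (C + C + 1)));
    last by ring.
  rewrite ler_piMr//; first by rewrite ltW// mulr_gt0// divr_gt0.
  by rewrite ler_pdivrMr// mul1r lerDl.
rewrite /box_mean -(ler_pM2l wd0) -{1}(ger0_norm (ltW wd0)) -normrM mulrBr mulrA.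
rewrite divff ?gt_eqF// mul1r.
rewrite (le_trans (ler_distD (\sum_(z <- box c w) block_mean A b z) _ _))//.
rewrite (le_trans (lerD (le_trans h1 h4) h2))// -mulrDr.
by rewrite -splitr.
Qed.

Context (disp : measure_display) (M : measurableMetricType disp R)
  (nu : probability M R).

Lemma GAO_almost_averages (Phi : M * Zd d -> R) (Phibar C : R) :
  measurable_fun setT Phi -> (forall x, `|Phi x| <= C) ->
  GAO nu Phi Phibar -> almost_averages (slice_mean nu Phi) Phibar.
Proof.
move=> mPhi PhiC [_ _ H] eps eps0; have [b [B0 [b0 _ HB]]] := H _ eps0.
exists b, B0; split => // m Bm.
have := HB (m + m)%N (leq_trans Bm (leq_addr _ _)).
set s := box (centered_corner m) (m + m).
set bad := bad_center _ _ _ _.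
have zmE z : (forall i, - ((m + m)%:R / 2) < ((coordZ z i)%:~R : R) <= (m + m)%:R / 2)
    <-> z \in s.
  have -> : (m + m)%:R / 2 = m%:Z%:~R :> R by rewrite natrD -pmulrn; field.
  split=> [zm|/mem_box zm i].
    apply/mem_box => i; have := zm i; rewrite coordZ_row -mulrNz ltr_int ler_int.
    by move: (coordZ z i) => x; lia.
  have := zm i; rewrite coordZ_row -mulrNz ltr_int ler_int.
  by move: (coordZ z i) => x; lia.
have -> : good_centers nu Phi Phibar eps b (m + m) =
    [set z | z \in [seq x <- s | predC bad x]].
  apply/seteqP; split=> z /=; rewrite mem_filter /= negbK block_meanE /box_mean
    -(average_cube nu z b mPhi PhiC).
    by move=> [/zmE -> ->].
  by move=> /andP[zb /zmE zs].
rewrite counting_seq ?filter_uniq ?box_uniq// size_filter lte_fin => Hgood.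
have := count_predC bad s; rewrite size_box => /(congr1 (fun k => k%:R : R)).
rewrite natrD natrX => E.
by lra.
Qed.

End cube_averages.

(** * Global global mixing *)

Section lattice_mean_tail.
Context (R : realType) (d : nat) (p : 'rV[R]_d -> R).
Local Notation lam := (lebesgue_tuple R d).
Hypotheses (p_ge0 : forall z, 0 <= p z)
  (p_L1 : lam.-integrable setT (EFin \o (fun t => p (row_of t))))
  (p_int1 : \int[lam]_t p (row_of t) = 1).

(** The lattice points with some coordinate larger than [r]. *)
Definition far (r : nat) : set (Zd d) := [set u | ~ bounded_by r u].

Lemma far_le1 r u : `|\1_(far r) u| <= 1 :> R.
Proof. by rewrite ger0_norm// indicE; case: (_ \in _). Qed.

Lemma lattice_mean_tail (s eps : R) : 0 < s -> 0 < eps ->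
  exists r, lattice_mean p s \1_(far r) <= eps.
Proof.
move=> s0 eps0.
have : lattice_mean p s \1_(far r) @[r --> \oo] --> (0 : R).
  rewrite -[X in _ --> X](mul0r (fine (lam setT))) -Rintegral_cst//.
  apply: (Rint_dominated_cvg _ _ p_L1) => //.
  - by move=> r; exact: L1_measurable (L1_lattice p_L1 s0 (far_le1 r)).
  - apply: aeW => t r; rewrite normrM (ger0_norm (p_ge0 _)).
    by rewrite -[leRHS]mulr1 ler_wpM2l// far_le1.
  - apply: aeW => t; apply: cvg_near_cst.
    exists (\sum_j `|coordZ (cell_index s t) j|)%N => // r /= rt.
    rewrite indicE memNset ?mulr0//= => nb; apply: nb => j.
    have : (`|coordZ (cell_index s t) j| <= \sum_i `|coordZ (cell_index s t) i|)%N.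
      by rewrite (bigD1 j)//= leq_addr.
    by move=> /leq_trans/(_ rt); move: (coordZ _ _) => x; lia.
move=> H; have [r _ /(_ r (leqnn r)) Hr] := cvgr0_norm_le _ H _ eps0.
by exists r; apply: le_trans Hr; exact: ler_norm.
Qed.

(** For a fixed [s], and over large cubes through the origin, the mean of the
    block averages is close to [Abar] on average. *)
Lemma lattice_mean_block_dev (A : Zd d -> R) (C Abar eps : R) :
  (forall z, `|A z| <= C) -> almost_averages A Abar -> 0 < eps ->
  exists2 b : nat, (0 < b)%N & forall s, 0 < s ->
    exists W : nat, forall w c, (W <= w)%N -> (0 < w)%N -> through0 c w ->
      \sum_(z <- box c w)
        `|lattice_mean p s (fun u => block_mean A b (z + u)) - Abar|
      <= w%:R ^+ d * eps.
Proof.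
move=> AC HA eps0.
have C0 : 0 <= C by exact: le_trans (normr_ge0 _) (AC 0).
have K0 : 0 <= C + `|Abar| by rewrite addr_ge0.
pose kappa := 1 + (C + `|Abar|) * 4 ^+ d.
have kappa0 : 0 < kappa by rewrite ltr_pwDl// mulr_ge0.
have eta0 : 0 < eps / 2 / kappa by rewrite !divr_gt0.
have [b [m0 [b0 Hbad]]] := HA _ eta0; exists b => // s s0.
have den0 : 0 < C + `|Abar| + 1 by rewrite ltr_wpDl.
have tl0 : 0 < eps / 2 / (C + `|Abar| + 1) by rewrite !divr_gt0.
have [r Hr] := lattice_mean_tail s0 tl0.
exists (m0 + r + 1)%N => w c Ww w0 c0.
have wd0 : 0 < w%:R ^+ d :> R by rewrite exprn_gt0// ltr0n.
have blkC z : `|block_mean A b z| <= C.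
  by rewrite block_meanE; exact: box_mean_norm_le.
have devC z : `|block_mean A b z - Abar| <= C + `|Abar|.
  by rewrite (le_trans (ler_normB _ _))// lerD2r.
have step1 z : `|lattice_mean p s (fun u => block_mean A b (z + u)) - Abar| <=
    lattice_mean p s (fun u => `|block_mean A b (z + u) - Abar|).
  rewrite -{1}(lattice_mean_cst p_L1 p_int1 s Abar).
  rewrite -(lattice_meanB p_L1 (B1 := C) (B2 := `|Abar|))//.
  apply: le_norm_Rint.
  - exact: L1_measurable (L1_lattice p_L1 s0
      (h := fun u => block_mean A b (z + u) - Abar) (fun u => devC (z + u))).
  - apply: (L1_lattice p_L1 s0 (B := C + `|Abar|)
      (h := fun u => `|block_mean A b (z + u) - Abar|)) => u.
    by rewrite normr_id; exact: devC.
  - by move=> t; rewrite normrM (ger0_norm (p_ge0 _)).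
apply: (le_trans (ler_sum _ (fun z _ => step1 z))).
rewrite -(lattice_mean_sum p_L1 (B := C + `|Abar|))//; last first.
  by move=> z u; rewrite normr_id; exact: devC.
have bndr u : \sum_(z <- box c w) `|block_mean A b (z + u) - Abar| <=
    w%:R ^+ d * (eps / 2 + (C + `|Abar|) * \1_(far r) u).
  have [ur|ur] := pselect (bounded_by r u).
    rewrite [X in _ * (_ + _ * X)]indicE memNset; last by move=> nb; apply: nb.
    rewrite mulr0 addr0.
    have := shifted_block_dev (ltW eta0) b0 AC Hbad c0 ur.
    by rewrite -/kappa divfK ?gt_eqF//; apply; lia.
  rewrite indicE mem_set// mulr1.
  rewrite (le_trans (ler_sum _ (fun z _ => devC (z + u))))// sum_cst_box.
  by rewrite ler_wpM2l ?(ltW wd0)// lerDr ltW// divr_gt0.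
have B1 u : `|\sum_(z <- box c w) `|block_mean A b (z + u) - Abar| | <=
    w%:R ^+ d * (C + `|Abar|).
  rewrite ger0_norm ?sumr_ge0//.
  by rewrite (le_trans (ler_sum _ (fun z _ => devC (z + u))))// sum_cst_box.
have B3 u : `|eps / 2 + (C + `|Abar|) * \1_(far r) u| <= eps / 2 + (C + `|Abar|).
  rewrite ger0_norm; last by rewrite addr_ge0 ?mulr_ge0// ltW// divr_gt0.
  by rewrite lerD2l ler_piMr// -[leLHS]ger0_norm// far_le1.
have B2 u : `|w%:R ^+ d * (eps / 2 + (C + `|Abar|) * \1_(far r) u)| <=
    w%:R ^+ d * (eps / 2 + (C + `|Abar|)).
  by rewrite normrM (ger0_norm (ltW wd0)) ler_wpM2l ?(ltW wd0).
apply: (le_trans (lattice_mean_le p_ge0 p_L1 s0 B1 B2 bndr)).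
rewrite (lattice_meanZ p_L1 (B := eps / 2 + (C + `|Abar|)))// ler_wpM2l ?(ltW wd0)//.
have -> : lattice_mean p s (fun u => eps / 2 + (C + `|Abar|) * \1_(far r) u) =
    eps / 2 + (C + `|Abar|) * lattice_mean p s \1_(far r).
  rewrite -(lattice_meanZ p_L1 (B := 1))//; last exact: far_le1.
  rewrite -{2}(lattice_mean_cst p_L1 p_int1 s (eps / 2)).
  have i1 := L1_lattice p_L1 s0 (h := fun=> eps / 2) (fun=> lexx _).
  have i2 : lam.-integrable setT (EFin \o (fun t => p (row_of t) *
      ((C + `|Abar|) * \1_(far r) (cell_index s t)))).
    apply: (L1_lattice p_L1 s0 (B := C + `|Abar|)
      (h := fun u => (C + `|Abar|) * \1_(far r) u)) => u.
    by rewrite normrM (ger0_norm K0) ler_piMr// far_le1.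
  rewrite -RintegralD//; apply: eq_Rintegral => t _; exact: mulrDr.
rewrite [leRHS]splitr lerD2l (le_trans (ler_wpM2l K0 Hr))//.
rewrite mulrCA ler_piMr//; first by rewrite ltW// divr_gt0.
by rewrite ler_pdivrMr// mul1r lerDl.
Qed.

End lattice_mean_tail.

Section limits_along_filters.
Context (R : realType) (T0 : choiceType) (T : filteredType T0) (F : set_system T).
Hypothesis (F_proper : ProperFilter F).

Lemma limf_esup_near (g : T -> R) (l eps : R) :
  F [set x | `|g x - l| <= eps] ->
  ((l - eps)%:E <= limf_esup (fun x => (g x)%:E) F <= (l + eps)%:E)%E.
Proof.
move=> H; apply/andP; split.
  apply: le_ereal_inf_tmp => _ [V FV <-].
  have [x [Vx gx]] := filter_ex (filterI FV H).
  apply: (@le_trans _ _ (g x)%:E); last by apply: ereal_sup_ubound; exists x.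
  by rewrite lee_fin; move: gx; rewrite /= ler_distl => /andP[].
apply: (@le_trans _ _
  (ereal_sup ((fun x => (g x)%:E) @` [set x | `|g x - l| <= eps]))).
  by apply: ereal_inf_lbound; exists [set x | `|g x - l| <= eps].
apply: ge_ereal_sup => _ [x /= gx <-].
by rewrite lee_fin; move: gx; rewrite /= ler_distl => /andP[].
Qed.

Lemma limf_einf_near (g : T -> R) (l eps : R) :
  F [set x | `|g x - l| <= eps] ->
  ((l - eps)%:E <= limf_einf (fun x => (g x)%:E) F <= (l + eps)%:E)%E.
Proof.
move=> H; rewrite /limf_einf.
have /(limf_esup_near (g := fun x => - g x)) : F [set x | `|- g x - - l| <= eps].
  by apply: filterS H => x /=; rewrite -opprD normrN.
move=> /andP[h1 h2]; apply/andP; split.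
  by rewrite leeNr -EFinN opprB addrC; exact: h2.
by rewrite leeNl -EFinN opprD; exact: h1.
Qed.

End limits_along_filters.

Lemma cvg_ereal_near (R : realType) (u : nat -> \bar R) (l : R) :
  (forall eps, 0 < eps -> \forall n \near \oo,
    ((l - eps)%:E <= u n <= (l + eps)%:E)%E) ->
  u n @[n --> \oo] --> l%:E.
Proof.
move=> H; apply/fine_cvgP; split.
  have := H 1 ltr01; apply: filterS => n /andP[h1 h2].
  by rewrite fin_numElt (lt_le_trans (ltNyr _) h1) (le_lt_trans h2 (ltry _)).
apply/cvgrPdist_le => eps eps0; have := H _ eps0; apply: filterS => n /andP[h1 h2].
have uf : u n \is a fin_num.
  by rewrite fin_numElt (lt_le_trans (ltNyr _) h1) (le_lt_trans h2 (ltry _)).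
rewrite -(fineK uf) !lee_fin in h1 h2.
by rewrite distrC ler_distl h1 h2.
Qed.

Section global_global.
Context (R : realType) (d : nat) (disp : measure_display)
  (M : measurableMetricType disp R) (nu : probability M R)
  (f : M -> M) (tau : M -> Zd d) (L : nat -> R) (p : 'rV[R]_d -> R).
Local Notation lam := (lebesgue_tuple R d).
Local Notation mu := (skew_measure d nu).
Local Notation "'tau_' n" := (birkhoff_sum f tau n) (at level 1).
Hypotheses (M_borel : borel_space M) (M_compact : compact [set: M]).
Hypotheses (mf : measurable_fun setT f) (mtau : measurable_fun setT tau).
Hypotheses (L_gt0 : forall n, 0 < L n) (llt : pointwise_llt nu f tau L p).
Hypotheses (p_ge0 : forall z, 0 <= p z) (p_int : integral_Rd p = 1%E).

Let p_L1 : lam.-integrable setT (EFin \o (fun t => p (row_of t))).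
Proof. exact: (L1_density M_borel M_compact mf mtau L_gt0 llt p_ge0 p_int). Qed.

Let p_int1 : \int[lam]_t p (row_of t) = 1.
Proof. exact: Rint_density. Qed.

(** By asymptotic translation invariance, [A] may be replaced by its block
    averages, uniformly in the base point [z]. *)
Lemma lattice_mean_block (A : Zd d -> R) (C : R) (b : nat) :
  (forall z, `|A z| <= C) -> (0 < b)%N ->
  exists2 delta : nat -> R, delta n @[n --> \oo] --> (0 : R) &
    forall n z, `|lattice_mean p (L n) (fun u => block_mean A b (z + u))
                  - lattice_mean p (L n) (fun u => A (z + u))| <= delta n.
Proof.
move=> AC b0.
have bd : 0 < b%:R ^+ d :> R by rewrite exprn_gt0// ltr0n.
have bdV : 0 <= (b%:R ^+ d)^-1 :> R by rewrite invr_ge0 ltW.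
have /choice[delta deltaP] : forall v : Zd d, exists delta : nat -> R,
    delta n @[n --> \oo] --> (0 : R) /\
    forall n (B : R) (h : Zd d -> R), (forall u, `|h u| <= B) ->
    `|lattice_mean p (L n) (fun u => h (u + v)) - lattice_mean p (L n) h|
      <= B * delta n.
  move=> v; have [delta d0 dP] := lattice_mean_shift M_borel M_compact mf mtau
    L_gt0 llt p_ge0 p_int v.
  by exists delta.
exists (fun n => (b%:R ^+ d)^-1 *
    \sum_(v <- box (cube_corner (0 : Zd d) b) b) C * delta v n).
  rewrite [X in _ --> X](_ : 0 = (b%:R ^+ d)^-1 *
      \sum_(v <- box (cube_corner (0 : Zd d) b) b) C * 0); last first.
    by rewrite big1 ?mulr0// => v _; rewrite mulr0.
  apply: cvgM; first exact: cvg_cst.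
  apply: cvg_big => [|v _]; first exact: add_continuous.
  by apply: cvgM; [exact: cvg_cst|exact: (deltaP v).1].
move=> n z.
have -> : lattice_mean p (L n) (fun u => block_mean A b (z + u)) =
    (b%:R ^+ d)^-1 * \sum_(v <- box (cube_corner 0 b) b)
      lattice_mean p (L n) (fun u => A (v + (z + u))).
  rewrite -(lattice_mean_sum p_L1 (B := C))//.
  rewrite -(lattice_meanZ p_L1 (B := b%:R ^+ d * C))// => u.
  rewrite (le_trans (ler_norm_sum _ _ _))//.
  by rewrite (le_trans (ler_sum _ (fun v _ => AC _)))// sum_cst_box.
have -> : lattice_mean p (L n) (fun u => A (z + u)) =
    (b%:R ^+ d)^-1 * \sum_(v <- box (cube_corner (0 : Zd d) b) b)
      lattice_mean p (L n) (fun u => A (z + u)).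
  by rewrite sum_cst_box mulrA mulVf ?mul1r// gt_eqF.
rewrite -mulrBr -sumrB normrM (ger0_norm bdV) ler_wpM2l//.
rewrite (le_trans (ler_norm_sum _ _ _))//; apply: ler_sum => v _.
rewrite (_ : (fun u => A (v + (z + u))) = fun u => A (z + (u + v))); last first.
  by apply/funext => u; rewrite addrC addrA.
exact: ((deltaP v).2 n C (fun u => A (z + u)) (fun u => AC _)).
Qed.

Section observables.
Variables (Phi1 Phi2 : M * Zd d -> R) (Phi1bar Phi2bar C1 C2 : R).
Hypotheses (G1 : GAO nu Phi1 Phi1bar) (G2 : GAO nu Phi2 Phi2bar).
Hypotheses (C1_ge0 : 0 <= C1) (C2_ge0 : 0 <= C2).
Hypotheses (Phi1C : forall x, `|Phi1 x| <= C1) (Phi2C : forall x, `|Phi2 x| <= C2).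

Let c1 : unif_continuous Phi1. Proof. by case: G1. Qed.
Let c2 : unif_continuous Phi2. Proof. by case: G2. Qed.
Let m1 := measurable_observable M_borel c1.
Let m2 := measurable_observable M_borel c2.

Let A1 := slice_mean nu Phi1.
Let A2 := slice_mean nu Phi2.

Let A1C u : `|A1 u| <= C1.
Proof. by apply: Rint_prob_le => //; exact: (measurable_slice u M_borel c1). Qed.

Let A2C u : `|A2 u| <= C2.
Proof. by apply: Rint_prob_le => //; exact: (measurable_slice u M_borel c2). Qed.

(* The correlation over the fibre above [z]. *)
Let corr n z := \int[nu]_y (Phi1 (y, z) * Phi2 (iter n f y, z + tau_ n y)).

(** The block size is fixed by [eta], the time [n] is taken large next, and only
    then the cube: [W] depends on [n] because of the tail of the displacement. *)
Lemma cube_mixing (eta : R) : 0 < eta ->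
  \forall n \near \oo, exists W : nat, forall w c, (W <= w)%N -> (0 < w)%N ->
    through0 c w -> `|box_mean (corr n) c w - Phi1bar * Phi2bar| <= eta.
Proof.
move=> eta0.
pose K := 1 + C1 + C1 + `|Phi2bar|.
have K0 : 0 < K by rewrite /K -!addrA ltr_pwDl// !addr_ge0.
pose eps := eta / K.
have eps0 : 0 < eps by rewrite divr_gt0.
have AA1 := GAO_almost_averages m1 Phi1C G1.
have AA2 := GAO_almost_averages m2 Phi2C G2.
have [b b0 Hb] := lattice_mean_block_dev p_ge0 p_L1 p_int1 A2C AA2 eps0.
have [delta delta0 Hdelta] := lattice_mean_block A2C b0.
have Hdec := skew_decoupling M_borel M_compact mf mtau L_gt0 llt p_ge0 p_int
  c1 c2 Phi1C Phi2C eps0.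
have [W1 HW1] := box_mean_through0 A1C AA1 eps0.
have Hde := cvgr0_norm_le _ delta0 _ eps0.
near=> n.
have dec : forall z,
    `|corr n z - A1 z * lattice_mean p (L n) (fun u => A2 (z + u))| <= eps.
  by near: n; exact: Hdec.
have del : delta n <= eps.
  by rewrite (le_trans (ler_norm _))//; near: n; exact: Hde.
have [W2 HW2] := Hb (L n) (L_gt0 n).
exists (W1 + W2)%N => w c Ww w0 cw.
have wd0 : 0 < w%:R ^+ d :> R by rewrite exprn_gt0// ltr0n.
have wdV : 0 <= (w%:R ^+ d)^-1 :> R by rewrite invr_ge0 ltW.
have h1 := HW1 w c (leq_trans (leq_addr _ _) Ww) w0 cw.
have h2 := HW2 w c (leq_trans (leq_addl _ _) Ww) w0 cw.
pose B z := lattice_mean p (L n) (fun u => block_mean A2 b (z + u)).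
have dist z : `|corr n z - A1 z * Phi2bar| <=
    eps + C1 * eps + C1 * `|B z - Phi2bar|.
  pose E := lattice_mean p (L n) (fun u => A2 (z + u)).
  have -> : corr n z - A1 z * Phi2bar =
    (corr n z - A1 z * E) + A1 z * (E - B z) + A1 z * (B z - Phi2bar) by ring.
  rewrite (le_trans (ler_normD _ _))//.
  rewrite (le_trans (lerD (ler_normD _ _) (lexx _)))// !normrM.
  apply: lerD; last by rewrite ler_wpM2r.
  apply: lerD; first exact: dec.
  by rewrite ler_pM// distrC (le_trans (Hdelta n z)).
have main : `|box_mean (corr n) c w - box_mean A1 c w * Phi2bar| <=
    eps + C1 * eps + C1 * eps.
  rewrite /box_mean -mulrA -mulrBr mulr_suml -sumrB normrM (ger0_norm wdV).
  rewrite mulrC ler_pdivrMr// (le_trans (ler_norm_sum _ _ _))//.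
  rewrite (le_trans (ler_sum _ (fun z _ => dist z)))//.
  rewrite big_split /= sum_cst_box -mulr_sumr [leRHS]mulrC [leRHS]mulrDr lerD//.
  by rewrite [leRHS]mulrCA ler_wpM2l.
have -> : box_mean (corr n) c w - Phi1bar * Phi2bar =
  (box_mean (corr n) c w - box_mean A1 c w * Phi2bar) +
  (box_mean A1 c w - Phi1bar) * Phi2bar by ring.
rewrite (le_trans (ler_normD _ _))// normrM.
have h3 : `|box_mean A1 c w - Phi1bar| * `|Phi2bar| <= eps * `|Phi2bar|.
  by rewrite ler_wpM2r.
have -> : eta = K * eps by rewrite /eps mulrC divfK// gt_eqF.
by rewrite /K; lra.
Unshelve. all: by end_near. Qed.

Hypothesis d_gt0 : (0 < d)%N.

Lemma cubes_through0P (z : Zd d) (w : nat) :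
  cubes_through0 M (z, w) <-> (0 < w)%N /\ through0 (cube_corner z w) w.
Proof.
split=> [[/= w0 H]|[w0 H]]; split => //=.
  have : cube (M := M) z w (point, 0) by exact: H.
  by rewrite cubeE => /mem_box K i; have := K i; rewrite /= [coordZ 0 i]mxE.
move=> [y u] /= ->; rewrite cubeE; apply/mem_box => i /=.
by rewrite [coordZ 0 i]mxE; exact: H.
Qed.

Lemma large_cubes_sizes (W : nat) :
  large_cubes (d := d) nu [set zw | cubes_through0 M zw /\ (W <= zw.2)%N].
Proof.
exists (W%:R ^+ d : R) => // -[z w] [H1 /=].
rewrite skew_measure_cube lte_fin => H2; split => //=.
rewrite leqNgt; apply/negP => wW; move: H2; rewrite ltNge => /negP; apply.
by rewrite lerXn2r ?nnegrE// ler_nat ltnW.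
Qed.

Lemma large_cubes_proper : ProperFilter (large_cubes (d := d) nu).
Proof.
apply: filter_from_proper; first apply: filter_from_filter.
- by exists 0.
- move=> a b _ _; exists (Num.max a b) => // zw [H]; rewrite /= EFin_max gt_max.
  by move=> /andP[].
- move=> C _; pose w := (Num.truncn `|C|).+2.
  have wC : C < w%:R.
    rewrite (le_lt_trans (ler_norm C))// (lt_trans (truncnS_gt _))//.
    by rewrite ltr_nat.
  exists (0, w); split; last first.
    rewrite /= skew_measure_cube lte_fin (lt_le_trans wC)//.
    by rewrite ler_eXnr// ler1n.
  apply/cubes_through0P; split => // i.
  by rewrite coordZ_row [coordZ 0 i]mxE; lia.
Qed.

Lemma global_global_cvg :
  let avg (n : nat) (zw : Zd d * nat) : \bar R :=
    (average nu (cube zw.1 zw.2)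
      (fun x => Phi1 x * Phi2 (iter n (skew_map f tau) x)))%:E in
  (limf_esup (avg n) (large_cubes (d := d) nu) @[n --> \oo]
     --> (Phi1bar * Phi2bar)%:E) /\
  (limf_einf (avg n) (large_cubes (d := d) nu) @[n --> \oo]
     --> (Phi1bar * Phi2bar)%:E).
Proof.
move=> avg; have FP := large_cubes_proper.
have mT n : measurable_fun setT (fun x => Phi2 (iter n (skew_map f tau) x)).
  rewrite (_ : (fun x => _) = fun x => Phi2 (iter n f x.1, x.2 + tau_ n x.1)).
    by apply: measurable_from_slices => z; exact: measurable_skew_slice.
  by apply/funext => x; rewrite iter_skew_map.
have near_avg eta : 0 < eta -> \forall n \near \oo,
    large_cubes (d := d) nu [set zw | `|average nu (cube zw.1 zw.2)
      (fun x => Phi1 x * Phi2 (iter n (skew_map f tau) x))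
      - Phi1bar * Phi2bar| <= eta].
  move=> eta0; apply: filterS (cube_mixing eta0) => n [W HW].
  apply: filterS (large_cubes_sizes W) => -[z w] [/cubes_through0P[w0 cw] /= Ww].
  rewrite (average_cube nu (C := C1 * C2)).
  - rewrite (_ : slice_mean _ _ = corr n); first exact: HW.
    apply/funext => u; apply: eq_Rintegral => y _.
    by rewrite iter_skew_map.
  - exact: measurable_funM.
  - by move=> x; rewrite normrM ler_pM.
split; apply: cvg_ereal_near => eta eta0.
  by apply: filterS (near_avg _ eta0) => n; exact: limf_esup_near.
by apply: filterS (near_avg _ eta0) => n; exact: limf_einf_near.
Qed.

End observables.
End global_global.

(** * Mixing of the skew product *)

Theorem theorem2p4 (R : realType) (d : nat) (d_ge1 : (1 <= d)%N)
    (disp : measure_display) (M : measurableMetricType disp R)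
    (M_borel : borel_space M) (M_compact : compact [set: M])
    (nu : probability M R) (f : M -> M) (f_nu : measure_preserving nu f)
    (tau : M -> Zd d) (tau_meas : measurable_fun setT tau)
    (L : nat -> R) (mllt : MLLT nu f tau L) :
  local_global_mixing nu (skew_map f tau) (GO nu) /\
  global_global_mixing nu (skew_map f tau) (GAO nu).
Proof.
have [p [p_cont p_bnd p_ge0 p_int llt]] := MLLT_pointwise mllt.
have [L_gt0 Loo _] := mllt; have [mf _] := f_nu.
split.
  move=> phi Phi Phibar iphi PhiG.
  have [C C0 PhiC] : exists2 C : R, 0 <= C & forall x, `|Phi x| <= C.
    by case: PhiG => bPhi _ _; exact: bounded_observable.
  exact: (local_global_cvg M_borel M_compact mf tau_meas L_gt0 Loo llt p_cont
    p_bnd p_ge0 p_int PhiG C0 PhiC iphi).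
move=> Phi1 Phi2 Phi1bar Phi2bar G1 G2.
have [C1 C1_ge0 Phi1C] : exists2 C : R, 0 <= C & forall x, `|Phi1 x| <= C.
  by case: G1 => bPhi _ _; exact: bounded_observable.
have [C2 C2_ge0 Phi2C] : exists2 C : R, 0 <= C & forall x, `|Phi2 x| <= C.
  by case: G2 => bPhi _ _; exact: bounded_observable.
exact: (global_global_cvg M_borel M_compact mf tau_meas L_gt0 llt p_ge0 p_int
  G1 G2 C1_ge0 C2_ge0 Phi1C Phi2C d_ge1).
Qed.
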